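(* Let $k$ be an algebraically closed field and let $A$ be a finite-dimensional representation-finite $k$-algebra. If $A$ has finite global dimension, then $$\det C(A)=1,$$ where $C(A)$ is the Cartan matrix of $A$.
   Context: All algebras are associative and unital. All modules are finite-dimensional right modules. A finite-dimensional algebra is representation-finite if it has only finitely many isomorphism classes of finite-dimensional indecomposable modules. An algebra is basic if, as a right module over itself, its indecomposable direct summands are pairwise nonisomorphic. For a basic finite-dimensional $k$-algebra $A$ with a complete set $e_1,\ldots,e_n$ of primitive orthogonal idempotents, the Cartan matrix is $$C(A)=\bigl(\dim_k e_iAe_j\bigr)_{i,j=1}^{n}.$$ For a general finite-dimensional algebra, $\det C(A)$ means the Cartan determinant of a basic algebra Morita equivalent to $A$. Cartan determinants, finiteness of global dimension and representation-finiteness are invariant under Morita equivalence. *)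

(* Defs.v *)
From HB Require Import structures.
From mathcomp Require Import all_boot all_order all_algebra all_field.

Set Implicit Arguments.
Unset Strict Implicit.
Unset Printing Implicit Defensive.

Import GRing.Theory.
Local Open Scope ring_scope.

(* Finite-dimensional right A-modules: [ract m a] is m . a.  MathComp's own
   modules are left modules over the base ring, here only the field k.  The
   zero module is allowed. *)
Record rmodule (k : fieldType) (A : falgType k) : Type := RModule {
  rcarrier :> vectType k;
  ract : rcarrier -> A -> rcarrier;
  ract_linearl : forall (a : A) (c : k) (m m' : rcarrier),
    ract (c *: m + m') a = c *: ract m a + ract m' a;
  ract_linearr : forall (m : rcarrier) (c : k) (a b : A),
    ract m (c *: a + b) = c *: ract m a + ract m b;
  ract1 : forall m : rcarrier, ract m 1 = m;
  ractM : forall (m : rcarrier) (a b : A), ract m (a * b) = ract (ract m a) b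
}.

Section RegularModule.
Variables (k : fieldType) (A : falgType k).

Fact regular_linearl (a : A) (c : k) (m m' : A) :
  (c *: m + m') * a = c *: (m * a) + m' * a.
Proof. by rewrite mulrDl scalerAl. Qed.

Fact regular_linearr (m : A) (c : k) (a b : A) :
  m * (c *: a + b) = c *: (m * a) + m * b.
Proof. by rewrite mulrDr scalerAr. Qed.

Definition regular_rmodule : rmodule A :=
  @RModule k A A (fun m a => m * a) regular_linearl regular_linearr
    (@mulr1 A) (@mulrA A).

End RegularModule.

Section Submodule.
Variables (k : fieldType) (A : falgType k) (M : rmodule A).

Definition is_submodule (U : {vspace M}) : Prop :=
  forall (m : M) (a : A), m \in U -> ract m a \in U.

Variables (U : {vspace M}) (sU : is_submodule U).

Definition submod_act (u : subvs_of U) (a : A) : subvs_of U :=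
  vsproj U (ract (vsval u) a).

Fact submod_actE u a : vsval (submod_act u a) = ract (vsval u) a.
Proof. by rewrite vsprojK //; apply: sU; apply: subvsP. Qed.

Fact submod_linearl a c u u' :
  submod_act (c *: u + u') a = c *: submod_act u a + submod_act u' a.
Proof.
by apply: subvs_inj; rewrite linearP !submod_actE linearP
  ract_linearl /= !submod_actE.
Qed.

Fact submod_linearr u c a b :
  submod_act u (c *: a + b) = c *: submod_act u a + submod_act u b.
Proof.
by apply: subvs_inj; rewrite linearP !submod_actE ract_linearr
  /= !submod_actE.
Qed.

Fact submod_act1 u : submod_act u 1 = u.
Proof. by apply: subvs_inj; rewrite submod_actE ract1. Qed.

Fact submod_actM u a b : submod_act u (a * b) = submod_act (submod_act u a) b.
Proof. by apply: subvs_inj; rewrite !submod_actE ractM. Qed.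

Definition submod : rmodule A :=
  RModule submod_linearl submod_linearr submod_act1 submod_actM.

End Submodule.

Section Modules.
Variables (k : fieldType) (A : falgType k).

Definition module_hom (M N : rmodule A) (f : 'Hom(M, N)) : Prop :=
  forall (m : M) (a : A), f (ract m a) = ract (f m) a.

Definition module_iso (M N : rmodule A) (f : 'Hom(M, N)) : Prop :=
  module_hom f /\
  exists g : 'Hom(N, M),
    [/\ module_hom g, (g \o f)%VF = \1%VF & (f \o g)%VF = \1%VF].

Definition isomorphic (M N : rmodule A) : Prop :=
  exists f : 'Hom(M, N), module_iso f.

Definition indecomposable (M : rmodule A) : Prop :=
  {: M}%VS <> 0%VS /\
  forall U V : {vspace M}, is_submodule U -> is_submodule V ->
    (U + V)%VS = fullv -> (U :&: V)%VS = 0%VS -> U = 0%VS \/ V = 0%VS.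

Definition projective (P : rmodule A) : Prop :=
  forall (M N : rmodule A) (g : 'Hom(M, N)) (f : 'Hom(P, N)),
    module_hom g -> limg g = fullv -> module_hom f ->
    exists2 h : 'Hom(P, M), module_hom h & (g \o h)%VF = f.

(* M has a projective resolution
     0 -> P n -> ... -> P 1 -> P 0 -> M -> 0. *)
Definition pdim_le (M : rmodule A) (n : nat) : Prop :=
  exists (P : nat -> rmodule A) (d : forall i, 'Hom(P i.+1, P i))
         (eps : 'Hom(P 0%N, M)),
    [/\ forall i, projective (P i),
        forall i, module_hom (d i) /\ lker (d i) = limg (d i.+1),
        module_hom eps /\ lker eps = limg (d 0%N),
        limg eps = fullv &
        forall i, (n < i)%N -> {: P i}%VS = 0%VS].

End Modules.

Definition representation_finite (k : fieldType) (A : falgType k) : Prop :=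
  exists (r : nat) (X : 'I_r -> rmodule A),
    forall M : rmodule A, indecomposable M -> exists i, isomorphic M (X i).

Definition finite_global_dimension (k : fieldType) (A : falgType k) : Prop :=
  exists n : nat, forall M : rmodule A, pdim_le M n.

Definition basic (k : fieldType) (A : falgType k) : Prop :=
  forall (n : nat) (U : 'I_n -> {vspace regular_rmodule A})
         (sU : forall i, is_submodule (U i)),
    directv (\sum_(i < n) U i) -> (\sum_(i < n) U i)%VS = fullv ->
    (forall i, indecomposable (submod (sU i))) ->
    forall i j : 'I_n, i != j -> ~ isomorphic (submod (sU i)) (submod (sU j)).

(* k-linear functors between categories of finite-dimensional right modules;
   only the values of [fmor] on module homomorphisms are meaningful. *)
Record mod_functor (k : fieldType) (A B : falgType k) : Type := ModFunctor {
  fobj :> rmodule A -> rmodule B;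
  fmor : forall M N : rmodule A, 'Hom(M, N) -> 'Hom(fobj M, fobj N);
  fmor_hom : forall (M N : rmodule A) (f : 'Hom(M, N)),
    module_hom f -> module_hom (fmor f);
  fmor_id : forall M : rmodule A, fmor (\1%VF : 'Hom(M, M)) = \1%VF;
  fmor_comp : forall (L M N : rmodule A) (f : 'Hom(L, M)) (g : 'Hom(M, N)),
    module_hom f -> module_hom g ->
    fmor (g \o f)%VF = (fmor g \o fmor f)%VF;
  fmor_linear : forall (M N : rmodule A) (c : k) (f g : 'Hom(M, N)),
    module_hom f -> module_hom g ->
    fmor (c *: f + g) = c *: fmor f + fmor g
}.

Definition morita_equivalent (k : fieldType) (A B : falgType k) : Prop :=
  exists (F : mod_functor A B) (G : mod_functor B A)
         (eta : forall M : rmodule A, 'Hom(M, G (F M)))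
         (eps : forall N : rmodule B, 'Hom(F (G N), N)),
    [/\ forall M, module_iso (eta M),
        forall (M M' : rmodule A) (f : 'Hom(M, M')), module_hom f ->
          (eta M' \o f)%VF = (fmor G (fmor F f) \o eta M)%VF,
        forall N, module_iso (eps N) &
        forall (N N' : rmodule B) (f : 'Hom(N, N')), module_hom f ->
          (eps N' \o fmor F (fmor G f))%VF = (f \o eps N)%VF].

Definition orthogonal_idempotents (k : fieldType) (A : falgType k) (n : nat)
    (e : 'I_n -> A) : Prop :=
  forall i j : 'I_n, e i * e j = if i == j then e i else 0.

Definition primitive_idempotent (k : fieldType) (A : falgType k) (e : A) :
    Prop :=
  [/\ e * e = e, e <> 0 &
      forall f g : A, f * f = f -> g * g = g -> f * g = 0 -> g * f = 0 ->
        e = f + g -> f = 0 \/ g = 0].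

Definition complete_primitive_orthogonal (k : fieldType) (A : falgType k)
    (n : nat) (e : 'I_n -> A) : Prop :=
  [/\ orthogonal_idempotents e, forall i, primitive_idempotent (e i) &
      \sum_(i < n) e i = 1].

(* The product of subspaces <[e i]> * {:A} * <[e j]> is e_i A e_j. *)
Definition cartan_matrix (k : fieldType) (A : falgType k) (n : nat)
    (e : 'I_n -> A) : 'M[int]_n :=
  \matrix_(i, j) (\dim (<[e i]> * {: A} * <[e j]>)%VS)%:Z.

(* Main.v *)
From HB Require Import structures.
Require Import Defs.
From mathcomp Require Import all_boot all_order all_algebra all_field.
From Stdlib Require Import Classical ClassicalEpsilon.
Import GRing.Theory.
Local Open Scope ring_scope.

Set Implicit Arguments.
Unset Strict Implicit.
Unset Printing Implicit Defensive.

(** If the algebra were positively graded with semisimple part of degree zero,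
    its graded Cartan matrix [C(q)] over [Z[q]] would satisfy [C(0) = 1], and
    finite minimal graded resolutions of the simple modules would provide an
    inverse of [C(q)] over [Z[q]]. Then [det C(q)] is a unit of [Z[q]], hence
    constant, equal to [det C(0) = 1], and [q = 1] gives the claim. A
    representation-finite algebra need not come with such a grading, but it has a
    covering that is just as good.

    Let the [X v] represent the finitely many indecomposable modules, and filter
    the hom spaces [Hom(X i, X j)] by the powers of the radical of the category.
    Choosing maps (arrows) that lift bases of [rad / rad ^ 2] presents the
    category, and the relations between arrows come from the almost split
    sequences [X w -> Y -> X z]. The arrows cannot in general be chosen once and
    for all so that the relations are quadratic. They can, however, be chosen
    depth by depth: given the arrows from depth [n + 1] to depth [n], the kernels
    of the resulting sink maps [Y -> X z] provide the arrows from depth [n + 2] to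
    depth [n + 1] out of the translates ([next_level]), while those out of
    the other vertices are arbitrary. Almost split sequences are obtained directly
    from finiteness: the sink map is the projective cover of [rad(-, X z)], which
    exists because the radical is nilpotent ([rad_pow_nilpotent]), and a pushout
    argument shows that its kernel is left almost split and indecomposable
    ([kernel_of_sink_left_almost_split], [kernel_of_sink_indecomposable]).

    Products of [m] arrows ending at depth [n] span subspaces [piece m n i j] of
    [Hom(X i, X j)]. Since all relations between arrows are now homogeneous, the
    hom space is the direct sum of its pieces ([pieces_independent]), and their
    dimensions are those of the layers of the radical filtration ([dim_piece]),
    whatever the depth [n]. This is the covering functor from the mesh category
    of the Auslander-Reiten quiver, unrolled along the length of paths, to the
    category of modules.

    Restricted to the indecomposable projectives, the pieces play the role of the
    grading. Modules whose hom spaces from the projectives decompose compatibly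
    with the pieces ([lifted]) have minimal projective resolutions of the same
    kind, which stop when the projective dimension is finite ([lifted_syzygy],
    [lifted_gdim]). Applied to the radicals of the indecomposable projectives
    this inverts the graded Cartan matrix ([cartan_poly_inverse]).

    Finally, a Morita equivalence carries the modules [e_i B] to a complete list
    of indecomposable projectives over [A] with the same hom spaces, whose
    dimensions are the entries of the transpose of the Cartan matrix of [B]. *)

Notation "f \c g" := (comp_lfun f g) (at level 40, left associativity).

(** * Linear algebra *)

Section LinearAlgebra.
Variable k : fieldType.

Lemma comp_lfun_suml (U V W : vectType k) (I : Type) (r : seq I) (P : pred I)
    (F : I -> 'Hom(V, W)) (g : 'Hom(U, V)) :
  (\sum_(i <- r | P i) F i) \c g = \sum_(i <- r | P i) F i \c g.
Proof.
by apply: (big_morph (fun f => f \c g)) => [f f'|];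
  rewrite ?comp_lfunDl ?comp_lfun0l.
Qed.

Lemma comp_lfun_sumr (U V W : vectType k) (I : Type) (r : seq I) (P : pred I)
    (F : I -> 'Hom(U, V)) (g : 'Hom(V, W)) :
  g \c (\sum_(i <- r | P i) F i) = \sum_(i <- r | P i) g \c F i.
Proof.
by apply: (big_morph (fun f => g \c f)) => [f f'|];
  rewrite ?comp_lfunDr ?comp_lfun0r.
Qed.

Lemma comp_lfunBl (U V W : vectType k) (f f' : 'Hom(V, W)) (g : 'Hom(U, V)) :
  (f - f') \c g = f \c g - f' \c g.
Proof. by rewrite comp_lfunDl comp_lfunNl. Qed.

Lemma comp_lfunBr (U V W : vectType k) (f f' : 'Hom(U, V)) (g : 'Hom(V, W)) :
  g \c (f - f') = g \c f - g \c f'.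
Proof. by rewrite comp_lfunDr comp_lfunNr. Qed.

Lemma scale_comp (U V W : vectType k) (c : k) (f : 'Hom(V, W)) (g : 'Hom(U, V)) :
  (c *: f) \c g = c *: (f \c g).
Proof. by rewrite comp_lfunZl. Qed.

Lemma comp_scale (U V W : vectType k) (c : k) (f : 'Hom(V, W)) (g : 'Hom(U, V)) :
  f \c (c *: g) = c *: (f \c g).
Proof. by rewrite comp_lfunZr. Qed.

(** Predicates of homs such as linearity over [A] or membership in the radical
    are classical propositions; this turns them into subspaces, so that the
    dimension theory applies. *)
Lemma vspace_of_prop (V : vectType k) (P : V -> Prop) :
    P 0 -> (forall c u v, P u -> P v -> P (c *: u + v)) ->
  exists U : {vspace V}, forall v, v \in U <-> P v.
Proof.
move=> P0 PL.
suff: forall n (U : {vspace V}), (forall u, u \in U -> P u) ->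
    (\dim {:V} - \dim U < n)%N ->
    exists U' : {vspace V}, forall v, v \in U' <-> P v.
  by move/(_ (\dim {:V}).+1 0%VS); apply=> [u /[!memv0]/eqP->|] //;
    rewrite ltnS leq_subr.
elim=> [|n IHn] // U sUP lt_n.
case: (classic (exists2 v, P v & v \notin U)) => [[v Pv nUv]|noext].
  apply: (IHn (U + <[v]>)%VS) => [u /memv_addP[u' Uu' [_ /vlineP[c ->] ->]]|].
    by rewrite addrC; apply: PL => //; apply: sUP.
  have ltU : (\dim U < \dim (U + <[v]>))%N.
    rewrite ltn_neqAle dimvS ?addvSl // andbT eqn_leq dimvS ?addvSl //=.
    apply/negP=> leUv; case/negP: nUv.
    have /eqP-> : U == (U + <[v]>)%VS by rewrite eqEdim addvSl.
    by rewrite memvE addvSr.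
  have := dimvS (subvf (U + <[v]>)); move: lt_n ltU.
  set a := \dim U; set b := \dim _; set d := \dim _ => lt_n ltU led.
  rewrite ltnS in lt_n; apply: leq_trans lt_n.
  by rewrite ltn_sub2l // (leq_trans ltU).
exists U => v; split=> [/sUP//|Pv].
by apply/negPn/negP => nUv; apply: noext; exists v.
Qed.

Lemma full_eq (V : vectType k) (U : {vspace V}) : (forall v, v \in U) -> U = fullv.
Proof.
by move=> UV; apply/eqP; rewrite eqEsubv subvf; apply/subvP=> v _; apply: UV.
Qed.

Lemma zero_eq (V : vectType k) (U : {vspace V}) :
  (forall v, v \in U -> v = 0) -> U = 0%VS.
Proof.
move=> U0; apply/eqP; rewrite -subv0; apply/subvP=> v /U0->; exact: mem0v.
Qed.

End LinearAlgebra.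

(** * Module homomorphisms *)

Section Homs.
Variables (k : fieldType) (A : falgType k).
Implicit Types K L M N : rmodule A.

Lemma homv_exists M N :
  exists U : {vspace 'Hom(M, N)}, forall f, f \in U <-> module_hom f.
Proof.
apply: vspace_of_prop => [m a|c f g hf hg m a].
  rewrite !lfunE /=; have := ract_linearl a (-1) (0 : N) 0.
  by rewrite scaler0 addr0 scaleN1r addNr => ->.
by rewrite !lfunE /= !lfunE /= hf hg ract_linearl.
Qed.

Definition homv M N : {vspace 'Hom(M, N)} :=
  proj1_sig (constructive_indefinite_description _ (homv_exists M N)).

Lemma homvP M N (f : 'Hom(M, N)) : f \in homv M N <-> module_hom f.
Proof. by rewrite /homv; case: constructive_indefinite_description => U /= ->. Qed.

Lemma ractE M N (f : 'Hom(M, N)) m a :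
  f \in homv M N -> f (ract m a) = ract (f m) a.
Proof. by move/homvP. Qed.

Lemma hom_comp L M N (f : 'Hom(M, N)) (g : 'Hom(L, M)) :
  f \in homv M N -> g \in homv L M -> f \c g \in homv L N.
Proof.
by move=> hf hg; apply/homvP=> m a; rewrite !comp_lfunE (ractE _ _ hg) ractE.
Qed.

Lemma hom_id M : \1%VF \in homv M M.
Proof. by apply/homvP=> m a; rewrite !id_lfunE. Qed.

Lemma ractDl M (m m' : M) a : ract (m + m') a = ract m a + ract m' a.
Proof. by have := ract_linearl a 1 m m'; rewrite !scale1r. Qed.

Lemma ract0l M a : ract (0 : M) a = 0.
Proof.
have := ractDl (0 : M) 0 a; rewrite addr0 => /(congr1 (fun x => x - ract 0 a)).
by rewrite subrr addrK.
Qed.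

Lemma ractZl M (m : M) c a : ract (c *: m) a = c *: ract m a.
Proof. by have := ract_linearl a c m 0; rewrite !addr0 ract0l addr0. Qed.

Lemma ractZr M (m : M) c a : ract m (c *: a) = c *: ract m a.
Proof.
have r0 : ract m 0 = 0.
  have := ract_linearr m 1 0 0; rewrite scale1r addr0 scale1r.
  by move/(congr1 (fun x => x - ract m 0)); rewrite subrr addrK.
by have := ract_linearr m c a 0; rewrite !addr0 r0 addr0.
Qed.

Definition isom M N (f : 'Hom(M, N)) : Prop :=
  f \in homv M N /\
  exists2 g : 'Hom(N, M), g \in homv N M & g \c f = \1%VF /\ f \c g = \1%VF.

Lemma isomP M N (f : 'Hom(M, N)) : isom f <-> module_iso f.
Proof.
split=> [[/homvP hf [g /homvP hg [gf fg]]]|[hf [g [hg gf fg]]]].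
  by split=> //; exists g.
by split; [apply/homvP | exists g => //; apply/homvP].
Qed.

Lemma isom_id M : isom (\1%VF : 'Hom(M, M)).
Proof.
by split; rewrite ?hom_id //; exists \1%VF; rewrite ?hom_id ?comp_lfun1l.
Qed.

Lemma isom_comp L M N (f : 'Hom(M, N)) (g : 'Hom(L, M)) :
  isom f -> isom g -> isom (f \c g).
Proof.
case=> hf [f' hf' [f'f ff']] [hg [g' hg' [g'g gg']]].
split; first exact: hom_comp.
exists (g' \c f'); first exact: hom_comp.
split; rewrite -comp_lfunA.
  by rewrite (comp_lfunA f') f'f comp_lfun1l.
by rewrite (comp_lfunA g) gg' comp_lfun1l.
Qed.

Lemma isom_inv M N (f : 'Hom(M, N)) :
  isom f -> exists2 g : 'Hom(N, M), isom g & g \c f = \1%VF /\ f \c g = \1%VF.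
Proof.
by case=> hf [g hg [gf fg]]; exists g => //; split=> //; exists f.
Qed.

Lemma isomorphicP M N : isomorphic M N <-> exists f : 'Hom(M, N), isom f.
Proof. by split=> -[f /isomP]; exists f. Qed.

Lemma isomorphic_sym M N : isomorphic M N -> isomorphic N M.
Proof.
by case/isomorphicP=> f /isom_inv[g ig _]; apply/isomorphicP; exists g.
Qed.

Lemma isomorphic_trans L M N :
  isomorphic L M -> isomorphic M N -> isomorphic L N.
Proof.
move=> /isomorphicP[g ig] /isomorphicP[f jf]; apply/isomorphicP.
by exists (f \c g); apply: isom_comp.
Qed.

Lemma lker_submodule M N (f : 'Hom(M, N)) :
  f \in homv M N -> is_submodule (lker f).
Proof.
by move=> hf m a; rewrite !memv_ker ractE // => /eqP->; rewrite ract0l.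
Qed.

Lemma limg_submodule M N (f : 'Hom(M, N)) :
  f \in homv M N -> is_submodule (limg f).
Proof.
move=> hf _ a /memv_imgP[m _ ->]; rewrite -ractE //.
by apply: memv_img; rewrite memvf.
Qed.

Definition zero_mod M := {: M}%VS = 0%VS.

Lemma zero_modE M : zero_mod M <-> (\1%VF : 'Hom(M, M)) = 0.
Proof.
split=> [z|id0].
  apply/lfunP=> m; rewrite id_lfunE lfunE /=.
  by have := memvf m; rewrite z memv0 => /eqP.
apply/eqP; rewrite -subv0; apply/subvP=> m _.
by rewrite memv0 -[m]id_lfunE id0 lfunE.
Qed.

Lemma hom_zerol M N (f : 'Hom(M, N)) : zero_mod M -> f = 0.
Proof. by move/zero_modE=> id0; rewrite -[f]comp_lfun1r id0 comp_lfun0r. Qed.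

Lemma hom_zeror M N (f : 'Hom(M, N)) : zero_mod N -> f = 0.
Proof. by move/zero_modE=> id0; rewrite -[f]comp_lfun1l id0 comp_lfun0l. Qed.

Definition mono M N (f : 'Hom(M, N)) := f \in homv M N /\ lker f = 0%VS.
Definition epi M N (f : 'Hom(M, N)) := f \in homv M N /\ limg f = fullv.

Lemma mono_cancel L M N (f : 'Hom(M, N)) (g g' : 'Hom(L, M)) :
  mono f -> f \c g = f \c g' -> g = g'.
Proof.
case=> _ /eqP f0 eq_fg; apply/lfunP=> m; apply: (lker0P f0).
by rewrite -!comp_lfunE eq_fg.
Qed.

Lemma epi_cancel L M N (f : 'Hom(L, M)) (g g' : 'Hom(M, N)) :
  epi f -> g \c f = g' \c f -> g = g'.
Proof.
case=> _ fT eq_fg; apply/lfunP=> m.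
have /memv_imgP[l _ ->] : m \in limg f by rewrite fT memvf.
by rewrite -!comp_lfunE eq_fg.
Qed.

Lemma bij_isom M N (f : 'Hom(M, N)) : mono f -> epi f -> isom f.
Proof.
move=> [hf /eqP f0] [_ fT]; split=> //.
have Vf : f^-1%VF \c f = \1%VF by apply: lker0_compVf.
have fV : f \c f^-1%VF = \1%VF.
  apply/lfunP=> m; rewrite comp_lfunE id_lfunE limg_lfunVK //.
  by rewrite fT memvf.
exists f^-1%VF => //; apply/homvP=> m a; apply: (lker0P f0).
by rewrite (ractE _ _ hf) -!comp_lfunE fV !id_lfunE.
Qed.

Lemma isom_mono M N (f : 'Hom(M, N)) : isom f -> mono f.
Proof.
case=> hf [g hg [gf _]]; split=> //; apply/eqP; rewrite -subv0.
apply/subvP=> m; rewrite memv_ker memv0 => /eqP fm0.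
by rewrite -[m]id_lfunE -gf comp_lfunE fm0 linear0.
Qed.

Lemma isom_epi M N (f : 'Hom(M, N)) : isom f -> epi f.
Proof.
case=> hf [g hg [_ fg]]; split=> //; apply: full_eq => m.
rewrite -[m]id_lfunE -fg comp_lfunE.
by apply: memv_img; rewrite memvf.
Qed.

Lemma factor_mono K M N (f : 'Hom(M, N)) (g : 'Hom(K, N)) :
    mono f -> g \in homv K N -> (limg g <= limg f)%VS ->
  exists2 h : 'Hom(K, M), h \in homv K M & g = f \c h.
Proof.
move=> [hf /eqP f0] hg sgf.
have eq_g : g = f \c (f^-1%VF \c g).
  apply/lfunP=> m; rewrite !comp_lfunE limg_lfunVK //.
  by apply: (subvP sgf); rewrite memv_img ?memvf.
exists (f^-1%VF \c g) => //; apply/homvP=> m a; apply: (lker0P f0).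
by rewrite (ractE _ _ hf) -!comp_lfunE -eq_g ractE.
Qed.

Lemma factor_epi K M N (f : 'Hom(M, N)) (g : 'Hom(M, K)) :
    epi f -> g \in homv M K -> (lker f <= lker g)%VS ->
  exists2 h : 'Hom(N, K), h \in homv N K & g = h \c f.
Proof.
move=> [hf fT] hg sfg.
have eq_g : g = g \c f^-1%VF \c f.
  apply/lfunP=> m; rewrite !comp_lfunE.
  apply/eqP; rewrite -subr_eq0 -linearB -memv_ker; apply: (subvP sfg).
  by rewrite memv_ker linearB subr_eq0 /= limg_lfunVK // memv_img ?memvf.
exists (g \c f^-1%VF) => //; apply/homvP=> m a.
have /memv_imgP[l _ ->] : m \in limg f by rewrite fT memvf.
by rewrite -ractE // -!(comp_lfunE _ f) -eq_g ractE.
Qed.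

Lemma submodule_mono M (U : {vspace M}) :
    is_submodule U ->
  exists (K : rmodule A) (i : 'Hom(K, M)), mono i /\ limg i = U.
Proof.
move=> sU; exists (submod sU).
pose v : {linear subvs_of U -> M} := vsval.
pose i : 'Hom(submod sU, M) := linfun v.
have iE (u : submod sU) : i u = vsval u by rewrite lfunE.
exists i; split.
  split.
    apply/homvP=> m a; rewrite !iE /=; exact: submod_actE.
  apply/eqP/lker0P=> u u'; rewrite !iE; exact: subvs_inj.
apply/vspaceP=> m; apply/memv_imgP/idP=> [[u _ ->]|Um].
  by rewrite iE subvsP.
by exists (vsproj U m); rewrite ?memvf // iE vsprojK.
Qed.

Lemma kernel_exists M N (f : 'Hom(M, N)) :
    f \in homv M N ->
  exists (K : rmodule A) (i : 'Hom(K, M)), mono i /\ limg i = lker f.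
Proof. by move=> hf; apply/submodule_mono/lker_submodule. Qed.

Section Quotient.
Variables (M : rmodule A) (U : {vspace M}) (sU : is_submodule U).
Let W := subvs_of (U^C)%VS.
Let q : 'Hom(M, W) :=
  linfun (vsproj (U^C)%VS : {linear M -> W}) \c daddv_pi (U^C)%VS U.

Let qE m : vsval (q m) = daddv_pi (U^C)%VS U m.
Proof. by rewrite comp_lfunE lfunE /= vsprojK // memv_pi. Qed.

Let UC0 : (U^C :&: U = 0)%VS.
Proof. by rewrite capvC capv_compl. Qed.

Let qK (w : W) : q (vsval w) = w.
Proof. by apply: subvs_inj; rewrite qE daddv_pi_id // subvsP. Qed.

Let qker m : (q m == 0) = (m \in U).
Proof.
have -> : (q m == 0) = (vsval (q m) == 0).
  apply/eqP/eqP=> [->|e]; first by rewrite linear0.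
  by apply: subvs_inj; rewrite e linear0.
rewrite qE; have mT : m \in (U^C + U)%VS by rewrite addvC addv_complf memvf.
apply/eqP/idP=> [p0|Um].
  rewrite -(daddv_pi_add UC0 mT) p0 add0r; exact: memv_pi.
have := daddv_pi_add UC0 mT; rewrite (daddv_pi_id _ Um) 1?capvC //.
by move/(congr1 (fun x => x - m)); rewrite addrK subrr.
Qed.

Let act (w : W) a : W := q (ract (vsval w) a).

Let act_q m a : act (q m) a = q (ract m a).
Proof.
rewrite /act; apply/eqP; rewrite -subr_eq0 -linearB qker.
have -> : ract (vsval (q m)) a - ract m a = ract (vsval (q m) - m) a.
  by rewrite ractDl -scaleN1r -ractZl scaleN1r.
by apply: sU; rewrite -qker linearB /= qK subrr.
Qed.

Fact quotient_linearl a c w w' : act (c *: w + w') a = c *: act w a + act w' a.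
Proof. by rewrite /act linearP ract_linearl linearP. Qed.
Fact quotient_linearr w c a b : act w (c *: a + b) = c *: act w a + act w b.
Proof. by rewrite /act ract_linearr linearP. Qed.
Fact quotient1 w : act w 1 = w.
Proof. by rewrite /act ract1 qK. Qed.
Fact quotientM w a b : act w (a * b) = act (act w a) b.
Proof. by have -> : act w a = q (ract (vsval w) a) by []; rewrite act_q -ractM. Qed.

Let Q : rmodule A :=
  RModule quotient_linearl quotient_linearr quotient1 quotientM.

Lemma quotient_epi : exists (N : rmodule A) (p : 'Hom(M, N)), epi p /\ lker p = U.
Proof.
exists Q, q; split; last by apply/vspaceP=> m; rewrite memv_ker qker.
split; first by apply/homvP=> m a; rewrite -act_q.
apply: full_eq => w; rewrite -[w]qK.
by rewrite memv_img ?memvf.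
Qed.

End Quotient.

Section Product.
Variables M N : rmodule A.
Let W : vectType k := (M * N)%type.
Let act (w : W) a : W := (ract w.1 a, ract w.2 a).
Fact product_linearl a c w w' : act (c *: w + w') a = c *: act w a + act w' a.
Proof. by rewrite /act !ract_linearl. Qed.
Fact product_linearr w c a b : act w (c *: a + b) = c *: act w a + act w b.
Proof. by rewrite /act !ract_linearr. Qed.
Fact product1 w : act w 1 = w.
Proof. by rewrite /act !ract1; case: w. Qed.
Fact productM w a b : act w (a * b) = act (act w a) b.
Proof. by rewrite /act !ractM. Qed.
Definition prod_mod : rmodule A :=
  RModule product_linearl product_linearr product1 productM.

Lemma prod_mod_biproduct :
  exists (i1 : 'Hom(M, prod_mod)) (i2 : 'Hom(N, prod_mod))
         (p1 : 'Hom(prod_mod, M)) (p2 : 'Hom(prod_mod, N)),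
  [/\ [/\ i1 \in homv M prod_mod, i2 \in homv N prod_mod,
          p1 \in homv prod_mod M & p2 \in homv prod_mod N],
      p1 \c i1 = \1%VF /\ p2 \c i2 = \1%VF, p1 \c i2 = 0 /\ p2 \c i1 = 0 &
      i1 \c p1 + i2 \c p2 = \1%VF].
Proof.
have l1 : linear (fun m : M => (m, 0) : W).
  move=> c u v; by congr (_, _); rewrite /= scaler0 addr0.
have l2 : linear (fun m : N => (0, m) : W).
  move=> c u v; by congr (_, _); rewrite /= scaler0 addr0.
have r1 : linear (fun w : W => w.1) by [].
have r2 : linear (fun w : W => w.2) by [].
have mk (U V : vectType k) (f : U -> V) : linear f ->
    exists F : 'Hom(U, V), forall u, F u = f u.
  move=> lf.
  pose g := GRing.isLinear.Build k U V _ f lf.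
  pose h : {linear U -> V} := HB.pack f g.
  by exists (linfun h) => u; rewrite lfunE.
have [i1 i1E] := mk _ _ _ l1; have [i2 i2E] := mk _ _ _ l2.
have [p1 p1E] := mk _ _ _ r1; have [p2 p2E] := mk _ _ _ r2.
exists i1, i2, p1, p2; split.
- split; apply/homvP=> m a; rewrite ?(i1E, i2E, p1E, p2E) //=;
  by rewrite /act /= ract0l.
- by split; apply/lfunP=> m; rewrite comp_lfunE ?(i1E, i2E) ?(p1E, p2E) id_lfunE.
- by split; apply/lfunP=> m; rewrite comp_lfunE ?(i1E, i2E) ?(p1E, p2E) lfunE.
apply/lfunP=> m; rewrite lfunE /= !comp_lfunE i1E i2E p1E p2E id_lfunE.
by case: m => m1 m2; congr (_, _); rewrite ?addr0 ?add0r.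
Qed.

End Product.

Lemma zero_mod_exists : exists M, zero_mod M.
Proof.
have s0 : is_submodule (0%VS : {vspace regular_rmodule A}).
  by move=> m a /[!memv0] /eqP->; rewrite ract0l.
exists (submod s0); apply/eqP; rewrite -subv0; apply/subvP=> u _; rewrite memv0.
apply/eqP/subvs_inj; have := subvsP u; rewrite memv0 => /eqP->.
by rewrite linear0.
Qed.

(** The identity matrix of a family of modules. Its entries live in the types
    ['Hom(M i, M j)], so the diagonal has to be transported along a decided
    equality of indices. *)
Definition delta (I : eqType) (M : I -> rmodule A) (i j : I) : 'Hom(M i, M j) :=
  match i =P j with
  | ReflectT e => ecast x ('Hom(M i, M x)) e \1%VF
  | ReflectF _ => 0
  end.

Section Delta.
Variables (I : eqType) (M : I -> rmodule A).

Lemma delta_eq i : delta M i i = \1%VF.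
Proof. by rewrite /delta; case: eqP => // e; rewrite (eq_axiomK e). Qed.

Lemma delta_neq i j : i != j -> delta M i j = 0.
Proof. by rewrite /delta; case: eqP. Qed.

Lemma delta_hom i j : delta M i j \in homv (M i) (M j).
Proof.
have [<-|/delta_neq->] := eqVneq i j; last exact: rpred0.
by rewrite delta_eq hom_id.
Qed.

End Delta.

Lemma biproduct_exists (I : finType) (M : I -> rmodule A) :
  exists (D : rmodule A) (i : forall x, 'Hom(M x, D)) (p : forall x, 'Hom(D, M x)),
  [/\ forall x, i x \in homv (M x) D, forall x, p x \in homv D (M x),
      forall x y, p y \c i x = delta M x y &
      \sum_x i x \c p x = \1%VF].
Proof.
suff H (s : seq I) : uniq s ->
    exists (D : rmodule A) (i : forall x, 'Hom(M x, D)) (p : forall x, 'Hom(D, M x)),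
    [/\ forall x, i x \in homv (M x) D, forall x, p x \in homv D (M x),
        forall x y, x \in s -> p y \c i x = delta M x y,
        forall x, x \notin s -> p x = 0 &
        \sum_(x <- s) i x \c p x = \1%VF].
  have [D [i [p [hi hp pi _ ip]]]] := H (index_enum I) (index_enum_uniq I).
  by exists D, i, p; split=> // x y; apply: pi; rewrite mem_index_enum.
elim: s => [|x0 s IHs].
  move=> _; have [Z /zero_modE Z0] := zero_mod_exists.
  exists Z, (fun _ => 0), (fun _ => 0); split=> //; try by move=> ?; apply: rpred0.
  by rewrite big_nil.
move=> /= /andP[nsx0 us]; have [D [i [p [hi hp pi p0 ip]]]] := IHs us.
have [i1 [i2 [p1 [p2 [[hi1 hi2 hp1 hp2] [pi1 pi2] [pi12 pi21] ip12]]]]] :=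
  prod_mod_biproduct (M x0) D.
exists (prod_mod (M x0) D), (fun x => if x == x0 then i1 \c delta M x x0 else i2 \c i x),
  (fun x => delta M x0 x \c p1 + p x \c p2); split.
- by move=> x; case: ifP => _; rewrite hom_comp ?delta_hom.
- by move=> x; rewrite rpredD // hom_comp ?delta_hom.
- move=> x y; rewrite inE; case: eqP => [-> _|/eqP nx0 /= sx].
    rewrite comp_lfunDl !comp_lfunA -(comp_lfunA _ p1) pi1 -(comp_lfunA _ p2) pi21.
    by rewrite comp_lfun0r comp_lfun0l addr0 comp_lfun1r delta_eq comp_lfun1r.
  rewrite comp_lfunDl !comp_lfunA -(comp_lfunA _ p1) pi12 -(comp_lfunA _ p2) pi2.
  by rewrite comp_lfun0r comp_lfun0l add0r comp_lfun1r pi.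
- move=> x; rewrite inE negb_or => /andP[nx0 nsx].
  by rewrite p0 // delta_neq 1?eq_sym // !comp_lfun0l addr0.
rewrite big_cons eqxx delta_eq comp_lfun1r p0 // comp_lfun0l addr0.
rewrite comp_lfun1l -ip12; congr (_ + _).
transitivity (\sum_(x <- s) i2 \c (i x \c p x) \c p2).
  rewrite !big_seq; apply: eq_bigr => x sx.
  have nx0 : x != x0 by apply: contraNneq nsx0 => <-.
  rewrite (negPf nx0) delta_neq 1?eq_sym // comp_lfun0l add0r.
  by rewrite !comp_lfunA.
by rewrite -comp_lfun_suml -comp_lfun_sumr ip comp_lfun1r.
Qed.

Section BiproductMaps.
Variables (I : finType) (M : I -> rmodule A) (D : rmodule A).
Variables (i : forall x, 'Hom(M x, D)) (p : forall x, 'Hom(D, M x)).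
Hypothesis pi : forall x y, p y \c i x = delta M x y.

Lemma biproduct_proj L (w : forall x, 'Hom(L, M x)) y :
  p y \c (\sum_x i x \c w x) = w y.
Proof.
rewrite comp_lfun_sumr (bigD1 y) //= comp_lfunA pi delta_eq comp_lfun1l.
rewrite big1 ?addr0 // => x nxy.
by rewrite comp_lfunA pi delta_neq // comp_lfun0l.
Qed.

Lemma biproduct_inj L (w : forall x, 'Hom(M x, L)) y :
  (\sum_x w x \c p x) \c i y = w y.
Proof.
rewrite comp_lfun_suml (bigD1 y) //= -comp_lfunA pi delta_eq comp_lfun1r.
rewrite big1 ?addr0 // => x nxy.
by rewrite -comp_lfunA pi delta_neq 1?eq_sym // comp_lfun0r.
Qed.

End BiproductMaps.

End Homs.

(** * Decomposition into indecomposables *)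

Section Decomposition.
Variables (k : fieldType) (A : falgType k).
Implicit Types M N : rmodule A.

Lemma direct_sum_projections M (U V : {vspace M}) :
    is_submodule U -> is_submodule V ->
    (U + V)%VS = fullv -> (U :&: V)%VS = 0%VS ->
  exists (M1 M2 : rmodule A) (i1 : 'Hom(M1, M)) (i2 : 'Hom(M2, M))
         (p1 : 'Hom(M, M1)) (p2 : 'Hom(M, M2)),
  [/\ [/\ i1 \in homv M1 M, i2 \in homv M2 M, p1 \in homv M M1 & p2 \in homv M M2],
      [/\ lker i1 = 0%VS, lker i2 = 0%VS, limg i1 = U & limg i2 = V],
      p1 \c i2 = 0 /\ p2 \c i1 = 0 &
      i1 \c p1 + i2 \c p2 = \1%VF].
Proof.
move=> sU sV UV UV0.
have [M1 [i1 [mi1 i1U]]] := submodule_mono sU.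
have [M2 [i2 [mi2 i2V]]] := submodule_mono sV.
have VU : (V + U)%VS = fullv by rewrite addvC.
have VU0 : (V :&: U)%VS = 0%VS by rewrite capvC.
have pi_hom (X Y : {vspace M}) : is_submodule X -> is_submodule Y ->
    (X + Y)%VS = fullv -> (X :&: Y)%VS = 0%VS -> daddv_pi X Y \in homv M M.
  move=> sX sY XY XY0; apply/homvP=> m a.
  have YX0 : (Y :&: X)%VS = 0%VS by rewrite capvC.
  have /memv_addP[x Xx [y Yy ->]] : m \in (X + Y)%VS by rewrite XY memvf.
  have pi0 z : z \in Y -> daddv_pi X Y z = 0.
    move=> Yz; have zT : z \in (X + Y)%VS by rewrite XY memvf.
    have := daddv_pi_add XY0 zT; rewrite (daddv_pi_id YX0 Yz).
    by move/(congr1 (fun t => t - z)); rewrite addrK subrr.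
  rewrite ractDl !linearD /= (daddv_pi_id XY0 Xx) (pi0 y) // (pi0 (ract y a)) ?addr0;
    last exact: sY.
  by rewrite daddv_pi_id //; apply: sX.
have img_pi (X Y : {vspace M}) : (limg (daddv_pi X Y) <= X)%VS.
  by apply/subvP=> _ /memv_imgP[m _ ->]; apply: memv_pi.
have [|p1 hp1 e1] := factor_mono mi1 (pi_hom U V sU sV UV UV0).
  by rewrite i1U img_pi.
have [|p2 hp2 e2] := factor_mono mi2 (pi_hom V U sV sU VU VU0).
  by rewrite i2V img_pi.
have sum1 : i1 \c p1 + i2 \c p2 = \1%VF.
  apply/lfunP=> m; rewrite -e1 -e2 lfunE /= id_lfunE daddv_pi_add //.
  by rewrite UV memvf.
exists M1, M2, i1, i2, p1, p2; case: mi1 mi2 => [hi1 i10] [hi2 i20].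
split=> //; split.
  apply: (@mono_cancel _ _ _ _ _ i1) => //; rewrite comp_lfunA -e1 comp_lfun0r.
  apply/lfunP=> m; rewrite comp_lfunE [RHS]lfunE /=.
  have Vm : i2 m \in V by rewrite -i2V memv_img ?memvf.
  have zT : i2 m \in (U + V)%VS by rewrite UV memvf.
  have := daddv_pi_add UV0 zT; rewrite (daddv_pi_id VU0 Vm).
  by move/(congr1 (fun t => t - i2 m)); rewrite addrK subrr.
apply: (@mono_cancel _ _ _ _ _ i2) => //; rewrite comp_lfunA -e2 comp_lfun0r.
apply/lfunP=> m; rewrite comp_lfunE [RHS]lfunE /=.
have Um : i1 m \in U by rewrite -i1U memv_img ?memvf.
have zT : i1 m \in (V + U)%VS by rewrite VU memvf.
have := daddv_pi_add VU0 zT; rewrite (daddv_pi_id UV0 Um).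
by move/(congr1 (fun t => t - i1 m)); rewrite addrK subrr.
Qed.

(** Krull-Schmidt decompositions enter only through this induction: a property
    inherited by direct sums needs to be checked on indecomposables only. *)
Lemma decomposition_ind (Phi : rmodule A -> Prop) :
    (forall M, zero_mod M -> Phi M) ->
    (forall M, indecomposable M -> Phi M) ->
    (forall M M1 M2 (i1 : 'Hom(M1, M)) (i2 : 'Hom(M2, M))
        (p1 : 'Hom(M, M1)) (p2 : 'Hom(M, M2)),
      i1 \in homv M1 M -> i2 \in homv M2 M -> p1 \in homv M M1 ->
      p2 \in homv M M2 -> i1 \c p1 + i2 \c p2 = \1%VF ->
      Phi M1 -> Phi M2 -> Phi M) ->
  forall M, Phi M.
Proof.
move=> Phi0 Phi_ind PhiD M.
have [n] := ubnP (\dim {:M}); elim: n M => // n IHn M; rewrite ltnS => leMn.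
have [zM|nzM] := classic (zero_mod M); first exact: Phi0.
have [|nind] := classic (indecomposable M); first exact: Phi_ind.
have [U [V [[sU sV UV] UV0 nU0 nV0]]] : exists U V : {vspace M},
    [/\ [/\ is_submodule U, is_submodule V & (U + V)%VS = fullv],
        (U :&: V)%VS = 0%VS, U <> 0%VS & V <> 0%VS].
  apply: NNPP => noUV; apply: nind; split=> // U V sU sV UV UV0.
  have [->|nU0] := eqVneq U 0%VS; first by left.
  have [->|nV0] := eqVneq V 0%VS; first by right.
  by case: noUV; exists U, V; split=> //; apply/eqP.
have [M1 [M2 [i1 [i2 [p1 [p2 [[hi1 hi2 hp1 hp2] [k1 k2 iU iV] _ sum1]]]]]]] :=
  direct_sum_projections sU sV UV UV0.
have dimE := dimv_disjoint_sum UV0; rewrite UV in dimE.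
have dU : \dim U = \dim {:M1}.
  by rewrite -iU limg_dim_eq // k1 capv0.
have dV : \dim V = \dim {:M2}.
  by rewrite -iV limg_dim_eq // k2 capv0.
have posU : (0 < \dim U)%N by rewrite lt0n dimv_eq0; apply/eqP.
have posV : (0 < \dim V)%N by rewrite lt0n dimv_eq0; apply/eqP.
apply: (PhiD M M1 M2 i1 i2 p1 p2) => //; apply: IHn.
  by apply: leq_trans leMn; rewrite dimE -dU -[X in (X < _)%N]addn0 ltn_add2l.
by apply: leq_trans leMn; rewrite dimE -dV -[X in (X < _)%N]add0n ltn_add2r.
Qed.

End Decomposition.

(** * The radical of the module category *)

Section Radical.
Variables (k : fieldType) (A : falgType k).
Implicit Types L M N : rmodule A.

(** The Jacobson radical of the category of modules: between indecomposables it
    consists of the maps that are not invertible. *)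
Definition radical M N (f : 'Hom(M, N)) : Prop :=
  f \in homv M N /\ forall g, g \in homv N M -> isom (\1%VF - g \c f).

(** If [c] inverts [1 - g f] then [1 + f c g] inverts [1 - f g]. *)
Lemma isom_one_sub_comm M N (f : 'Hom(M, N)) (g : 'Hom(N, M)) :
    f \in homv M N -> g \in homv N M ->
  isom (\1%VF - g \c f) -> isom (\1%VF - f \c g).
Proof.
move=> hf hg [_ [c hc [cl cr]]].
have El x : c x - c (g (f x)) = x.
  by move/lfunP/(_ x): cl; rewrite comp_lfunE !lfunE /= !lfunE /= linearB comp_lfunE.
have Er x : c x - g (f (c x)) = x.
  by move/lfunP/(_ x): cr; rewrite comp_lfunE !lfunE /= !lfunE /= comp_lfunE.
split; first by rewrite rpredB ?hom_id ?hom_comp.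
exists (\1%VF + f \c c \c g); first by rewrite rpredD ?hom_id ?hom_comp.
have T x : f (c (g x)) - f (c (g (f (g x)))) = f (g x) by rewrite -linearB /= El.
have S x : f (c (g x)) - f (g (f (c (g x)))) = f (g x) by rewrite -linearB /= Er.
have e1 x : (\1%VF + f \c c \c g) x = x + f (c (g x)).
  by rewrite add_lfunE id_lfunE !comp_lfunE.
have e2 x : (\1%VF - f \c g) x = x - f (g x).
  by rewrite add_lfunE opp_lfunE id_lfunE comp_lfunE.
split; apply/lfunP=> x; rewrite comp_lfunE id_lfunE ?(e1, e2) ?(e1, e2).
  by rewrite !linearB /= T subrK.
by rewrite !linearD /= -opprD -{1}(S x) subrK addrK.
Qed.

Lemma mono_isom M (f : 'End(M)) : mono f -> isom f.
Proof.
move=> mf; apply: (bij_isom mf); case: mf => hf f0; split=> //.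
by apply: lker0_limgf; rewrite f0.
Qed.

Lemma radical_hom M N (f : 'Hom(M, N)) : radical f -> f \in homv M N.
Proof. by case. Qed.

Lemma radical_compl L M N (f : 'Hom(M, N)) (u : 'Hom(N, L)) :
  radical f -> u \in homv N L -> radical (u \c f).
Proof.
move=> [hf rf] hu; split; first exact: hom_comp.
by move=> g hg; rewrite comp_lfunA; apply/rf/hom_comp.
Qed.

Lemma radical_compr L M N (f : 'Hom(M, N)) (v : 'Hom(L, M)) :
  radical f -> v \in homv L M -> radical (f \c v).
Proof.
move=> [hf rf] hv; split; first exact: hom_comp.
move=> g hg; rewrite comp_lfunA; apply: isom_one_sub_comm => //.
  exact: hom_comp.
by rewrite comp_lfunA; apply/rf/hom_comp.
Qed.

Lemma radicalD M N (f f' : 'Hom(M, N)) : radical f -> radical f' -> radical (f + f').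
Proof.
move=> [hf rf] [hf' rf']; split; first exact: rpredD.
move=> g hg; have [c ic [cl cr]] := isom_inv (rf g hg).
have -> : \1%VF - g \c (f + f') = (\1%VF - g \c f) \c (\1%VF - c \c g \c f').
  rewrite comp_lfunBr comp_lfun1r !comp_lfunA cr comp_lfun1l comp_lfunDr opprD.
  by rewrite addrA.
apply: isom_comp; first exact: rf.
by apply: rf'; apply: hom_comp => //; case: ic.
Qed.

Lemma radicalZ M N c (f : 'Hom(M, N)) : radical f -> radical (c *: f).
Proof.
move=> [hf rf]; split; first exact: rpredZ.
by move=> g hg; rewrite comp_scale -scale_comp; apply/rf/rpredZ.
Qed.

Lemma radical0 M N : radical (0 : 'Hom(M, N)).
Proof.
split=> [|g hg]; first exact: rpred0.
by rewrite comp_lfun0r subr0; apply: isom_id.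
Qed.

Lemma radv_exists M N :
  exists U : {vspace 'Hom(M, N)}, forall f, f \in U <-> radical f.
Proof.
apply: vspace_of_prop => [|c f g rf rg]; first exact: radical0.
by apply: radicalD => //; apply: radicalZ.
Qed.

Definition radv M N : {vspace 'Hom(M, N)} :=
  proj1_sig (constructive_indefinite_description _ (radv_exists M N)).

Lemma radvP M N (f : 'Hom(M, N)) : f \in radv M N <-> radical f.
Proof. by rewrite /radv; case: constructive_indefinite_description => U /= ->. Qed.

Lemma rad_hom M N (f : 'Hom(M, N)) : f \in radv M N -> f \in homv M N.
Proof. by move/radvP/radical_hom. Qed.

Lemma rad_compl L M N (f : 'Hom(M, N)) (u : 'Hom(N, L)) :
  f \in radv M N -> u \in homv N L -> u \c f \in radv M L.
Proof. by move=> /radvP rf hu; apply/radvP/radical_compl. Qed.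

Lemma rad_compr L M N (f : 'Hom(M, N)) (v : 'Hom(L, M)) :
  f \in radv M N -> v \in homv L M -> f \c v \in radv L N.
Proof. by move=> /radvP rf hu; apply/radvP/radical_compr. Qed.

Lemma rad_one_sub M (f : 'End(M)) : f \in radv M M -> isom (\1%VF - f).
Proof.
by move=> /radvP[_ rf]; have := rf _ (hom_id M); rewrite comp_lfun1l.
Qed.

Lemma rad_id M : \1%VF \in radv M M -> zero_mod M.
Proof.
move/rad_one_sub; rewrite subrr => -[_ [g _ [_ e]]].
by apply/zero_modE; rewrite -e comp_lfun0l.
Qed.

(** ** Indecomposable modules *)

Lemma indecomposable_nz M : indecomposable M -> ~ zero_mod M.
Proof. by case. Qed.

Lemma indecomposable_iso M N :
  isomorphic M N -> indecomposable M -> indecomposable N.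
Proof.
move=> /isomorphicP[f isf] [nzM ind].
have [hf f0] := isom_mono isf; have [_ fT] := isom_epi isf.
have f0' : lker f == 0%VS by rewrite f0.
split=> [zN|U V sU sV UV UV0].
  by apply: nzM; apply: zero_eq => m _; apply: (lker0P f0'); rewrite linear0;
    have := memvf (f m); rewrite zN memv0 => /eqP.
have sub W : is_submodule W -> is_submodule (f @^-1: W)%VS.
  by move=> sW m a; rewrite -!memv_preim ractE //; apply: sW.
have zero W : (f @^-1: W)%VS = 0%VS -> W = 0%VS.
  move=> W0; apply: zero_eq => n.
  have /memv_imgP[m _ ->] : n \in limg f by rewrite fT memvf.
  by rewrite memv_preim W0 memv0 => /eqP->; rewrite linear0.
have [||/zero|/zero] := ind _ _ (sub U sU) (sub V sV); [| |by left|by right].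
  apply: full_eq => m.
  have /memv_addP[u Uu [v Vv e]] : f m \in (U + V)%VS by rewrite UV memvf.
  have /memv_imgP[u' _ eu] : u \in limg f by rewrite fT memvf.
  have /memv_imgP[v' _ ev] : v \in limg f by rewrite fT memvf.
  have -> : m = u' + v' by apply: (lker0P f0'); rewrite linearD /= -eu -ev.
  by apply: memv_add; rewrite -memv_preim -?eu -?ev.
apply: zero_eq => m; rewrite memv_cap -!memv_preim => /andP[mU mV].
apply: (lker0P f0'); rewrite linear0; apply/eqP; rewrite -memv0 -UV0.
by rewrite memv_cap mU.
Qed.

(** Fitting: if [f] is not injective, the kernels of its powers stabilise at
    some [n], the kernel and image of [f ^ n] are complementary, and so
    [f ^ n = 0], which makes [1 - f] invertible. *)
Lemma fitting M (f : 'End(M)) :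
  indecomposable M -> f \in homv M M -> ~ isom f -> isom (\1%VF - f).
Proof.
move=> [_ ind] hf nif.
pose pw n := iter n (fun h => f \c h) \1%VF : 'End(M).
have hpw n : pw n \in homv M M by elim: n => [|n]; rewrite ?hom_id //; apply: hom_comp.
have pwD m n : pw (m + n)%N = pw m \c pw n.
  by elim: m => [|m IHm]; rewrite ?comp_lfun1l //= IHm comp_lfunA.
have sK m n : (lker (pw n) <= lker (pw (m + n)%N))%VS.
  by apply/subvP=> x; rewrite !memv_ker pwD comp_lfunE => /eqP->; rewrite linear0.
have [n stable] : exists n, (lker (pw n.+1) <= lker (pw n))%VS.
  apply: NNPP => nst.
  have lt n : (\dim (lker (pw n)) < \dim (lker (pw n.+1)))%N.
    rewrite ltnNge; apply/negP=> le; apply: nst; exists n.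
    have /eqP<- // : lker (pw n) == lker (pw n.+1).
    by rewrite eqEdim le (sK 1%N).
  have ge n : (n <= \dim (lker (pw n)))%N.
    by elim: n => // n IHn; apply: leq_ltn_trans IHn (lt n).
  by have := ge (\dim {:M}).+1; rewrite ltnNge dimvS ?subvf.
have stab m : (lker (pw (m + n)%N) <= lker (pw n))%VS.
  elim: m => // m IHm; apply: subv_trans IHm.
  apply/subvP=> x Kx.
  have : pw m x \in lker (pw n.+1).
    by rewrite memv_ker -comp_lfunE -pwD addSnnS addnC -memv_ker.
  by move/(subvP stable); rewrite !memv_ker -comp_lfunE -pwD addnC.
have KI : (lker (pw n) :&: limg (pw n))%VS = 0%VS.
  apply: zero_eq => x; rewrite memv_cap => /andP[Kx /memv_imgP[y _ ex]].
  have : y \in lker (pw (n + n)%N) by rewrite memv_ker pwD comp_lfunE -ex -memv_ker.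
  by move/(subvP (stab n)); rewrite memv_ker -ex => /eqP.
have KIT : (lker (pw n) + limg (pw n))%VS = fullv.
  apply/eqP; rewrite eqEdim subvf dimv_disjoint_sum //=.
  by rewrite -(limg_ker_dim (pw n) fullv) capfv.
have [K0|I0] := ind _ _ (lker_submodule (hpw n)) (limg_submodule (hpw n)) KIT KI.
  case: nif; apply: mono_isom; split=> //; apply/eqP; rewrite -subv0 -K0.
  apply: subv_trans stable; have := sK n 1%N.
  by rewrite addn1 /= comp_lfun1r.
apply: mono_isom; split; first by rewrite rpredB ?hom_id.
apply: zero_eq => x; rewrite memv_ker add_lfunE opp_lfunE id_lfunE subr_eq0.
move=> /eqP fx; have -> : x = pw n x.
  by elim: n {stable stab KI KIT I0} => [|n IHn]; rewrite /= ?id_lfunE // comp_lfunE -IHn.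
by apply/eqP; rewrite -memv0 -I0 memv_img ?memvf.
Qed.

Lemma split_mono_indecomposable M N (f : 'Hom(M, N)) :
    indecomposable M -> f \in homv M N ->
    (forall g, g \in homv N M -> g \c f <> \1%VF) -> f \in radv M N.
Proof.
move=> indM hf nsplit; apply/radvP; split=> // g hg.
apply: fitting => //; first exact: hom_comp.
case=> _ [c hc [cgf _]]; apply: (nsplit (c \c g)); first exact: hom_comp.
by rewrite -comp_lfunA.
Qed.

Lemma split_epi_indecomposable M N (f : 'Hom(M, N)) :
    indecomposable N -> f \in homv M N ->
    (forall g, g \in homv N M -> f \c g <> \1%VF) -> f \in radv M N.
Proof.
move=> indN hf nsplit; apply/radvP; split=> // g hg.
apply: isom_one_sub_comm => //; apply: fitting => //; first exact: hom_comp.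
case=> _ [c hc [_ fgc]]; apply: (nsplit (g \c c)); first exact: hom_comp.
by rewrite comp_lfunA.
Qed.

Lemma noniso_indecomposable_rad M N (f : 'Hom(M, N)) :
    indecomposable M -> indecomposable N -> f \in homv M N ->
  ~ isomorphic M N -> f \in radv M N.
Proof.
move=> indM indN hf niso; apply: split_mono_indecomposable => // g hg gf.
apply: niso; apply/isomorphicP; exists f.
have [fg|nfg] := classic (isom (f \c g)); last first.
  have := fitting indN (hom_comp hf hg) nfg => -[_ [c hc [cl _]]].
  case: (indecomposable_nz indM); apply/zero_modE.
  have e : (\1%VF - f \c g) \c f = 0.
    by rewrite comp_lfunBl comp_lfun1l -comp_lfunA gf comp_lfun1r subrr.
  have f0 : f = 0 by rewrite -[f]comp_lfun1l -cl -comp_lfunA e comp_lfun0r.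
  by rewrite -gf f0 comp_lfun0r.
split=> //; exists g => //; split=> //; have [h ih [hfg fgh]] := isom_inv fg.
have e : f \c g \c (f \c g) = f \c g.
  by rewrite comp_lfunA -(comp_lfunA f g f) gf comp_lfun1r.
by rewrite -[LHS]comp_lfun1l -hfg -comp_lfunA e.
Qed.

End Radical.

Lemma lfun_eigenvalue (k : closedFieldType) (V : vectType k) (f : 'End(V)) :
  {:V}%VS <> 0%VS -> exists c, lker (f - c *: \1%VF) <> 0%VS.
Proof.
move=> V0.
have [c root_c] : exists c, root (char_poly (passmx.mxof (vbasis {:V}) (vbasis {:V}) f)) c.
  apply/closed_rootP; rewrite size_char_poly eqSS dimv_eq0; exact/eqP.
exists c; rewrite -/(passmx.leigenspace f c) (passmx.leigenspaceE (vbasisP {:V})).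
apply/eqP; rewrite passmx.vsof_eq0 ?vbasisP //.
by rewrite -eigenvalue_root_char in root_c.
Qed.

(** This is where the base field has to be algebraically closed: the residue
    field of the local ring [End M] is [k] itself. *)
Lemma indecomposable_end (k : closedFieldType) (A : falgType k) (M : rmodule A)
    (f : 'End(M)) :
    indecomposable M -> f \in homv M M ->
  exists c, f - c *: \1%VF \in radv M M.
Proof.
move=> indM hf; have [c nK] := lfun_eigenvalue f (indecomposable_nz indM).
exists c; have hfc : f - c *: \1%VF \in homv M M by rewrite rpredB ?rpredZ ?hom_id.
apply: split_mono_indecomposable => // g hg gf; apply: nK.
apply: zero_eq => m; rewrite memv_ker => /eqP fm0.
by rewrite -[m]id_lfunE -gf comp_lfunE fm0 linear0.
Qed.

(** * Almost split sequences *)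

Section ShortExact.
Variables (k : fieldType) (A : falgType k).
Implicit Types K M N Y Z W : rmodule A.

Definition short_exact K Y Z (f : 'Hom(K, Y)) (g : 'Hom(Y, Z)) : Prop :=
  [/\ mono f, epi g & limg f = lker g].

Lemma kernel_comp0 K Y Z (f : 'Hom(K, Y)) (g : 'Hom(Y, Z)) :
  limg f = lker g -> g \c f = 0.
Proof.
move=> fg; apply/lfunP=> x; rewrite comp_lfunE zero_lfunE; apply/eqP.
by rewrite -memv_ker -fg memv_img ?memvf.
Qed.

Lemma comp0_limg M Y Z (u : 'Hom(M, Y)) (g : 'Hom(Y, Z)) :
  g \c u = 0 -> (limg u <= lker g)%VS.
Proof.
move=> gu; apply/subvP=> _ /memv_imgP[m _ ->].
by rewrite memv_ker -comp_lfunE gu zero_lfunE.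
Qed.

Lemma factor_kernel K M Y Z (f : 'Hom(K, Y)) (g : 'Hom(Y, Z)) (u : 'Hom(M, Y)) :
    mono f -> limg f = lker g -> u \in homv M Y -> g \c u = 0 ->
  exists2 h, h \in homv M K & u = f \c h.
Proof. by move=> mf fg hu gu; apply: factor_mono => //; rewrite fg comp0_limg. Qed.

Lemma factor_cokernel K M Y Z (f : 'Hom(K, Y)) (g : 'Hom(Y, Z)) (u : 'Hom(Y, M)) :
    short_exact f g -> u \in homv Y M -> u \c f = 0 ->
  exists2 h, h \in homv Z M & u = h \c g.
Proof.
by move=> [_ eg fg] hu uf; apply: factor_epi => //; rewrite -fg comp0_limg.
Qed.

(** [sink g] says that [Hom(-, g)] is a projective cover of the functor
    [rad(-, Z)]: [g] is what is called a minimal right almost split map. *)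
Definition sink Y Z (g : 'Hom(Y, Z)) : Prop :=
  [/\ g \in radv Y Z,
      forall M (f : 'Hom(M, Z)), f \in radv M Z ->
        exists2 s, s \in homv M Y & f = g \c s &
      forall M (u : 'Hom(M, Y)), u \in homv M Y -> g \c u = 0 -> u \in radv M Y].

Lemma sink_isom Y Z (g : 'Hom(Y, Z)) (s : 'End(Y)) :
  sink g -> s \in homv Y Y -> g \c s = g -> isom s.
Proof.
move=> [_ _ g0] hs gs.
have : \1%VF - s \in radv Y Y.
  by apply: g0; rewrite ?rpredB ?hom_id // comp_lfunBr comp_lfun1r gs subrr.
by move/rad_one_sub; rewrite opprB addrC subrK.
Qed.

(** If [g] is not surjective, the inclusion of its image is radical and factors
    through [g]; this makes the corestriction of [g] a split monomorphism. *)
Lemma sink_mono_or_epi Y Z (g : 'Hom(Y, Z)) :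
  indecomposable Z -> sink g -> mono g \/ epi g.
Proof.
move=> indZ sg; have [rg g1 g0] := sg; have hg := rad_hom rg.
have [gT|ngT] := classic (limg g = fullv); first by right; split.
left; have [I [i [mi iI]]] := submodule_mono (limg_submodule hg).
have ri : i \in radv I Z.
  apply: split_epi_indecomposable => //; first by case: mi.
  move=> s hs is1; apply: ngT; rewrite -iI; apply: full_eq => z.
  by rewrite -[z]id_lfunE -is1 comp_lfunE memv_img ?memvf.
have [s hs es] := g1 _ _ ri.
have [|g' hg' eg'] := factor_mono mi hg; first by rewrite iI.
have iso : isom (s \c g').
  apply: sink_isom sg _ _; first exact: hom_comp.
  by rewrite comp_lfunA -es -eg'.
split=> //; apply: zero_eq => y; rewrite memv_ker => /eqP gy0.
have [_ /eqP m0] := isom_mono iso; apply: (lker0P m0); rewrite linear0 comp_lfunE.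
have -> : g' y = 0; last by rewrite linear0.
case: mi => _ /eqP i0; apply: (lker0P i0).
by rewrite linear0 -comp_lfunE -eg' gy0.
Qed.

(** If [u] does not extend, the pushout [W -> V -> Z] of the sequence along [u]
    does not split; as [g] is a sink map, [V -> Z] then factors through [g],
    and composing back and forth exhibits [u] as a split monomorphism. *)
Lemma kernel_of_sink_left_almost_split K Y Z W
    (f : 'Hom(K, Y)) (g : 'Hom(Y, Z)) (u : 'Hom(K, W)) :
    indecomposable Z -> sink g -> short_exact f g -> u \in homv K W ->
    (forall v, v \in homv W K -> v \c u <> \1%VF) ->
  exists2 u', u' \in homv Y W & u = u' \c f.
Proof.
move=> indZ sg [mf eg fg] hu nsplit.
have gf0 := kernel_comp0 fg.
have [rg g1 g0] := sg; have hg := rad_hom rg; have [hf f0] := mf.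
have [iW [iY [pW [pY [[hiW hiY hpW hpY] [pWiW pYiY] [pWiY pYiW] ip]]]]] :=
  prod_mod_biproduct W Y.
set P := prod_mod W Y in iW iY pW pY hiW hiY hpW hpY pWiW pYiY pWiY pYiW ip.
pose kappa : 'Hom(K, P) := iW \c u - iY \c f.
have hk : kappa \in homv K P by rewrite rpredB ?hom_comp.
have pWk : pW \c kappa = u.
  by rewrite comp_lfunBr !comp_lfunA pWiW pWiY comp_lfun1l comp_lfun0l subr0.
have pYk : pY \c kappa = - f.
  by rewrite comp_lfunBr !comp_lfunA pYiW pYiY comp_lfun1l comp_lfun0l sub0r.
have [V [q [eq qk]]] := quotient_epi (limg_submodule hk).
have hq : q \in homv P V by case: eq.
have qk0 : q \c kappa = 0 by apply: kernel_comp0.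
pose j := q \c iW; pose l := q \c iY.
have hj : j \in homv W V by apply: hom_comp.
have hl : l \in homv Y V by apply: hom_comp.
have jl : j \c u = l \c f.
  apply/eqP; rewrite -subr_eq0 -!comp_lfunA -comp_lfunBr -/kappa; exact/eqP.
have [|pi hpi epi] := factor_epi eq (hom_comp hg hpY).
  rewrite qk; apply: comp0_limg.
  by rewrite -comp_lfunA pYk comp_lfunNr gf0 oppr0.
have pil : pi \c l = g by rewrite comp_lfunA -epi -comp_lfunA pYiY comp_lfun1r.
have pij : pi \c j = 0 by rewrite comp_lfunA -epi -comp_lfunA pYiW comp_lfun0r.
have mj : mono j.
  split=> //; apply: zero_eq => w; rewrite memv_ker comp_lfunE -memv_ker qk.
  case/memv_imgP=> x _ ewx.
  have fx : f x = 0.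
    apply: oppr_inj; rewrite -opp_lfunE -pYk comp_lfunE -ewx -comp_lfunE pYiW.
    by rewrite zero_lfunE oppr0.
  have /eqP f0' := f0; rewrite -[w]id_lfunE -pWiW comp_lfunE ewx.
  by rewrite (_ : x = 0) ?linear0 //; apply: (lker0P f0'); rewrite linear0.
have img_j v : pi v = 0 -> v \in limg j.
  have [_ qT] := eq; have /memv_imgP[p _ ->] : v \in limg q by rewrite qT memvf.
  rewrite -comp_lfunE -epi comp_lfunE => /eqP.
  rewrite -memv_ker -fg => /memv_imgP[x _ ex].
  have -> : q p = j (pW p + u x).
    rewrite linearD /= -(comp_lfunE j u) jl !comp_lfunE -ex -linearD /=.
    congr (q _); rewrite -!comp_lfunE -add_lfunE ip; exact/esym/id_lfunE.
  by rewrite memv_img ?memvf.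
(* The pushout sequence splits exactly when [u] extends along [f]. *)
have [split|nspl] := classic (exists2 s, s \in homv Z V & pi \c s = \1%VF).
  have [s hs pis] := split.
  have hm : l - s \c g \in homv Y V by rewrite rpredB ?hom_comp.
  have [|u' hu' eu'] := factor_mono mj hm.
    apply/subvP=> _ /memv_imgP[y _ ->]; apply: img_j.
    by rewrite -comp_lfunE comp_lfunBr pil comp_lfunA pis comp_lfun1l subrr zero_lfunE.
  exists u' => //; apply: (mono_cancel mj); rewrite comp_lfunA -eu' comp_lfunBl.
  by rewrite -(comp_lfunA s) gf0 comp_lfun0r subr0.
have rpi : pi \in radv V Z.
  by apply: split_epi_indecomposable => // s hs pis; apply: nspl; exists s.
have [t ht et] := g1 _ _ rpi.
have gtl : g \c (t \c l) = g by rewrite comp_lfunA -et.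
have htl : t \c l \in homv Y Y by apply: hom_comp.
have [t' it' [t't tt']] := isom_inv (sink_isom sg htl gtl).
have ht' : t' \in homv Y Y by case: it'.
have [|k' hk' ek'] := factor_kernel mf fg (hom_comp ht hj).
  by rewrite comp_lfunA -et.
have [|phi hphi ephi] := factor_kernel mf fg (hom_comp ht' hf).
  by rewrite comp_lfunA -gtl -(comp_lfunA g) tt' comp_lfun1r.
case: (nsplit (phi \c k')); first exact: hom_comp.
apply: (mono_cancel mf); rewrite !comp_lfunA -ephi -(comp_lfunA t') -ek'.
rewrite -(comp_lfunA t') -(comp_lfunA t) jl (comp_lfunA t) comp_lfunA t't.
by rewrite comp_lfun1l comp_lfun1r.
Qed.

Lemma nz_rad_not_split M N (f : 'Hom(M, N)) v :
  ~ zero_mod M -> f \in radv M N -> v \in homv N M -> v \c f <> \1%VF.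
Proof. by move=> nzM rf hv vf1; apply: nzM; apply: rad_id; rewrite -vf1 rad_compl. Qed.

(** The projections onto two nonzero summands of [K] would extend to [Y] and
    together split the radical map [f]. *)
Lemma kernel_of_sink_indecomposable K Y Z (f : 'Hom(K, Y)) (g : 'Hom(Y, Z)) :
  indecomposable Z -> sink g -> short_exact f g -> indecomposable K.
Proof.
move=> indZ sg sfg; have [mf eg fg] := sfg; have [rg g1 g0] := sg.
have [hf f0] := mf.
have rf : f \in radv K Y by apply: g0 => //; apply: kernel_comp0.
have nzK : ~ zero_mod K.
  move=> zK; have f_0 : f = 0 by apply: hom_zerol.
  have mg : mono g.
    split; first exact: rad_hom.
    by rewrite -fg; apply: zero_eq => _ /memv_imgP[x _ ->]; rewrite f_0 zero_lfunE.
  have [_ [h hh [hg1 gh1]]] := bij_isom mg eg.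
  by apply: (indecomposable_nz indZ); apply: rad_id; rewrite -gh1 rad_compr.
split=> // U V sU sV UV UV0.
have [M1 [M2 [i1 [i2 [p1 [p2 [[hi1 hi2 hp1 hp2] [k1 k2 iU iV] [p1i2 p2i1] ip]]]]]]] :=
  direct_sum_projections sU sV UV UV0.
have zero_img (M : rmodule A) (i : 'Hom(M, K)) : i = 0 -> limg i = 0%VS.
  by move=> ->; apply: zero_eq => _ /memv_imgP[x _ ->]; rewrite zero_lfunE.
have [[v hv vp]|ns1] := classic (exists2 v, v \in homv M1 K & v \c p1 = \1%VF).
  right; rewrite -iV; apply: zero_img.
  by rewrite -[i2]comp_lfun1l -vp -comp_lfunA p1i2 comp_lfun0r.
have [[v hv vp]|ns2] := classic (exists2 v, v \in homv M2 K & v \c p2 = \1%VF).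
  left; rewrite -iU; apply: zero_img.
  by rewrite -[i1]comp_lfun1l -vp -comp_lfunA p2i1 comp_lfun0r.
have [|u1 hu1 e1] := kernel_of_sink_left_almost_split indZ sg sfg hp1.
  by move=> v hv vp; apply: ns1; exists v.
have [|u2 hu2 e2] := kernel_of_sink_left_almost_split indZ sg sfg hp2.
  by move=> v hv vp; apply: ns2; exists v.
case: (@nz_rad_not_split _ _ f (i1 \c u1 + i2 \c u2) nzK rf).
  by rewrite rpredD ?hom_comp.
by rewrite comp_lfunDl -!comp_lfunA -e1 -e2.
Qed.

(** Two left almost split maps out of [K] factor through each other, so they
    have isomorphic cokernels. *)
Lemma kernel_of_sink_determines K Y Z Y' Z'
    (f : 'Hom(K, Y)) (g : 'Hom(Y, Z)) (f' : 'Hom(K, Y')) (g' : 'Hom(Y', Z')) :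
    indecomposable Z -> indecomposable Z' -> sink g -> sink g' ->
    short_exact f g -> short_exact f' g' ->
  isomorphic Z Z'.
Proof.
move=> indZ indZ' sg sg' sfg sfg'.
have [mf eg fg] := sfg; have [mf' eg' fg'] := sfg'.
have [rg _ g0] := sg; have [rg' _ g0'] := sg'.
have hg := rad_hom rg; have hg' := rad_hom rg'.
have hf : f \in homv K Y by case: mf.
have hf' : f' \in homv K Y' by case: mf'.
have gf := kernel_comp0 fg; have gf' := kernel_comp0 fg'.
have nzK := indecomposable_nz (kernel_of_sink_indecomposable indZ sg sfg).
have rf : f \in radv K Y by apply: g0.
have rf' : f' \in radv K Y' by apply: g0'.
have [h hh eh] := kernel_of_sink_left_almost_split indZ sg sfg hf'
  (fun v => @nz_rad_not_split _ _ f' v nzK rf').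
have [h' hh' eh'] := kernel_of_sink_left_almost_split indZ' sg' sfg' hf
  (fun v => @nz_rad_not_split _ _ f v nzK rf).
have inv1 : isom (h' \c h).
  have [||w hw ew] := factor_cokernel (u := \1%VF - h' \c h) sfg.
  - by rewrite rpredB ?hom_id ?hom_comp.
  - by rewrite comp_lfunBl comp_lfun1l -comp_lfunA -eh -eh' subrr.
  have : \1%VF - h' \c h \in radv Y Y by rewrite ew rad_compl.
  by move/rad_one_sub; rewrite opprB addrC subrK.
have inv2 : isom (h \c h').
  have [||w hw ew] := factor_cokernel (u := \1%VF - h \c h') sfg'.
  - by rewrite rpredB ?hom_id ?hom_comp.
  - by rewrite comp_lfunBl comp_lfun1l -comp_lfunA -eh' -eh subrr.
  have : \1%VF - h \c h' \in radv Y' Y' by rewrite ew rad_compl.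
  by move/rad_one_sub; rewrite opprB addrC subrK.
have isoh : isom h.
  apply: bij_isom.
    split=> //; apply: zero_eq => y; rewrite memv_ker => /eqP hy.
    have [_ /eqP m0] := isom_mono inv1; apply: (lker0P m0).
    by rewrite linear0 comp_lfunE hy linear0.
  split=> //; apply: full_eq => y; have [_ eT] := isom_epi inv2.
  have /memv_imgP[x _ ->] : y \in limg (h \c h') by rewrite eT memvf.
  by rewrite comp_lfunE memv_img ?memvf.
have [h1 ih1 [h1h hh1]] := isom_inv isoh.
have hh1' : h1 \in homv Y' Y by case: ih1.
have [||phi hphi ephi] := factor_cokernel (u := g' \c h) sfg.
- exact: hom_comp.
- by rewrite -comp_lfunA -eh.
have [||psi hpsi epsi] := factor_cokernel (u := g \c h1) sfg'.
- exact: hom_comp.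
- by rewrite eh (comp_lfunA _ h) -(comp_lfunA g) h1h comp_lfun1r.
apply/isomorphicP; exists phi; split=> //; exists psi => //; split.
  apply: (epi_cancel eg); rewrite -comp_lfunA -ephi comp_lfunA -epsi.
  by rewrite -comp_lfunA h1h comp_lfun1l comp_lfun1r.
apply: (epi_cancel eg'); rewrite -comp_lfunA -epsi comp_lfunA -ephi.
by rewrite -comp_lfunA hh1 comp_lfun1l comp_lfun1r.
Qed.

End ShortExact.

(** * Products of spaces of linear maps *)

Lemma sum_sigma (M : nmodType) (I : finType) (J : I -> finType)
    (F : forall i, J i -> M) :
  \sum_(t : {i : I & J i}) F (tag t) (tagged t) = \sum_i \sum_j F i j.
Proof. by rewrite sig_big_dep. Qed.

Section CompSpace.
Variables (k : fieldType) (L M N : vectType k).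

Definition compv (U : {vspace 'Hom(M, N)}) (W : {vspace 'Hom(L, M)}) :
    {vspace 'Hom(L, N)} :=
  \sum_(s < \dim U) \sum_(t < \dim W) <[(vbasis U)`_s \c (vbasis W)`_t]>%VS.

Variables (U : {vspace 'Hom(M, N)}) (W : {vspace 'Hom(L, M)}).

Lemma mem_vbasis_nth (V : vectType k) (S : {vspace V}) (i : 'I_(\dim S)) :
  (vbasis S)`_i \in S.
Proof. by apply/vbasis_mem/mem_nth; rewrite size_tuple. Qed.

Lemma memv_compv u w : u \in U -> w \in W -> u \c w \in compv U W.
Proof.
move=> Uu Ww; rewrite (coord_vbasis Uu) comp_lfun_suml; apply: rpred_sum => s _.
rewrite (coord_vbasis Ww) comp_lfun_sumr; apply: rpred_sum => t _.
rewrite scale_comp comp_scale; apply/rpredZ/rpredZ.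
by rewrite memvE (subv_trans _ (sumv_sup s _ (sumv_sup t _ (subvv _)))).
Qed.

Lemma compv_subP (T : {vspace 'Hom(L, N)}) :
  (forall u w, u \in U -> w \in W -> u \c w \in T) -> (compv U W <= T)%VS.
Proof.
move=> sT; apply/subv_sumP=> s _; apply/subv_sumP=> t _.
by rewrite -memvE sT ?mem_vbasis_nth.
Qed.

Lemma compv_expandl f : f \in compv U W ->
  exists2 g : 'I_(\dim U) -> 'Hom(L, M), forall t, g t \in W &
    f = \sum_(t < \dim U) (vbasis U)`_t \c g t.
Proof.
case/memv_sumP=> F mF ->.
have /fin_all_exists[c cP] : forall s, exists c : 'I_(\dim W) -> k,
    F s = \sum_(t < \dim W) c t *: ((vbasis U)`_s \c (vbasis W)`_t).
  move=> s; have /memv_sumP[G mG ->] := mF s isT.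
  have /fin_all_exists[c cP] : forall t, exists c, G t = c *: ((vbasis U)`_s \c (vbasis W)`_t).
    by move=> t; have /vlineP[c ->] := mG t isT; exists c.
  by exists c; apply: eq_bigr.
exists (fun s => \sum_(t < \dim W) c s t *: (vbasis W)`_t) => [s|].
  by apply: rpred_sum => t _; rewrite rpredZ ?mem_vbasis_nth.
apply: eq_bigr => s _; rewrite cP comp_lfun_sumr; apply: eq_bigr => t _.
by rewrite comp_scale.
Qed.

Lemma compv_expandr f : f \in compv U W ->
  exists2 g : 'I_(\dim W) -> 'Hom(M, N), forall t, g t \in U &
    f = \sum_(t < \dim W) g t \c (vbasis W)`_t.
Proof.
case/compv_expandl=> g gW ->.
exists (fun t => \sum_(s < \dim U) coord (vbasis W) t (g s) *: (vbasis U)`_s) => [t|].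
  by apply: rpred_sum => s _; rewrite rpredZ ?mem_vbasis_nth.
under [RHS]eq_bigr => t _ do rewrite comp_lfun_suml.
rewrite exchange_big; apply: eq_bigr => s _ /=.
rewrite {1}(coord_vbasis (gW s)) comp_lfun_sumr; apply: eq_bigr => t _.
by rewrite scale_comp comp_scale.
Qed.

End CompSpace.

(** * The radical filtration on indecomposable modules *)

Section Indecomposables.
Variables (k : closedFieldType) (A : falgType k) (V : finType) (X : V -> rmodule A).
Hypotheses (X_ind : forall v, indecomposable (X v))
  (X_noniso : forall v w, isomorphic (X v) (X w) -> v = w)
  (X_complete : forall M : rmodule A, indecomposable M -> exists v, isomorphic M (X v)).

Local Notation hom x y := (homv (X x) (X y)).
Local Notation rad x y := (radv (X x) (X y)).

Lemma hom_delta_rad x y f : f \in hom x y -> exists c, f - c *: delta X x y \in rad x y.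
Proof.
case: (eqVneq x y) f => [<-|nxy] f hf.
  by rewrite delta_eq; apply: indecomposable_end.
 exists 0; rewrite scale0r subr0.
apply: noniso_indecomposable_rad => // iso; case/eqP: nxy; exact: X_noniso.
Qed.

Lemma rad_neq x y f : x != y -> f \in hom x y -> f \in rad x y.
Proof.
move=> nxy /hom_delta_rad[c]; rewrite delta_neq // scaler0 subr0 //.
Qed.

Lemma scale_id_rad x c : c *: \1%VF \in rad x x -> c = 0.
Proof.
have [//|c0] := eqVneq c 0; rewrite rpredZeq (negPf c0) /= => /rad_id.
by move/(indecomposable_nz (X_ind x)).
Qed.

Fixpoint rad_pow n x z : {vspace 'Hom(X x, X z)} :=
  if n is n'.+1 then (\sum_y compv (rad y z) (rad_pow n' x y))%VS else hom x z.

Lemma rad_powS n x z :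
  rad_pow n.+1 x z = (\sum_y compv (rad y z) (rad_pow n x y))%VS.
Proof. by []. Qed.

Lemma memv_rad_powS n x y z f g :
  f \in rad y z -> g \in rad_pow n x y -> f \c g \in rad_pow n.+1 x z.
Proof.
move=> rf rg; rewrite rad_powS memvE.
by rewrite (sumv_sup y) // -memvE; apply: memv_compv.
Qed.

Lemma rad_powS_subP n x z (T : {vspace 'Hom(X x, X z)}) :
    (forall y f g, f \in rad y z -> g \in rad_pow n x y -> f \c g \in T) ->
  (rad_pow n.+1 x z <= T)%VS.
Proof.
by move=> H; apply/subv_sumP=> y _; apply: compv_subP => f g; apply: H.
Qed.

Lemma rad_pow_hom n x z : (rad_pow n x z <= hom x z)%VS.
Proof.
elim: n x z => [|n IHn] x z; first exact: subvv.
apply: rad_powS_subP => y f g rf rg; apply: hom_comp; first exact: rad_hom.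
exact: (subvP (IHn x y)).
Qed.

Lemma rad_pow1 x z : rad_pow 1 x z = rad x z.
Proof.
apply/eqP; rewrite eqEsubv; apply/andP; split.
  by apply: rad_powS_subP => y f g rf hg; apply: rad_compr.
apply/subvP=> f rf; rewrite -[f]comp_lfun1r.
by apply: memv_rad_powS => //; apply: hom_id.
Qed.

Lemma rad_pow_decr n x z : (rad_pow n.+1 x z <= rad_pow n x z)%VS.
Proof.
elim: n x z => [|n IHn] x z; first exact: rad_pow_hom.
apply: rad_powS_subP => y f g rf rg; apply: memv_rad_powS rf _.
exact: (subvP (IHn x y)).
Qed.

Lemma rad_pow_comp m n x y z f g :
  f \in rad_pow m y z -> g \in rad_pow n x y -> f \c g \in rad_pow (m + n) x z.
Proof.
elim: m z f => [|m IHm] z f.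
  move=> hf; case: n => [|n]; first exact: hom_comp.
  case/memv_sumP=> F mF ->; rewrite comp_lfun_sumr; apply: rpred_sum => w _.
  have /compv_expandl[h hh ->] := mF w isT.
  rewrite comp_lfun_sumr; apply: rpred_sum => t _; rewrite comp_lfunA.
  by apply: memv_rad_powS => //; apply: rad_compl => //; apply: mem_vbasis_nth.
case/memv_sumP=> F mF -> hg; rewrite comp_lfun_suml; apply: rpred_sum => w _.
have /compv_expandl[h hh ->] := mF w isT.
rewrite comp_lfun_suml; apply: rpred_sum => t _; rewrite -comp_lfunA addSn.
by apply: memv_rad_powS; [apply: mem_vbasis_nth | apply: IHm].
Qed.

(** Nakayama: once the decreasing spaces [rad_pow n x _] are stationary, bases
    of them assemble to a map [v : X x -> D] with [v = u v] for a radical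
    endomorphism [u] of [D], so [v = 0]. *)
Lemma rad_pow_nilpotent : exists n, forall x z, rad_pow n x z = 0%VS.
Proof.
have [n stable] : exists n, forall x z, rad_pow n.+1 x z = rad_pow n x z.
  apply: NNPP => nst.
  pose tot n := (\sum_x \sum_z \dim (rad_pow n x z))%N.
  have lt n : (tot n.+1 < tot n)%N.
    rewrite ltnNge; apply/negP=> le; apply: nst; exists n => x z.
    apply/eqP; rewrite eqEdim rad_pow_decr /= leqNgt; apply/negP=> ltxz.
    have : (tot n.+1 < tot n)%N; last by rewrite ltnNge le.
    rewrite /tot (bigD1 x) // [X in (_ < X)%N](bigD1 x) //= -addSn leq_add //.
      rewrite (bigD1 z) // [X in (_ < X)%N](bigD1 z) //= -addSn leq_add //.
      by apply: leq_sum => y _; apply/dimvS/rad_pow_decr.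
    by apply: leq_sum => y _; apply: leq_sum => w _; apply/dimvS/rad_pow_decr.
  have le m : (tot m + m <= tot 0)%N.
    elim: m => [|m IHm]; first by rewrite addn0.
    by apply: leq_trans IHm; rewrite addnS -addSn leq_add2r.
  by have := le (tot 0%N).+1; rewrite leqNgt ltn_addl.
exists n => x z; pose W y := rad_pow n x y.
pose T := {y : V & 'I_(\dim (W y))}.
pose b (t : T) : 'Hom(X x, X (tag t)) := (vbasis (W (tag t)))`_(tagged t).
have [D [i [p [hi hp pi ip]]]] := biproduct_exists (fun t : T => X (tag t)).
have /fin_all_exists[g gP] : forall t : T,
    exists g : forall s : T, 'Hom(X (tag s), X (tag t)),
      (forall s, g s \in rad (tag s) (tag t)) /\ b t = \sum_s g s \c b s.
  move=> t; have : b t \in rad_pow n.+1 x (tag t).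
    by rewrite stable; apply: mem_vbasis_nth.
  case/memv_sumP=> F mF ->.
  have /fin_all_exists[h hP] : forall y, exists h : 'I_(\dim (W y)) -> 'Hom(X y, X (tag t)),
      (forall s, h s \in rad y (tag t)) /\ F y = \sum_(s < \dim (W y)) h s \c (vbasis (W y))`_s.
    by move=> y; have /compv_expandr[h hh ->] := mF y isT; exists h.
  exists (fun s => h (tag s) (tagged s)); split=> [s|]; first by case: (hP (tag s)).
  rewrite (sum_sigma (J := fun y => 'I_(\dim (W y))) (fun y s => h y s \c (vbasis (W y))`_s)).
  by apply: eq_bigr => y _; case: (hP y).
pose v := \sum_t i t \c b t.
pose u : 'End(D) := \sum_t \sum_s i t \c g t s \c p s.
have hb t : b t \in hom x (tag t).
  by apply: (subvP (rad_pow_hom n _ _)); apply: mem_vbasis_nth.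
have pv s : p s \c v = b s by apply: biproduct_proj.
have uv : u \c v = v.
  rewrite comp_lfun_suml; apply: eq_bigr => t _; rewrite comp_lfun_suml.
  have [_ ->] := gP t; rewrite comp_lfun_sumr; apply: eq_bigr => s _.
  by rewrite -!comp_lfunA pv.
have ru : u \in radv D D.
  apply: rpred_sum => t _; apply: rpred_sum => s _; have [rg _] := gP t.
  by apply: rad_compr => //; apply: rad_compl.
have v0 : v = 0.
  have [_ [c _ [c1 _]]] := rad_one_sub ru.
  by rewrite -[v]comp_lfun1l -c1 -comp_lfunA comp_lfunBl comp_lfun1l uv subrr comp_lfun0r.
apply/eqP; rewrite -dimv_eq0 -leqn0 leqNgt; apply/negP=> d0.
pose t : T := Tagged (fun y => 'I_(\dim (W y))) (Ordinal d0 : 'I_(\dim (W z))).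
have : b t = 0 by rewrite -pv v0 comp_lfun0r.
have : b t \in (vbasis (W z) : seq _) by rewrite /b /= mem_nth // size_tuple.
by move=> /[swap] ->; have := basis_free (vbasisP (W z)) => /free_not0/[apply]/eqP.
Qed.

(** ** Sink maps built from arrows *)

(** Lifts to actual maps of the spaces [rad / rad ^ 2] of irreducible maps. The
    various choices of lifts are the whole point: a different one is made at each
    depth, so that the mesh relations hold exactly. *)
Definition arrow_spaces (L : forall x z, {vspace 'Hom(X x, X z)}) : Prop :=
  forall x z, (L x z + rad_pow 2 x z)%VS = rad x z /\
              (L x z :&: rad_pow 2 x z)%VS = 0%VS.

Definition arr (L : forall x z, {vspace 'Hom(X x, X z)}) z : finType :=
  {x : V & 'I_(\dim (L x z))}.

Definition mk_arr L z y (s : 'I_(\dim (L y z))) : arr L z :=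
  Tagged (fun y => 'I_(\dim (L y z))) s.

Definition arrow L z (t : arr L z) : 'Hom(X (tag t), X z) :=
  (vbasis (L (tag t) z))`_(tagged t).

Lemma arrow_mem L z (t : arr L z) : arrow t \in L (tag t) z.
Proof. exact: mem_vbasis_nth. Qed.

Lemma sum_compv_expand L z x (W : forall y, {vspace 'Hom(X x, X y)}) f :
    f \in (\sum_y compv (L y z) (W y))%VS ->
  exists2 h : forall t : arr L z, 'Hom(X x, X (tag t)),
    forall t, h t \in W (tag t) & f = \sum_t arrow t \c h t.
Proof.
case/memv_sumP=> F mF ->.
have /fin_all_exists[h hP] : forall y, exists h : 'I_(\dim (L y z)) -> 'Hom(X x, X y),
    (forall t, h t \in W y) /\ F y = \sum_(t < \dim (L y z)) (vbasis (L y z))`_t \c h t.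
  by move=> y; have /compv_expandl[h hh ->] := mF y isT; exists h.
exists (fun t => h (tag t) (tagged t)) => [t|]; first by case: (hP (tag t)).
rewrite (sum_sigma (J := fun y => 'I_(\dim (L y z)))
  (fun y t => (vbasis (L y z))`_t \c h y t)).
by apply: eq_bigr => y _; case: (hP y).
Qed.

Lemma arrows_exist : exists L, arrow_spaces L.
Proof.
exists (fun x z => rad x z :\: rad_pow 2 x z)%VS => x z; split; last exact: capv_diff.
rewrite addv_diff; apply/addv_idPl.
by rewrite -rad_pow1; apply: rad_pow_decr.
Qed.

Section Sink.
Variables (L : forall x z, {vspace 'Hom(X x, X z)}) (L_arrows : arrow_spaces L).

Lemma arrows_rad x z : (L x z <= rad x z)%VS.
Proof. by have [<- _] := L_arrows x z; apply: addvSl. Qed.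

Lemma arrow_rad z (t : arr L z) : arrow t \in rad (tag t) z.
Proof. exact: (subvP (arrows_rad _ _)) (arrow_mem t). Qed.

Lemma arrow_split x z f : f \in rad x z ->
  exists2 l, l \in L x z & f - l \in rad_pow 2 x z.
Proof.
have [<- _] := L_arrows x z => /memv_addP[l Ll [r r2 ->]].
by exists l; rewrite // addrC addKr.
Qed.

Lemma rad_generated x z : (rad x z <= \sum_y compv (L y z) (hom x y))%VS.
Proof.
set Im := (\sum_y _)%VS.
have step n : (rad_pow n.+1 x z <= Im + rad_pow n.+2 x z)%VS.
  apply: rad_powS_subP => y f g /arrow_split[l Ll r2] rg.
  rewrite -[f](subrK l) addrC comp_lfunDl; apply: memv_add.
    rewrite memvE (sumv_sup y) // -memvE; apply: memv_compv => //.
    exact: (subvP (rad_pow_hom n x y)).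
  by rewrite -[n.+2]/(2 + n)%N; apply: rad_pow_comp rg.
have le n : (rad x z <= Im + rad_pow n.+1 x z)%VS.
  elim: n => [|n IHn]; first by rewrite rad_pow1 addvSr.
  by apply: subv_trans IHn _; rewrite subv_add addvSl step.
have [n nil] := rad_pow_nilpotent.
apply: subv_trans (le n) _; rewrite subv_add subvv /=.
by apply: subv_trans (rad_pow_decr n x z) _; rewrite nil sub0v.
Qed.

Lemma rad_expand x z f : f \in rad x z ->
  exists2 h : forall t : arr L z, 'Hom(X x, X (tag t)),
    forall t, h t \in hom x (tag t) & f = \sum_t arrow t \c h t.
Proof. by move/(subvP (rad_generated x z))/sum_compv_expand. Qed.

(** A relation between arrows has no scalar coefficients, as arrows are
    linearly independent modulo the square of the radical. *)
Lemma arrow_relation_rad x z (h : forall t : arr L z, 'Hom(X x, X (tag t))) :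
    (forall t, h t \in hom x (tag t)) -> \sum_t arrow t \c h t \in rad_pow 2 x z ->
  forall t, h t \in rad x (tag t).
Proof.
move=> hh sum2.
have /fin_all_exists[c cP] : forall t, exists c, h t - c *: delta X x (tag t) \in rad x (tag t).
  by move=> t; apply: hom_delta_rad (hh t).
pose S := \sum_t c t *: (arrow t \c delta X x (tag t)).
pose tg y (s : 'I_(\dim (L y z))) := mk_arr s.
have SL : S = \sum_(s < \dim (L x z)) c (tg x s) *: (vbasis (L x z))`_s.
  pose F y (s : 'I_(\dim (L y z))) := c (tg y s) *: ((vbasis (L y z))`_s \c delta X x y).
  transitivity (\sum_(t : arr L z) F (tag t) (tagged t)).
    by apply: eq_bigr => -[].
  rewrite (sum_sigma (J := fun y => 'I_(\dim (L y z))) F) (bigD1 x) //= [X in _ + X]big1.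
    by rewrite addr0; apply: eq_bigr => s _; rewrite /F delta_eq comp_lfun1r.
  move=> y nyx; apply: big1 => s _.
  by rewrite /F delta_neq 1?eq_sym // comp_lfun0r scaler0.
have S0 : S = 0.
  apply/eqP; rewrite -memv0; have [_ <-] := L_arrows x z; rewrite memv_cap.
  apply/andP; split.
    by rewrite SL; apply: rpred_sum => s _; rewrite rpredZ ?mem_vbasis_nth.
  have -> : S = \sum_t arrow t \c h t -
      \sum_t arrow t \c (h t - c t *: delta X x (tag t)).
    rewrite -sumrB; apply: eq_bigr => t _.
    by rewrite -comp_lfunBr opprB addrCA subrr addr0 comp_scale.
  apply: rpredB => //; apply: rpred_sum => t _.
  by apply: memv_rad_powS; [apply: arrow_rad | rewrite rad_pow1; apply: cP].
have c0 s : c (tg x s) = 0.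
  have /freeP := basis_free (vbasisP (L x z)).
  by move/(_ (fun s => c (tg x s))); apply; rewrite -SL S0.
have c0' t : tag t = x -> c t = 0 by case: t => y s /= e; subst y; apply: c0.
move=> t; have [/c0' ct0|nx] := eqVneq (tag t) x; last first.
  by apply: rad_neq (hh t); rewrite eq_sym.
by have := cP t; rewrite ct0 scale0r subr0.
Qed.

Lemma arrow_sink z :
  exists (Y : rmodule A) (i : forall t : arr L z, 'Hom(X (tag t), Y))
         (p : forall t : arr L z, 'Hom(Y, X (tag t))),
  [/\ forall t, i t \in homv (X (tag t)) Y, forall t, p t \in homv Y (X (tag t)),
      forall s t, p t \c i s = delta (fun t : arr L z => X (tag t)) s t,
      \sum_t i t \c p t = \1%VF & sink (\sum_t arrow t \c p t)].
Proof.
have [Y [i [p [hi hp pi ip]]]] := biproduct_exists (fun t : arr L z => X (tag t)).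
exists Y, i, p; split=> //; set g := \sum_t arrow t \c p t.
have gi t : g \c i t = arrow t by apply: biproduct_inj.
split; first by apply: rpred_sum => t _; apply: rad_compr (arrow_rad t) (hp t).
- apply: decomposition_ind => [M zM f _|M indM f rf|M M1 M2 i1 i2 p1 p2 hi1 hi2 hp1 hp2 ip12 IH1 IH2 f rf].
  + by exists 0; rewrite ?rpred0 // (hom_zerol f zM) comp_lfun0r.
  + have [x /isomorphicP[phi iphi]] := X_complete indM.
    have [hphi _] := iphi; have [psi [hpsi _] [psiphi _]] := isom_inv iphi.
    have [|h hh e] := @rad_expand x z (f \c psi); first exact: rad_compr.
    exists ((\sum_t i t \c h t) \c phi).
      by apply: hom_comp => //; apply: rpred_sum => t _; apply: hom_comp.
    rewrite comp_lfunA comp_lfun_sumr.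
    under eq_bigr => t _ do rewrite comp_lfunA gi.
    by rewrite -e -comp_lfunA psiphi comp_lfun1r.
  have [s1 hs1 e1] := IH1 _ (rad_compr rf hi1).
  have [s2 hs2 e2] := IH2 _ (rad_compr rf hi2).
  exists (s1 \c p1 + s2 \c p2); first by rewrite rpredD ?hom_comp.
  by rewrite comp_lfunDr !comp_lfunA -e1 -e2 -!comp_lfunA -comp_lfunDr ip12 comp_lfun1r.
apply: decomposition_ind => [M zM u _ _|M indM u hu gu|M M1 M2 i1 i2 p1 p2 hi1 hi2 hp1 hp2 ip12 IH1 IH2 u hu gu].
+ by rewrite (hom_zerol u zM) rpred0.
+ have [x /isomorphicP[phi iphi]] := X_complete indM.
  have [hphi _] := iphi; have [psi [hpsi _] [psiphi _]] := isom_inv iphi.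
  rewrite -[u]comp_lfun1r -psiphi comp_lfunA; apply: rad_compr => //.
  rewrite -[u \c psi]comp_lfun1l -ip comp_lfun_suml; apply: rpred_sum => t _.
  rewrite -comp_lfunA; apply: rad_compl => //.
  apply: (arrow_relation_rad (h := fun t => p t \c (u \c psi))) => [s|].
    by rewrite !hom_comp.
  under eq_bigr => s _ do rewrite !comp_lfunA.
  by rewrite -!comp_lfun_suml gu comp_lfun0l rpred0.
rewrite -[u]comp_lfun1r -ip12 comp_lfunDr !comp_lfunA; apply: rpredD.
  by apply: rad_compr => //; apply: IH1; rewrite ?hom_comp // comp_lfunA gu comp_lfun0l.
by apply: rad_compr => //; apply: IH2; rewrite ?hom_comp // comp_lfunA gu comp_lfun0l.
Qed.

Definition spanned z w (beta : forall t : arr L z, 'Hom(X w, X (tag t))) y :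
    {vspace 'Hom(X w, X y)} :=
  (\sum_(s < \dim (L y z)) <[beta (mk_arr s) : 'Hom(X w, X y)]>)%VS.

(** The sink map [g : Y -> X z] assembled from the arrows is injective (for [X z]
    projective) or surjective. In the second case its kernel is some [X w], the
    translate of [X z]. As [X w -> Y] is left almost split, its components [beta]
    span [rad / rad ^ 2]; as its cokernel [g] is radical, they are independent
    there. So [beta] can serve in turn as arrows out of [X w]. *)
Lemma arrow_kernel z :
  (forall x (h : forall t : arr L z, 'Hom(X x, X (tag t))),
     (forall t, h t \in hom x (tag t)) -> \sum_t arrow t \c h t = 0 ->
     forall t, h t = 0) \/
  exists w (beta : forall t : arr L z, 'Hom(X w, X (tag t))),
  [/\ exists (Y : rmodule A) (g : 'Hom(Y, X z)) (f : 'Hom(X w, Y)),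
        sink g /\ short_exact f g,
      forall y, (spanned beta y + rad_pow 2 w y)%VS = rad w y /\
                (spanned beta y :&: rad_pow 2 w y)%VS = 0%VS,
      \sum_t arrow t \c beta t = 0 &
      forall x (h : forall t : arr L z, 'Hom(X x, X (tag t))),
        (forall t, h t \in hom x (tag t)) -> \sum_t arrow t \c h t = 0 ->
        exists2 u, u \in hom x w & forall t, h t = beta t \c u].
Proof.
have [Y [i [p [hi hp pi ip sg]]]] := arrow_sink z.
set g := \sum_t arrow t \c p t in sg.
have gi t : g \c i t = arrow t by apply: biproduct_inj.
have psum x (h : forall t : arr L z, 'Hom(X x, X (tag t))) t :
    p t \c (\sum_s i s \c h s) = h t.
  exact: biproduct_proj.
have gsum x (h : forall t : arr L z, 'Hom(X x, X (tag t))) :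
    g \c (\sum_s i s \c h s) = \sum_t arrow t \c h t.
  by rewrite comp_lfun_sumr; apply: eq_bigr => t _; rewrite comp_lfunA gi.
have [rg g1 g0] := sg.
case: (sink_mono_or_epi (X_ind z) sg) => [mg|eg].
  left=> x h hh h0 t; rewrite -psum; suff -> : \sum_s i s \c h s = 0.
    by rewrite comp_lfun0r.
  by apply: (mono_cancel mg); rewrite gsum h0 comp_lfun0r.
right; have [K [f0 [mf0 f0g]]] := kernel_exists (rad_hom rg).
have sfg0 : short_exact f0 g by split.
have indK := kernel_of_sink_indecomposable (X_ind z) sg sfg0.
have [w /isomorphic_sym/isomorphicP[phi iphi]] := X_complete indK.
pose f := f0 \c phi.
have sfg : short_exact f g.
  have [hphi phi0] := isom_mono iphi; have [_ phiT] := isom_epi iphi.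
  have [hf0 f00] := mf0.
  split=> //; last by rewrite limg_comp phiT.
  split; first exact: hom_comp.
  apply: zero_eq => m; rewrite memv_ker comp_lfunE -memv_ker f00 memv0.
  by rewrite -memv_ker phi0 memv0 => /eqP.
have [mf _ fg] := sfg; have [hf _] := mf; have gf := kernel_comp0 fg.
have rf : f \in radv (X w) Y by apply: g0.
pose beta t := p t \c f.
have rbeta t : beta t \in rad w (tag t) by apply: rad_compl.
have las y r : r \in rad w y -> exists2 u, u \in homv Y (X y) & r = u \c f.
  move=> rr; apply: (kernel_of_sink_left_almost_split (X_ind z) sg sfg) => [|v hv].
    exact: rad_hom.
  exact: nz_rad_not_split (indecomposable_nz (X_ind w)) rr hv.
exists w, beta; split.
- by exists Y, g, f.
- move=> y; have dbeta t : delta X (tag t) y \c beta t \in spanned beta y.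
    case: t => x s; rewrite [tag _]/=.
    have [exy|nxy] := eqVneq x y; last by rewrite delta_neq // comp_lfun0l rpred0.
    by subst y; rewrite delta_eq comp_lfun1l memvE; apply: (sumv_sup s).
  split.
    apply/eqP; rewrite eqEsubv; apply/andP; split.
      rewrite subv_add -[X in _ && (_ <= X)%VS]rad_pow1 rad_pow_decr andbT.
      by apply/subv_sumP=> s _; rewrite -memvE; apply: rbeta (mk_arr s).
    apply/subvP=> r /las[u hu ->].
    rewrite -[f]comp_lfun1l -ip comp_lfun_suml comp_lfun_sumr.
    apply: rpred_sum => t _; rewrite -comp_lfunA comp_lfunA -/(beta t).
    have hut : u \c i t \in hom (tag t) y by apply: hom_comp.
    have [c rc] := hom_delta_rad hut.
    rewrite -[u \c i t](subrK (c *: delta X (tag t) y)) comp_lfunDl addrC.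
    apply: memv_add; last by apply: memv_rad_powS => //; rewrite rad_pow1; apply: rbeta.
    by rewrite scale_comp; apply: rpredZ.
  apply: zero_eq => r; rewrite memv_cap => /andP[/memv_sumP[F mF ->]].
  have /fin_all_exists[c cP] : forall s, exists c, F s = c *: (beta (mk_arr s) : 'Hom(X w, X y)).
    by move=> s; have /vlineP[c ->] := mF s isT; exists c.
  under eq_bigr => s _ do rewrite cP.
  (* An element of [rad ^ 2] factors as [v f] with [v] radical, so a combination
     [P f] of components of [f] equal to it gives [P - v = h g], a radical map. *)
  case/memv_sumP=> G mG eG.
  have /fin_all_exists[u uP] : forall x, exists u, u \in radv Y (X y) /\ G x = u \c f.
    move=> x; have /compv_expandl[l hl ->] := mG x isT.
    have /fin_all_exists[v vP] : forall t, exists v, v \in homv Y (X x) /\ l t = v \c f.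
      by move=> t; have : l t \in rad_pow 1 w x := hl t; rewrite rad_pow1 => /las[v hv ->]; exists v.
    exists (\sum_(t < \dim (rad x y)) (vbasis (rad x y))`_t \c v t); split.
      apply: rpred_sum => t _; apply: rad_compr; first exact: mem_vbasis_nth.
      by case: (vP t).
    rewrite comp_lfun_suml; apply: eq_bigr => t _.
    by rewrite -comp_lfunA; case: (vP t) => _ <-.
  pose v := \sum_x u x.
  have rv : v \in radv Y (X y) by apply: rpred_sum => x _; case: (uP x).
  pose P := \sum_(s < \dim (L y z)) c s *: (p (mk_arr s) : 'Hom(Y, X y)).
  have hP : P \in homv Y (X y).
    by apply: rpred_sum => s _; apply: rpredZ; apply: hp (mk_arr s).
  have Pf : P \c f = \sum_s c s *: (beta (mk_arr s) : 'Hom(X w, X y)).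
    by rewrite comp_lfun_suml; apply: eq_bigr => s _; rewrite scale_comp.
  have [||h hh eh] := factor_cokernel (u := P - v) sfg.
  + by rewrite rpredB ?(rad_hom rv).
  + rewrite comp_lfunBl Pf eG comp_lfun_suml -sumrB big1 // => x _.
    by have [_ ->] := uP x; rewrite subrr.
  have rP : P \in radv Y (X y).
    by rewrite -[P](subrK v) eh; apply: rpredD => //; apply: rad_compl.
  apply: big1 => s _.
  suff -> : c s = 0 by rewrite scale0r.
  apply: (@scale_id_rad y).
  have -> : c s *: \1%VF = P \c i (mk_arr s).
    rewrite comp_lfun_suml (bigD1 s) //= scale_comp (pi (mk_arr s) (mk_arr s)) delta_eq.
    rewrite big1 ?addr0 // => s' ns.
    rewrite scale_comp (pi (mk_arr s) (mk_arr s')) delta_neq ?scaler0 //.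
    by apply: contraNneq ns => e; apply/eqP; apply: esym; apply: (eq_from_Tagged e).
  exact: rad_compr (hi (mk_arr s)).
- by rewrite -gsum /beta; under eq_bigr => t _ do rewrite comp_lfunA;
    rewrite -comp_lfun_suml ip comp_lfun1l.
move=> x h hh h0.
have [||u hu eu] := factor_kernel (u := \sum_s i s \c h s) mf fg.
- by apply: rpred_sum => s _; apply: hom_comp.
- by rewrite gsum.
by exists u => // t; rewrite -psum eu comp_lfunA.
Qed.

(** Each [w] is the translate of at most one [z], so the components [beta] found
    for the various [z] can be used as arrows simultaneously. *)
Lemma next_level :
  exists2 L', arrow_spaces L' &
    forall z x (h : forall t : arr L z, 'Hom(X x, X (tag t))),
      (forall t, h t \in hom x (tag t)) -> \sum_t arrow t \c h t = 0 ->
    exists w (beta : forall t : arr L z, 'Hom(X w, X (tag t))) u,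
      [/\ forall t, beta t \in L' w (tag t), u \in hom x w,
          \sum_t arrow t \c beta t = 0 & forall t, h t = beta t \c u].
Proof.
(* [o z] is the translate of [z] with the components of its left almost split
   map, or [None] when the sink map of [X z] is injective. *)
pose B z w := forall t : arr L z, 'Hom(X w, X (tag t)).
have /fin_all_exists[o oP] : forall z, exists o : option {w : V & B z w},
    match o with
    | None => forall x (h : B z x), (forall t, h t \in hom x (tag t)) ->
        \sum_t arrow t \c h t = 0 -> forall t, h t = 0
    | Some (existT w beta) =>
      [/\ exists (Y : rmodule A) (g : 'Hom(Y, X z)) (f : 'Hom(X w, Y)),
            sink g /\ short_exact f g,
          forall y, (spanned beta y + rad_pow 2 w y)%VS = rad w y /\
                    (spanned beta y :&: rad_pow 2 w y)%VS = 0%VS,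
          \sum_t arrow t \c beta t = 0 &
          forall x (h : B z x), (forall t, h t \in hom x (tag t)) ->
            \sum_t arrow t \c h t = 0 ->
            exists2 u, u \in hom x w & forall t, h t = beta t \c u]
    end.
  move=> z; have [inj|[w [beta bP]]] := arrow_kernel z; first by exists None.
  by exists (Some (existT _ w beta)).
have [L0 L0P] := arrows_exist.
have /fin_all_exists[L' L'P] : forall w, exists Lw : forall y, {vspace 'Hom(X w, X y)},
    (forall y, (Lw y + rad_pow 2 w y)%VS = rad w y /\
               (Lw y :&: rad_pow 2 w y)%VS = 0%VS) /\
    forall z (beta : B z w), o z = Some (existT _ w beta) ->
      forall t, beta t \in Lw (tag t).
  move=> w; have [[z [beta oz]]|no] :=
    classic (exists z (beta : B z w), o z = Some (existT _ w beta)); last first.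
    exists (L0 w); split=> [y|z beta oz]; first exact: L0P.
    by case: no; exists z, beta.
  have := oP z; rewrite oz => -[[Y [g [f [sg sfg]]]] bP _ _].
  exists (spanned beta); split=> // z' beta' oz'.
  have := oP z'; rewrite oz' => -[[Y' [g' [f' [sg' sfg']]]] _ _ _].
  have ezz : z = z'.
    exact/X_noniso/(kernel_of_sink_determines (X_ind z) (X_ind z') sg sg' sfg sfg').
  subst z'; move: oz'; rewrite oz => -[/(@eq_from_Tagged V (B z) w) <-] [y s].
  by rewrite memvE; apply: (sumv_sup s).
exists L' => [w|z x h hh h0]; first by case: (L'P w).
have := oP z; case oz: (o z) => [[w beta]|] => [[_ _ ab kb]|inj].
  have [u hu uP] := kb x h hh h0; exists w, beta, u; split=> //.
  by have [_] := L'P w; apply.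
exists x, (fun _ => 0), 0; split=> [t||| t]; rewrite ?rpred0 //.
  by apply: big1 => t _; rewrite comp_lfun0r.
by rewrite comp_lfun0r (inj x h).
Qed.

End Sink.

(** Relations between the arrows of [L] into a vertex are multiples of mesh
    relations, those whose coefficients lie in the arrow spaces of [L']. *)
Definition mesh_compatible (L L' : forall x z, {vspace 'Hom(X x, X z)}) : Prop :=
  forall z x (h : forall t : arr L z, 'Hom(X x, X (tag t))),
    (forall t, h t \in hom x (tag t)) -> \sum_t arrow t \c h t = 0 ->
  exists w (beta : forall t : arr L z, 'Hom(X w, X (tag t))) u,
    [/\ forall t, beta t \in L' w (tag t), u \in hom x w,
        \sum_t arrow t \c beta t = 0 & forall t, h t = beta t \c u].

Lemma levels_exist : exists Ls : nat -> forall x z, {vspace 'Hom(X x, X z)},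
  forall n, arrow_spaces (Ls n) /\ mesh_compatible (Ls n) (Ls n.+1).
Proof.
pose T := {L | arrow_spaces L}.
have next (L : T) : {L' : T | mesh_compatible (sval L) (sval L')}.
  apply: constructive_indefinite_description; case: L => L LP /=.
  by have [L' L'P cL] := next_level LP; exists (exist _ L' L'P).
have [L0 L0P] := arrows_exist.
pose Ls n := iter n (fun L => sval (next L)) (exist _ L0 L0P).
exists (fun n => sval (Ls n)) => n; split; first by case: (Ls n).
by rewrite /=; case: (next (Ls n)).
Qed.

(** * Decomposition of hom spaces along the levels *)

Section Levels.
Variable Ls : nat -> forall x z, {vspace 'Hom(X x, X z)}.
Hypothesis Ls_arrows : forall n, arrow_spaces (Ls n).
Hypothesis Ls_mesh : forall n, mesh_compatible (Ls n) (Ls n.+1).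

(** The span of the paths of length [m] from [X i] at depth [n + m] to [X j] at
    depth [n], an arrow from depth [n + 1] to depth [n] being taken in [Ls n]. *)
Fixpoint piece m n i j : {vspace 'Hom(X i, X j)} :=
  if m is m'.+1 then (\sum_x compv (Ls n x j) (piece m' n.+1 i x))%VS
  else <[delta X i j]>%VS.

Lemma pieceS m n i j :
  piece m.+1 n i j = (\sum_x compv (Ls n x j) (piece m n.+1 i x))%VS.
Proof. by []. Qed.

Lemma piece_cons m n i x j l h :
  l \in Ls n x j -> h \in piece m n.+1 i x -> l \c h \in piece m.+1 n i j.
Proof.
by move=> Ll Hh; rewrite pieceS memvE (sumv_sup x) // -memvE memv_compv.
Qed.

Lemma piece_expand m n i j f : f \in piece m.+1 n i j ->
  exists2 h : forall t : arr (Ls n) j, 'Hom(X i, X (tag t)),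
    forall t, h t \in piece m n.+1 i (tag t) & f = \sum_t arrow t \c h t.
Proof. exact: sum_compv_expand. Qed.

Lemma piece_comp m m' n x y z f g :
    f \in piece m n y z -> g \in piece m' (n + m) x y ->
  f \c g \in piece (m + m') n x z.
Proof.
elim: m n z f => [|m IHm] n z f.
  case/vlineP=> c ->; rewrite scale_comp addn0 => Hg; apply: rpredZ.
  case: (eqVneq y z) Hg => [<-|nyz] Hg; first by rewrite delta_eq comp_lfun1l.
  by rewrite delta_neq // comp_lfun0l rpred0.
case/piece_expand=> h Hh -> Hg; rewrite comp_lfun_suml; apply: rpred_sum => t _.
rewrite -comp_lfunA addSn; apply: piece_cons; first exact: arrow_mem.
by apply: IHm (Hh t) _; rewrite addSnnS.
Qed.

Lemma piece_rad_pow m n i j : (piece m n i j <= rad_pow m i j)%VS.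
Proof.
elim: m n j => [|m IHm] n j.
  by apply/subvP=> _ /vlineP[c ->]; apply/rpredZ/delta_hom.
apply/subvP=> f /piece_expand[h Hh ->]; apply: rpred_sum => t _.
apply: memv_rad_powS; first exact: (arrow_rad (Ls_arrows n) t).
exact: (subvP (IHm _ _)) (Hh t).
Qed.

Lemma piece_hom m n i j : (piece m n i j <= hom i j)%VS.
Proof. exact: subv_trans (piece_rad_pow _ _ _ _) (rad_pow_hom _ _ _). Qed.

(** Peeling off one arrow at a time on the target side; the remainder lies in
    [rad ^ M], which is zero for large [M]. *)
Lemma hom_pieces M n i j :
  (hom i j <= \sum_(l < M) piece l n i j + rad_pow M i j)%VS.
Proof.
elim: M n j => [|M IHM] n j; first by rewrite big_ord0 add0v.
apply/subvP=> f hf; have [c rf] := hom_delta_rad hf.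
have {rf}[h hh e] := rad_expand (Ls_arrows n) rf.
rewrite -[f](subrK (c *: delta X i j)) e; apply: rpredD.
  apply: rpred_sum => t _.
  have /memv_addP[g /memv_sumP[G mG ->] [r rr ->]] := subvP (IHM n.+1 (tag t)) _ (hh t).
  rewrite comp_lfunDr; apply: memv_add; last first.
    exact: memv_rad_powS (arrow_rad (Ls_arrows n) t) rr.
  rewrite comp_lfun_sumr big_ord_recl /= -[X in X \in _]add0r.
  apply: memv_add; first exact: mem0v.
  by apply: memv_sumr => l _; apply: piece_cons (arrow_mem t) (mG l isT).
rewrite memvE; apply: subv_trans (addvSl _ _).
by rewrite -memvE rpredZ // memvE (sumv_sup ord0).
Qed.

Variable N : nat.
Hypothesis rad_powN : forall i j, rad_pow N i j = 0%VS.

Lemma rad_pow_large m i j : (N <= m)%N -> rad_pow m i j = 0%VS.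
Proof.
move=> leNm; apply/eqP; rewrite -subv0 -(rad_powN i j) -(subnK leNm).
elim: (m - N)%N => [|d IHd]; first by rewrite add0n.
by apply: subv_trans IHd; apply: rad_pow_decr.
Qed.

Lemma piece_large m n i j : (N <= m)%N -> piece m n i j = 0%VS.
Proof.
by move=> leNm; apply/eqP; rewrite -subv0 -(rad_pow_large i j leNm) piece_rad_pow.
Qed.

Lemma rad_pow_pieces m n i j :
  (rad_pow m i j <= \sum_(l < N) piece (m + l) n i j)%VS.
Proof.
elim: m n j => [|m IHm] n j.
  by have := hom_pieces N n i j; rewrite rad_powN addv0.
apply: rad_powS_subP => y f g rf rg.
have [h hh ->] := rad_expand (Ls_arrows n) rf.
rewrite comp_lfun_suml; apply: rpred_sum => t _; rewrite -comp_lfunA.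
have /(subvP (IHm n.+1 _))/memv_sumP[G mG ->] : h t \c g \in rad_pow m i (tag t).
  exact: (@rad_pow_comp 0 m _ _ _ _ _ (hh t) rg).
rewrite comp_lfun_sumr; apply: memv_sumr => l _.
exact: piece_cons (arrow_mem t) (mG l isT).
Qed.

Lemma sum_pieces_large n i j (f : nat -> 'Hom(X i, X j)) d :
    (forall l, f l \in piece l n i j) ->
  \sum_(l < N + d) f l = \sum_(l < N) f l.
Proof.
move=> fH; elim: d => [|d IHd]; first by rewrite addn0.
rewrite addnS big_ord_recr /= IHd; have := fH (N + d)%N.
by rewrite piece_large ?leq_addr // memv0 => /eqP->; rewrite addr0.
Qed.

(** The lowest terms vanish first. Write [f l] as a combination of arrows with
    coefficients [h (l - 1)] in the pieces of the next level. The sum of the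
    coefficients is a relation between arrows, so it is [beta u] for a mesh
    relation [beta]; decomposing [u] and comparing degrees at the next level,
    which is possible by induction, [h m] is [beta] times a component of [u], so
    that [f (m + 1)] is a multiple of the mesh relation. *)
Lemma pieces_independent n i j (f : nat -> 'Hom(X i, X j)) :
    (forall l, f l \in piece l n i j) -> \sum_(l < N) f l = 0 ->
  forall l, f l = 0.
Proof.
suff H m : forall n j (f : nat -> 'Hom(X i, X j)), (forall l, f l \in piece l n i j) ->
    \sum_(l < N) f l = 0 -> forall l, (l <= m)%N -> f l = 0.
  by move=> fH f0 l; apply: (H l n j f).
have large n' j' (f' : nat -> 'Hom(X i, X j')) :
    (forall l, f' l \in piece l n' i j') -> \sum_(l < N.+1) f' l = \sum_(l < N) f' l.
  by move/(sum_pieces_large 1); rewrite addn1.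
elim: m => [|m IHm] {n j f} n j f fH f0.
  move=> [|//] _; have /vlineP[c ec] := fH 0%N.
  have := f0; rewrite -(large _ _ _ fH) big_ord_recl => /eqP.
  rewrite addr_eq0 => /eqP ef0.
  have : f 0%N \in rad i j.
    rewrite ef0 rpredN; apply: rpred_sum => l _.
    rewrite -rad_pow1; have := subvP (piece_rad_pow l.+1 n i j) _ (fH _).
    elim: (l : nat) (f _) => // q IHq g gq; apply: IHq.
    exact: (subvP (rad_pow_decr _ _ _)).
  rewrite ec; case: (eqVneq i j) (c) => [<-|nij] c'; last first.
    by rewrite delta_neq // scaler0.
  by rewrite delta_eq => /scale_id_rad->; rewrite scale0r.
move=> l; rewrite leq_eqVlt => /orP[/eqP->|]; last by rewrite ltnS; apply: (IHm n j f).
have f_0 : f 0%N = 0 by apply: (IHm n j f).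
have sumS : \sum_(l < N) f l.+1 = 0.
  by have := f0; rewrite -(large _ _ _ fH) big_ord_recl f_0 add0r.
have hP q : {h : forall t : arr (Ls n) j, 'Hom(X i, X (tag t)) |
    (forall t, h t \in piece q n.+1 i (tag t)) /\ f q.+1 = \sum_t arrow t \c h t}.
  apply: constructive_indefinite_description.
  by have [h hh e] := piece_expand (fH q.+1); exists h.
pose h q := sval (hP q).
have hH q t : h q t \in piece q n.+1 i (tag t) by rewrite /h; case: (hP q) => ? [].
have fE q : f q.+1 = \sum_t arrow t \c h q t by rewrite /h; case: (hP q) => ? [].
have [||w [beta [u [bL hu ab hb]]]] := Ls_mesh (n := n) (z := j) (x := i)
  (h := fun t => \sum_(q < N) h q t).
- by move=> t; apply: rpred_sum => q _; apply: (subvP (piece_hom _ _ _ _)) (hH q t).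
- rewrite -[RHS]sumS; under [RHS]eq_bigr => q _ do rewrite fE.
  by rewrite exchange_big; apply: eq_bigr => t _; rewrite comp_lfun_sumr.
have /(subvP (rad_pow_pieces 0 n.+2 i w))/memv_sumP[U mU eu] := hu.
have {}bL t q (o : (q < N)%N) : beta t \c U (Ordinal o) \in piece q.+1 n.+1 i (tag t).
  exact: piece_cons (bL t) (mU (Ordinal o) isT).
pose U' q := if insub q is Some o then U o else 0.
have U'E (o : 'I_N) : U' o = U o by rewrite /U' valK.
have bU' t q : beta t \c U' q \in piece q.+1 n.+1 i (tag t).
  by rewrite /U'; case: insubP => [[q' o] _ <-|_]; rewrite ?bL // comp_lfun0r rpred0.
(* [e t] compares both expressions of the coefficient of the arrow [t] in each
   degree: [beta] raises degrees by one. *)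
pose e t q := h q t - (if q is q'.+1 then beta t \c U' q' else 0).
have e0 t : e t m = 0.
  apply: (IHm n.+1 (tag t) (e t)) => // [q|].
    apply: rpredB; first exact: hH.
    by case: q => [|q]; [apply: mem0v | apply: bU'].
  rewrite sumrB hb eu comp_lfun_sumr; apply/eqP; rewrite subr_eq0; apply/eqP.
  under eq_bigr => q _ do rewrite -U'E.
  rewrite -(large n.+1 (tag t) (fun q => if q is q'.+1 then beta t \c U' q' else 0)).
    by rewrite big_ord_recl add0r.
  by case=> [|q]; [apply: mem0v | apply: bU'].
have hm t : h m t = if m is q.+1 then beta t \c U' q else 0.
  by apply/eqP; rewrite -subr_eq0 -/(e t m) e0.
rewrite fE; under eq_bigr => t _ do rewrite hm.
case: (m) => [|q]; first by apply: big1 => t _; rewrite comp_lfun0r.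
by under eq_bigr => t _ do rewrite comp_lfunA; rewrite -comp_lfun_suml ab comp_lfun0l.
Qed.

(** In particular the dimension of a piece does not depend on the depth, though
    the piece itself may. *)
Lemma dim_piece m n i j :
  \dim (piece m n i j) = (\dim (rad_pow m i j) - \dim (rad_pow m.+1 i j))%N.
Proof.
have cap0 : (piece m n i j :&: rad_pow m.+1 i j)%VS = 0%VS.
  apply: zero_eq => f; rewrite memv_cap => /andP[fH].
  case/(subvP (rad_pow_pieces _ n _ _))/memv_sumP=> G mG ef.
  pose g q := if (q < m)%N then 0 else if q == m then f else
    if insub (q - m.+1)%N is Some o then - G o else 0.
  have gH q : g q \in piece q n i j.
    rewrite /g; case: ltngtP => [_|lt|->] //; first exact: rpred0.
    case: insubP => [o _ eo|_]; last exact: rpred0.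
    by rewrite rpredN -(subnKC lt) -eo; apply: mG.
  have -> : f = g m by rewrite /g ltnn eqxx.
  apply: (pieces_independent gH); rewrite -(sum_pieces_large m.+1 gH) addnC.
  rewrite big_split_ord big_ord_recr /= big1 => [|q _]; last by rewrite /g ltn_ord.
  rewrite add0r {1}/g ltnn eqxx ef -big_split big1 //= => l _.
  have lt : (m < m.+1 + l)%N by rewrite addSn ltnS leq_addr.
  by rewrite /g ltnNge (ltnW lt) gtn_eqF //= addKn valK subrr.
have sum : (piece m n i j + rad_pow m.+1 i j)%VS = rad_pow m i j.
  apply/eqP; rewrite eqEsubv subv_add piece_rad_pow rad_pow_decr /=.
  apply: subv_trans (rad_pow_pieces m n i j) _; apply/subv_sumP=> -[[|l] o] _ /=.
    by rewrite addn0 addvSl.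
  apply: subv_trans (piece_rad_pow _ _ _ _) _; apply: subv_trans (addvSr _ _).
  rewrite addnS -addSn; elim: (l) => [|d IHd]; first by rewrite addn0.
  by rewrite addnS; apply: subv_trans (rad_pow_decr _ _ _) IHd.
by rewrite -sum dimv_disjoint_sum // addnK.
Qed.

End Levels.

End Indecomposables.

(** * Projective dimension *)

Section Postcomposition.
Variables (k : fieldType) (L M N : vectType k) (f : 'Hom(M, N)).

Definition postc_fun (g : 'Hom(L, M)) : 'Hom(L, N) := f \c g.
Fact postc_linear : linear postc_fun.
Proof. by move=> c g h; rewrite /postc_fun comp_lfunDr comp_scale. Qed.
HB.instance Definition _ :=
  GRing.isLinear.Build k 'Hom(L, M) 'Hom(L, N) _ postc_fun postc_linear.
Definition postc : 'Hom('Hom(L, M), 'Hom(L, N)) := linfun postc_fun.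

Lemma postcE g : postc g = f \c g.
Proof. exact: lfunE. Qed.

Lemma postc_lker0 : lker f = 0%VS -> lker postc = 0%VS.
Proof.
move=> /eqP f0; apply: zero_eq => g; rewrite memv_ker postcE => /eqP fg.
apply/lfunP=> x; apply: (lker0P f0).
by rewrite -comp_lfunE fg !lfunE linear0.
Qed.

End Postcomposition.

Section Projective.
Variables (k : fieldType) (A : falgType k).
Implicit Types K M N Q R : rmodule A.

Lemma projective_lift Q M N (g : 'Hom(M, N)) (f : 'Hom(Q, N)) :
    projective Q -> epi g -> f \in homv Q N ->
  exists2 h, h \in homv Q M & g \c h = f.
Proof.
move=> pQ [/homvP hg gT] /homvP hf; have [h hh gh] := pQ _ _ _ _ hg gT hf.
by exists h => //; apply/homvP.
Qed.

Lemma zero_projective Q : zero_mod Q -> projective Q.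
Proof.
move=> zQ M N g f _ _ _; exists 0; first by apply/homvP; apply: rpred0.
by rewrite comp_lfun0r (hom_zerol f zQ).
Qed.

Lemma biproduct_projective (T : finType) (P : T -> rmodule A) Q
    (i : forall t, 'Hom(P t, Q)) (p : forall t, 'Hom(Q, P t)) :
    (forall t, i t \in homv (P t) Q) -> (forall t, p t \in homv Q (P t)) ->
    \sum_t i t \c p t = \1%VF -> (forall t, projective (P t)) -> projective Q.
Proof.
move=> hi hp ip pP M N g f /homvP hg gT /homvP hf.
have /fin_all_exists[h hP] : forall t, exists h : 'Hom(P t, M),
    h \in homv (P t) M /\ g \c h = f \c i t.
  move=> t; have eg : epi g by split.
  by have [h hh gh] := projective_lift (pP t) eg (hom_comp hf (hi t)); exists h.
exists (\sum_t h t \c p t).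
  apply/homvP/rpred_sum => t _; apply: hom_comp => //; by case: (hP t).
rewrite comp_lfun_sumr -[f]comp_lfun1r -ip comp_lfun_sumr; apply: eq_bigr => t _.
by rewrite !comp_lfunA; case: (hP t) => _ ->.
Qed.

Definition syzygy M K : Prop :=
  exists Q (f : 'Hom(K, Q)) (g : 'Hom(Q, M)), projective Q /\ short_exact f g.

(** Quantifying over all syzygies makes the notion usable for the particular
    projective covers constructed for lifted modules. *)
Fixpoint pdim_at_most n M : Prop :=
  if n is n'.+1 then forall K, syzygy M K -> pdim_at_most n' K else projective M.

(** A one-sided form of stable isomorphism. It replaces Schanuel's lemma, as it
    passes to arbitrary syzygies and needs no direct sums. *)
Definition stable_retract M M' : Prop :=
  exists (f : 'Hom(M, M')) (g : 'Hom(M', M)) R (u : 'Hom(M, R)) (v : 'Hom(R, M)),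
  [/\ [/\ f \in homv M M', g \in homv M' M, u \in homv M R & v \in homv R M],
      projective R & g \c f + v \c u = \1%VF].

Lemma stable_retract_refl M : stable_retract M M.
Proof.
have [Z zZ] := zero_mod_exists A.
exists \1%VF, \1%VF, Z, 0, 0; split; first by rewrite !rpred0 !hom_id.
  exact: zero_projective.
by rewrite comp_lfun0r addr0 comp_lfun1r.
Qed.

Lemma stable_retract_projective M M' :
  stable_retract M M' -> projective M' -> projective M.
Proof.
move=> [f [g [R [u [v [[hf hg hu hv] pR e]]]]]] pM' Y Z q h hq qT hh.
have eq : epi q by split=> //; apply/homvP.
have {}hh : h \in homv M Z by apply/homvP.
have [a ha qa] := projective_lift pM' eq (hom_comp hh hg).
have [b hb qb] := projective_lift pR eq (hom_comp hh hv).
exists (a \c f + b \c u); first by apply/homvP; rewrite rpredD ?hom_comp.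
by rewrite comp_lfunDr !comp_lfunA qa qb -!comp_lfunA -comp_lfunDr e comp_lfun1r.
Qed.

Lemma stable_retract_syzygy M M' K K' :
  stable_retract M M' -> syzygy M K -> syzygy M' K' -> stable_retract K K'.
Proof.
move=> [f [g [R [u [v [[hf hg hu hv] pR e]]]]]].
move=> [Q [i [p [pQ sip]]]] [Q' [i' [p' [pQ' sip']]]].
have [mi ep ipE] := sip; have [mi' ep' ipE'] := sip'.
have hp : p \in homv Q M by case: ep.
have hp' : p' \in homv Q' M' by case: ep'.
have hi : i \in homv K Q by case: mi.
have hi' : i' \in homv K' Q' by case: mi'.
have pi0 := kernel_comp0 ipE; have pi0' := kernel_comp0 ipE'.
have [F hF pF] := projective_lift pQ ep' (hom_comp hf hp).
have [G hG pG] := projective_lift pQ' ep (hom_comp hg hp').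
have [w hw pw] := projective_lift pR ep hv.
have [|a ha ea] := factor_kernel mi' ipE' (hom_comp hF hi).
  by rewrite comp_lfunA pF -comp_lfunA pi0 comp_lfun0r.
have [|b hb eb] := factor_kernel mi ipE (hom_comp hG hi').
  by rewrite comp_lfunA pG -comp_lfunA pi0' comp_lfun0r.
pose c := \1%VF - G \c F - w \c u \c p.
have hc : c \in homv Q Q by rewrite !rpredB ?hom_id ?hom_comp.
have [|r hr er] := factor_kernel mi ipE hc.
  rewrite !comp_lfunBr comp_lfun1r !comp_lfunA pG pw -(comp_lfunA g) pF.
  rewrite comp_lfunA -addrA -opprD -comp_lfunDl e comp_lfun1l.
  exact: subrr.
exists a, b, Q, i, r; split=> //.
apply: (mono_cancel mi); rewrite comp_lfunDr !comp_lfunA -eb -er comp_lfun1r.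
rewrite -(comp_lfunA G) -ea /c !comp_lfunBl comp_lfun1l -(comp_lfunA _ p) pi0.
by rewrite comp_lfun0r subr0 comp_lfunA addrC subrK.
Qed.

Lemma pdim_le_at_most M n : pdim_le M n ->
  forall M', stable_retract M' M -> pdim_at_most n.+1 M'.
Proof.
move=> [P [d [eps [pP dP [/homvP heps kereps] epsT Pn]]]].
have hd i : d i \in homv (P i.+1) (P i) by apply/homvP; case: (dP i).
(* The image of [d (i + 1)] is a syzygy of the image of [d i]. *)
have Pexact i K (j : 'Hom(K, P i)) : mono j -> limg j = limg (d i) ->
    exists K' (j' : 'Hom(K', P i.+1)), [/\ syzygy K K', mono j' & limg j' = limg (d i.+1)].
  move=> mj ij; have [K' [j' [mj' ij']]] := submodule_mono (limg_submodule (hd i.+1)).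
  have [|q hq eq] := factor_mono mj (hd i); first by rewrite ij.
  exists K', j'; split=> //; exists (P i.+1), j', q; split; first exact: pP.
  have [hj /eqP j0] := mj.
  split=> //; first split=> //.
    apply: full_eq => x; have /memv_imgP[y _ ey] : j x \in limg (d i).
      by rewrite -ij memv_img ?memvf.
    have -> : x = q y by apply: (lker0P j0); rewrite ey eq comp_lfunE.
    by rewrite memv_img ?memvf.
  rewrite ij'; have [_ <-] := dP i; apply/vspaceP=> x; rewrite !memv_ker eq comp_lfunE.
  apply/eqP/eqP=> [jq0|->]; last by rewrite linear0.
  by apply: (lker0P j0); rewrite linear0.
have main m : forall i K (j : 'Hom(K, P i)) M', (n < i.+1 + m)%N -> mono j ->
    limg j = limg (d i) -> stable_retract M' K -> pdim_at_most m M'.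
  elim: m => [|m IHm] i K j M' lt_n mj ij MK.
    apply: stable_retract_projective MK _; apply: zero_projective.
    rewrite addn0 in lt_n; have di0 := hom_zerol (d i) (Pn _ lt_n).
    have [_ /eqP j0] := mj; apply: zero_eq => x _; apply: (lker0P j0).
    have : j x \in limg (d i) by rewrite -ij memv_img ?memvf.
    by case/memv_imgP=> y _ ->; rewrite di0 zero_lfunE linear0.
  move=> L ML; have [K' [j' [KK' mj' ij']]] := Pexact i K j mj ij.
  apply: (IHm i.+1 K' j') => //; first by rewrite addSnnS.
  exact: stable_retract_syzygy MK ML KK'.
move=> M' MM' K MK; have [K0 [j [mj ij]]] := submodule_mono (limg_submodule (hd 0%N)).
apply: (main n 0%N K0 j K _ mj ij) => //.
apply: stable_retract_syzygy MM' MK _.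
exists (P 0%N), j, eps; split; first exact: pP.
by split=> //; rewrite ij kereps.
Qed.

End Projective.

(** * Lifted modules *)

Lemma vline0 (k : fieldType) (V : vectType k) : <[0 : V]>%VS = 0%VS.
Proof. by apply: zero_eq => _ /vlineP[c ->]; rewrite scaler0. Qed.

Lemma memv_sum_nat (k : fieldType) (V : vectType k) (S : nat -> {vspace V}) n v :
    v \in (\sum_(a < n) S a)%VS ->
  exists2 F : nat -> V, forall a, F a \in S a & v = \sum_(a < n) F a.
Proof.
case/memv_sumP=> G mG ->.
exists (fun a => if insub a is Some o then G o else 0) => [a|].
  by case: insubP => [o _ <-|_]; rewrite ?mem0v // mG.
by apply: eq_bigr => o _; rewrite valK.
Qed.

(** The setting: projective modules [P i] that generate all modules, and subspaces
    [pc m n i j] of their hom spaces, to be thought of as the maps of degree [m]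
    from [P i] at depth [n + m] to [P j] at depth [n]. For each depth [n] of the
    target they decompose the hom space, with dimensions [d m i j] independent of
    [n]. When [pc m n] itself is independent of [n] this is a grading of the
    endomorphism algebra of the sum of the [P i], with semisimple degree zero. *)
Section Lifted.
Variables (k : fieldType) (A : falgType k) (I : finType) (P : I -> rmodule A).
Hypothesis P_proj : forall i, projective (P i).
Hypothesis P_gen : forall (M : rmodule A) (U : {vspace M}), is_submodule U ->
  (forall i f, f \in homv (P i) M -> (limg f <= U)%VS) -> U = fullv.
Hypothesis P_local : forall i (c : k), c *: \1%VF \in radv (P i) (P i) -> c = 0.

Variables (pc : nat -> nat -> forall i j, {vspace 'Hom(P i, P j)}) (N : nat).
Variable d : nat -> I -> I -> nat.
Hypothesis pc_hom : forall m n i j, (pc m n i j <= homv (P i) (P j))%VS.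
Hypothesis pc0 : forall n i j, pc 0 n i j = <[delta P i j]>%VS.
Hypothesis pc_rad : forall m n i j, (pc m.+1 n i j <= radv (P i) (P j))%VS.
Hypothesis pc_comp : forall m m' n i j l f g,
  f \in pc m n j l -> g \in pc m' (n + m)%N i j -> f \c g \in pc (m + m')%N n i l.
Hypothesis pc_large : forall m n i j, (N <= m)%N -> pc m n i j = 0%VS.
Hypothesis pc_span : forall n i j, (homv (P i) (P j) <= \sum_(l < N) pc l n i j)%VS.
Hypothesis pc_indep : forall n i j q (F : nat -> 'Hom(P i, P j)),
  (forall l, F l \in pc l n i j) -> \sum_(l < q) F l = 0 ->
  forall l, (l < q)%N -> F l = 0.
Hypothesis pc_dim : forall m n i j, \dim (pc m n i j) = d m i j.

Implicit Types M K Q : rmodule A.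

(** Maps from [P i] placed at depth [a] to [P j] placed at depth [b]. *)
Definition pcs b a i j : {vspace 'Hom(P i, P j)} :=
  if (b <= a)%N then pc (a - b)%N b i j else 0%VS.

Lemma pcs_hom b a i j : (pcs b a i j <= homv (P i) (P j))%VS.
Proof. by rewrite /pcs; case: ifP => _; rewrite ?pc_hom ?sub0v. Qed.

Lemma pcs_comp c b m i j l f g :
  f \in pcs c b j l -> g \in pc m b i j -> f \c g \in pcs c (b + m)%N i l.
Proof.
rewrite /pcs; case: leqP => [cb Hf Hg|_]; last first.
  by rewrite memv0 => /eqP-> _; rewrite comp_lfun0l mem0v.
rewrite (leq_trans cb) ?leq_addr // -addnBAC //.
by apply: pc_comp Hf _; rewrite subnKC.
Qed.

(** The analogue of a graded module: [S i a] is the part at depth [a] of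
    [Hom(P i, M)], that is of the component of [M] at the vertex [i]. *)
Record lifted M (S : forall i, nat -> {vspace 'Hom(P i, M)}) (bd : nat) : Prop :=
  Lifted {
  lifted_hom : forall i a, (S i a <= homv (P i) M)%VS;
  lifted_span : forall i, (homv (P i) M <= \sum_(a < bd) S i a)%VS;
  lifted_indep : forall i n (F : nat -> 'Hom(P i, M)),
    (forall a, F a \in S i a) -> \sum_(a < n) F a = 0 ->
    forall a, (a < n)%N -> F a = 0;
  lifted_large : forall i a, (bd <= a)%N -> S i a = 0%VS;
  lifted_comp : forall i j a m f g,
    f \in S j a -> g \in pc m a i j -> f \c g \in S i (a + m)%N }.

Lemma lifted_submodule M S bd K (i : 'Hom(K, M)) :
    lifted S bd -> mono i ->
    (forall l n (F : nat -> 'Hom(P l, M)), (forall a, F a \in S l a) ->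
      (limg (\sum_(a < n) F a)%R <= limg i)%VS ->
      forall a, (a < n)%N -> (limg (F a) <= limg i)%VS) ->
  lifted (fun l a => postc (P l) i @^-1: S l a)%VS bd.
Proof.
move=> [Sh Ss Si Sl Sc] mi homog; have [hi i0] := mi; split.
- move=> l a; apply/subvP=> v; rewrite -memv_preim postcE => Siv.
  have [||h hh e] := factor_mono (g := i \c v) mi; first exact: (subvP (Sh _ _)) Siv.
    by rewrite limg_comp limgS ?subvf.
  by rewrite (mono_cancel mi e).
- move=> l; apply/subvP=> v hv.
  have /(subvP (Ss l))/memv_sum_nat[F FS eF] := hom_comp hi hv.
  have Fi : forall a, (a < bd)%N -> (limg (F a) <= limg i)%VS.
    by apply: homog => //; rewrite -eF limg_comp limgS ?subvf.
  have /fin_all_exists[h hP] : forall a : 'I_bd, exists h, F a = i \c h.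
    move=> a; have [||h _ e] := factor_mono (g := F a) mi; last by exists h.
      exact: (subvP (Sh _ _)) (FS a).
    exact: Fi.
  have -> : v = \sum_a h a.
    apply: (mono_cancel mi); rewrite eF comp_lfun_sumr.
    by apply: eq_bigr => a _.
  by apply: memv_sumr => a _; rewrite -memv_preim postcE -hP.
- move=> l n F FS F0 a lt_a; apply: (mono_cancel mi); rewrite comp_lfun0r.
  apply: (Si l n (fun a => i \c F a)) => // [b|].
    by rewrite -postcE memv_preim.
  by rewrite -comp_lfun_sumr F0 comp_lfun0r.
- move=> l a le_a; rewrite Sl //; apply: zero_eq => v.
  by rewrite -memv_preim memv0 -memv_ker postc_lker0 // memv0 => /eqP.
move=> l j a m f g; rewrite -!memv_preim !postcE comp_lfunA; exact: Sc.
Qed.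

Section LiftedProjective.
Variables (T : finType) (ix : T -> I) (lv : T -> nat) (bd : nat).
Hypothesis lv_bd : forall t, (lv t < bd)%N.
Variables (Q : rmodule A) (inj : forall t, 'Hom(P (ix t), Q))
  (prj : forall t, 'Hom(Q, P (ix t))).
Hypothesis h_inj : forall t, inj t \in homv (P (ix t)) Q.
Hypothesis h_prj : forall t, prj t \in homv Q (P (ix t)).
Hypothesis prj_inj : forall s t, prj t \c inj s = delta (fun t => P (ix t)) s t.
Hypothesis sum_inj_prj : \sum_t inj t \c prj t = \1%VF.

Definition free_piece i a : {vspace 'Hom(P i, Q)} :=
  (\sum_t postc (P i) (inj t) @: pcs (lv t) a i (ix t))%VS.

Lemma sum_prj i (u : 'Hom(P i, Q)) : \sum_s inj s \c (prj s \c u) = u.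
Proof.
under eq_bigr => s _ do rewrite comp_lfunA.
by rewrite -comp_lfun_suml sum_inj_prj comp_lfun1l.
Qed.

Lemma free_pieceP i a u :
  u \in free_piece i a <-> forall t, prj t \c u \in pcs (lv t) a i (ix t).
Proof.
split=> [/memv_sumP[F mF ->] t|H].
  have /fin_all_exists[w wP] : forall t, exists w,
      w \in pcs (lv t) a i (ix t) /\ F t = inj t \c w.
    by move=> s; have /memv_imgP[w mw ->] := mF s isT; exists w; rewrite postcE.
  under eq_bigr => s _ do rewrite (wP s).2.
  by rewrite (biproduct_proj prj_inj); case: (wP t).
rewrite -(sum_prj u); apply: memv_sumr => t _.
by rewrite -postcE memv_img //; apply: H.
Qed.

Lemma inj_free_piece t : inj t \in free_piece (ix t) (lv t).
Proof.
apply/free_pieceP=> s; rewrite prj_inj.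
have [<-|nst] := eqVneq t s; last by rewrite delta_neq // mem0v.
rewrite delta_eq /pcs leqnn subnn pc0 -(delta_eq P (ix t)); exact: memv_line.
Qed.

Lemma dim_free_piece i a :
  \dim (free_piece i a) =
    (\sum_t if (lv t <= a)%N then d (a - lv t) i (ix t) else 0)%N.
Proof.
have dir : directv (\sum_t postc (P i) (inj t) @: pcs (lv t) a i (ix t))%VS.
  apply/directv_sum_independent => F mF F0 t _.
  have /fin_all_exists[w wP] : forall t, exists w, F t = inj t \c w.
    by move=> s; have /memv_imgP[w mw ->] := mF s isT; exists w; rewrite postcE.
  have := biproduct_proj prj_inj w t; rewrite -(eq_bigr _ (fun s _ => wP s)) F0 comp_lfun0r wP => <-.
  by rewrite comp_lfun0r.
rewrite /free_piece (directvP dir) /=; apply: eq_bigr => t _.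
rewrite limg_dim_eq.
  by rewrite /pcs; case: ifP => _; rewrite ?pc_dim ?dimv0.
apply: zero_eq => w; rewrite memv_cap memv_ker postcE => /andP[_ /eqP iw0].
rewrite -[w]comp_lfun1l -(delta_eq (fun t => P (ix t)) t) -prj_inj -comp_lfunA iw0.
by rewrite comp_lfun0r.
Qed.

Lemma lifted_free : lifted free_piece (bd + N).
Proof.
split.
- move=> i a; apply/subvP=> u /free_pieceP uP; rewrite -(sum_prj u).
  apply: rpred_sum => t _; apply: hom_comp => //.
  exact: (subvP (pcs_hom _ _ _ _)) (uP t).
- move=> i; apply/subvP=> u hu; rewrite -(sum_prj u); apply: rpred_sum => t _.
  have /(subvP (pc_span (lv t) _ _))/memv_sumP[G mG ->] := hom_comp (h_prj t) hu.
  rewrite comp_lfun_sumr; apply: rpred_sum => l _.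
  have lt_l : (lv t + l < bd + N)%N.
    by rewrite -addSn leq_add // ltnW // ltn_ord.
  rewrite memvE (sumv_sup (Ordinal lt_l)) // -memvE.
  rewrite (_ : inj t \c G l = inj t \c G l) //; apply/free_pieceP=> s /=.
  rewrite comp_lfunA prj_inj.
  have [<-|nst] := eqVneq t s; last by rewrite delta_neq // comp_lfun0l mem0v.
  by rewrite delta_eq comp_lfun1l /pcs leq_addr addKn mG.
- move=> i n F FS F0 a lt_a; rewrite -(sum_prj (F a)); apply: big1 => t _.
  rewrite [prj t \c _](_ : _ = 0) ?comp_lfun0r //.
  have [lt|le] := ltnP a (lv t).
    by have /free_pieceP/(_ t) := FS a; rewrite /pcs leqNgt lt memv0 => /eqP.
  have le_n : (lv t <= n)%N by apply: leq_trans le (ltnW lt_a).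
  have G0 := @pc_indep (lv t) i (ix t) (n - lv t) (fun l => prj t \c F (lv t + l)%N).
  rewrite -(subnKC le); apply: G0; last by rewrite ltn_sub2r // (leq_ltn_trans le).
    by move=> l; have /free_pieceP/(_ t) := FS (lv t + l)%N; rewrite /pcs leq_addr addKn.
  have : \sum_(a < lv t + (n - lv t)) F a = 0 by rewrite subnKC.
  rewrite big_split_ord /= => /(congr1 (fun f => prj t \c f)).
  rewrite comp_lfunDr comp_lfun0r !comp_lfun_sumr [X in X + _]big1 ?add0r //.
  move=> l _; have /free_pieceP/(_ t) := FS (lshift (n - lv t) l).
  by rewrite /pcs leqNgt /= ltn_ord memv0 => /eqP.
- move=> i a le_a; apply: zero_eq => u /free_pieceP uP.
  rewrite -(sum_prj u); apply: big1 => t _; have := uP t.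
  rewrite /pcs; case: ifP => [le|_]; last by rewrite memv0 => /eqP->; rewrite comp_lfun0r.
  rewrite pc_large; first by rewrite memv0 => /eqP->; rewrite comp_lfun0r.
  by rewrite leq_subRL // (leq_trans _ le_a) // leq_add2r ltnW.
move=> i j a m f g /free_pieceP fP Hg; apply/free_pieceP=> t.
by rewrite comp_lfunA; apply: pcs_comp (fP t) Hg.
Qed.

End LiftedProjective.

(** Composing with a surjection onto [K] from a sum of [P l]'s suffices, because
    every map [Q -> K] lifts along that surjection. *)
Lemma rad_into_projective K Q (i : 'Hom(K, Q)) :
    projective Q -> i \in homv K Q ->
    (forall l f, f \in homv (P l) K -> i \c f \in radv (P l) Q) ->
  i \in radv K Q.
Proof.
move=> pQ hi rad_i.
pose T : finType := {l : I & 'I_(\dim (homv (P l) K))}.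
pose b (t : T) : 'Hom(P (tag t), K) := (vbasis (homv (P (tag t)) K))`_(tagged t).
have hb t : b t \in homv (P (tag t)) K by apply: mem_vbasis_nth.
have [D [inj [prj [h_inj h_prj prj_inj sum1]]]] := biproduct_exists (fun t : T => P (tag t)).
pose e := \sum_t b t \c prj t.
have he : e \in homv D K by apply: rpred_sum => t _; apply: hom_comp.
have e_inj t : e \c inj t = b t by apply: biproduct_inj.
have epi_e : epi e.
  split=> //; apply: P_gen => [|l f hf]; first exact: limg_submodule.
  apply/subvP=> _ /memv_imgP[x _ ->].
  rewrite (coord_vbasis hf) sum_lfunE; apply: rpred_sum => s _.
  rewrite scale_lfunE; apply: rpredZ.
  have -> : (vbasis (homv (P l) K))`_s = b (Tagged (fun l => 'I_(\dim (homv (P l) K))) s) by [].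
  by rewrite -e_inj comp_lfunE memv_img ?memvf.
have rie : i \c e \in radv D Q.
  rewrite comp_lfun_sumr; apply: rpred_sum => t _; rewrite comp_lfunA.
  exact: rad_compr (rad_i _ _ (hb t)) (h_prj t).
apply/radvP; split=> // g hg.
have [g' hg' eg'] := projective_lift pQ epi_e hg.
apply: isom_one_sub_comm => //; rewrite -eg' comp_lfunA.
by apply: rad_one_sub; apply: rad_compr.
Qed.

(** The projective cover of a lifted module has one summand [P i], at depth [a],
    for each element of a basis of [S i a] modulo the maps that factor through
    smaller depths; homogeneity makes the kernel a lifted module again. *)
Lemma lifted_syzygy M S bd : lifted S bd (M := M) ->
  exists K (S' : forall i, nat -> {vspace 'Hom(P i, K)}) bd'
      (T : finType) (ix : T -> I) (lv : T -> nat) Q (i : 'Hom(K, Q)) (p : 'Hom(Q, M)),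
  [/\ lifted S' bd', projective Q /\ short_exact i p, i \in radv K Q &
      forall l a, (\dim (S l a) + \dim (S' l a) =
        \sum_t if (lv t <= a)%N then d (a - lv t) l (ix t) else 0)%N].
Proof.
move=> [Sh Ss Si Sl Sc].
pose R i a : {vspace 'Hom(P i, M)} :=
  (\sum_j \sum_(b < a) compv (S j b) (pc (a - b)%N b i j))%VS.
pose C i a := (S i a :\: R i a)%VS.
have RS i a : (R i a <= S i a)%VS.
  apply/subv_sumP=> j _; apply/subv_sumP=> b _; apply: compv_subP => f g Sf Hg.
  by have := Sc i j b (a - b)%N f g Sf Hg; rewrite subnKC // ltnW.
have CR i a : (C i a + R i a)%VS = S i a by rewrite addv_diff; apply/addv_idPl.
have CR0 i a : (C i a :&: R i a)%VS = 0%VS by apply: capv_diff.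
have CS i a : (C i a <= S i a)%VS by rewrite -CR addvSl.
pose T : finType := {ia : I * 'I_bd & 'I_(\dim (C ia.1 ia.2))}.
pose J (ia : I * 'I_bd) := 'I_(\dim (C ia.1 ia.2)).
pose mk l (b : 'I_bd) (s : 'I_(\dim (C l b))) : T := existT J (l, b) s.
pose ix (t : T) := (tag t).1; pose lv (t : T) : nat := (tag t).2.
pose gam (t : T) : 'Hom(P (ix t), M) := (vbasis (C (ix t) (lv t)))`_(tagged t).
have lv_bd t : (lv t < bd)%N by apply: ltn_ord.
have gamC t : gam t \in C (ix t) (lv t) by apply: mem_vbasis_nth.
have gamS t : gam t \in S (ix t) (lv t) by apply: (subvP (CS _ _)) (gamC t).
have [Q [inj [prj [h_inj h_prj prj_inj sum1]]]] := biproduct_exists (fun t : T => P (ix t)).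
have pQ : projective Q.
  by apply: (biproduct_projective h_inj h_prj sum1) => t; apply: P_proj.
pose SQ := free_piece lv inj.
have SQP i a (u : 'Hom(P i, Q)) := free_pieceP lv prj_inj sum1 a u.
have lQ : lifted SQ (bd + N) := lifted_free lv_bd h_inj h_prj prj_inj sum1.
pose p := \sum_t gam t \c prj t.
have hp : p \in homv Q M.
  by apply: rpred_sum => t _; apply: hom_comp => //; apply: (subvP (Sh _ _)) (gamS t).
have p_inj t : p \c inj t = gam t by apply: biproduct_inj.
have gam_pcs i a t (u : 'Hom(P i, P (ix t))) : u \in pcs (lv t) a i (ix t) ->
    gam t \c u \in S i a.
  rewrite /pcs; case: ifP => [le Hu|_]; last by rewrite memv0 => /eqP->; rewrite comp_lfun0r mem0v.
  by have := Sc i _ _ _ _ _ (gamS t) Hu; rewrite subnKC.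
have pSQ i a u : u \in SQ i a -> p \c u \in S i a.
  move/SQP=> uP; rewrite comp_lfun_suml; apply: rpred_sum => t _.
  by rewrite -comp_lfunA; apply: gam_pcs.
have Sp i a f : f \in S i a -> exists2 u, u \in SQ i a & f = p \c u.
  suff : (S i a <= postc (P i) p @: SQ i a)%VS.
    by move=> /subvP sub /sub/memv_imgP[u SQu ->]; exists u; rewrite ?postcE.
  have [q] := ubnP a; elim: q a i {f} => // q IHq a i; rewrite ltnS => le_aq.
  rewrite -CR subv_add; apply/andP; split; last first.
    apply/subv_sumP=> j _; apply/subv_sumP=> b _; apply: compv_subP => f g Sf Hg.
    have /(subvP (IHq b j (leq_trans (ltn_ord b) le_aq)))/memv_imgP[u SQu ->] := Sf.
    rewrite postcE -comp_lfunA -postcE; apply: memv_img.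
    by have := lifted_comp lQ SQu Hg; rewrite subnKC // ltnW.
  have [le|lt] := leqP bd a.
    by apply: subv_trans (CS i a) _; rewrite Sl // sub0v.
  apply/subvP=> f Cf; rewrite (coord_vbasis Cf); apply: rpred_sum => s _.
  apply: rpredZ; pose t := @mk i (Ordinal lt) s.
  rewrite (_ : _`_s = gam t) // -p_inj -postcE; apply: memv_img.
  exact: (inj_free_piece lv prj_inj sum1 t).
have ep : epi p.
  split=> //; apply: P_gen => [|i f hf]; first exact: limg_submodule.
  have /memv_sumP[F mF ->] := subvP (Ss i) _ hf.
  apply/subvP=> _ /memv_imgP[x _ ->]; rewrite sum_lfunE; apply: rpred_sum => a _.
  have [u _ ->] := Sp _ _ _ (mF a isT).
  by rewrite comp_lfunE memv_img ?memvf.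
(* A scalar component of a relation would express an element of the chosen
   complement [C l b] through smaller depths. *)
have core l (b : 'I_bd) u : u \in SQ l b -> p \c u = 0 ->
    forall s, prj (@mk l b s) \c u = 0.
  move=> /SQP uP pu0.
  have /fin_all_exists[c cP] : forall s, exists c, prj (@mk l b s) \c u = c *: \1%VF.
    move=> s; have := uP (@mk l b s); rewrite /pcs leqnn subnn pc0 delta_eq.
    by case/vlineP=> c ->; exists c.
  have : \sum_s c s *: (vbasis (C l b))`_s \in C l b.
    by apply: rpred_sum => s _; apply: rpredZ; apply: mem_vbasis_nth.
  pose F (ia : I * 'I_bd) (s : J ia) : 'Hom(P l, M) :=
    gam (existT J ia s) \c (prj (existT J ia s) \c u).
  have sumF : \sum_ia \sum_s F ia s = 0.
    rewrite -(sum_sigma (J := fun ia : I * 'I_bd => 'I_(\dim (C ia.1 ia.2))) F) -[RHS]pu0.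
    rewrite comp_lfun_suml; apply: eq_bigr => -[ia s] _.
    by rewrite -comp_lfunA.
  have restR : \sum_(ia | ia != (l, b)) \sum_s F ia s \in R l b.
    apply: rpred_sum => -[j b'] njb; apply: rpred_sum => s _.
    rewrite /F; set t := existT _ _ _; have := uP t; rewrite /pcs [ix t]/= [lv t]/=.
    have [lt|gt|/val_inj eb] := ltngtP b' b.
    - move=> Hu; rewrite memvE (sumv_sup j) // (sumv_sup (Ordinal lt)) // -memvE.
      apply: memv_compv Hu; exact: gamS t.
    - by rewrite memv0 => /eqP->; rewrite comp_lfun0r mem0v.
    subst b'; rewrite subnn pc0 delta_neq => [|]; last first.
      by apply: contraNneq njb => ->.
    by case/vlineP=> c' ->; rewrite scaler0 comp_lfun0r mem0v.
  have mainF : \sum_s F (l, b) s = \sum_s c s *: (vbasis (C l b))`_s.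
    apply: eq_bigr => s _; rewrite /F -/(@mk l b s) cP comp_scale.
    by rewrite comp_lfun1r.
  move: sumF; rewrite (bigD1 (l, b)) //= mainF => /eqP; rewrite addr_eq0 => /eqP sumF.
  move=> sumC s.
  have c0 : \sum_s c s *: (vbasis (C l b))`_s = 0.
    apply/eqP; rewrite -memv0 -(CR0 l b) memv_cap sumC /=.
    by rewrite sumF rpredN.
  have /freeP/(_ c c0 s) := basis_free (vbasisP (C l b)).
  by rewrite cP => ->; rewrite scale0r.
have [K [i [mi ip]]] := kernel_exists hp; have [hi i0] := mi.
have lK : lifted (fun l a => postc (P l) i @^-1: SQ l a)%VS (bd + N).
  apply: lifted_submodule lQ mi _ => l n F FS.
  have lim0 (u : 'Hom(P l, Q)) : (limg u <= limg i)%VS <-> p \c u = 0.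
    rewrite ip; split=> [/subvP sub|]; last exact: comp0_limg.
    apply/lfunP=> x; rewrite comp_lfunE zero_lfunE; apply/eqP; rewrite -memv_ker.
    by apply: sub; rewrite memv_img ?memvf.
  move/lim0; rewrite comp_lfun_sumr => F0 a lt_a; apply/lim0.
  by apply: (Si l n (fun a => p \c F a)) => // b; apply: pSQ.
exists K, (fun l a => postc (P l) i @^-1: SQ l a)%VS, (bd + N)%N, T, ix, lv, Q, i, p.
split=> //.
  apply: rad_into_projective => // l f hf.
  have /memv_sumP[F mF ->] := subvP (lifted_span lK l) _ hf.
  rewrite comp_lfun_sumr; apply: rpred_sum => a _.
  have := mF a isT; rewrite -memv_preim postcE; set u := i \c F a => SQu.
  have pu0 : p \c u = 0 by rewrite /u comp_lfunA kernel_comp0 // comp_lfun0l.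
  rewrite -(sum_prj sum1 u); apply: rpred_sum => t _.
  apply: rad_compl => //; have /SQP/(_ t) := SQu; rewrite /pcs.
  case: ifP => [le|_]; last by rewrite memv0 => /eqP->; apply: mem0v.
  have [lt|ge] := ltnP (lv t) a.
    by rewrite -(subnSK lt); apply: (subvP (pc_rad _ _ _ _)).
  have ea : lv t = a by apply/eqP; rewrite eqn_leq le.
  have [el|nl] := eqVneq (ix t) l; last first.
    by rewrite ea subnn pc0 delta_neq 1?eq_sym // => /vlineP[c ->]; rewrite scaler0 mem0v.
  rewrite -ea in SQu; case: t el SQu {le ge ea} => -[j b] s.
  move=> el SQu _; have ej : j = l := el; clear el; subst j.
  by rewrite (core l b u SQu pu0 s) mem0v.
move=> l a; rewrite -(dim_free_piece lv prj_inj).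
have <- := limg_ker_dim (postc (P l) p) (SQ l a).
have -> : (postc (P l) p @: SQ l a)%VS = S l a.
  apply/eqP; rewrite eqEsubv; apply/andP; split; apply/subvP=> f.
    by case/memv_imgP=> u SQu ->; rewrite postcE; apply: pSQ.
  by case/Sp=> u SQu ->; rewrite -postcE memv_img.
have -> : (SQ l a :&: lker (postc (P l) p))%VS =
    (postc (P l) i @: (postc (P l) i @^-1: SQ l a))%VS.
  apply/vspaceP=> u; rewrite memv_cap memv_ker postcE.
  apply/andP/memv_imgP=> [[SQu /eqP pu0]|[v Kv ->]].
    have hu := subvP (lifted_hom lQ _ _) _ SQu.
    have [h hh e] := factor_kernel mi ip hu pu0.
    by exists h; rewrite ?postcE // -memv_preim postcE -e.
  rewrite memv_preim Kv postcE comp_lfunA (kernel_comp0 ip) comp_lfun0l.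
  by split.
by rewrite addnC limg_dim_eq // postc_lker0 // capv0.
Qed.

(** ** Graded dimensions *)

Definition gdim M (S : forall i, nat -> {vspace 'Hom(P i, M)}) bd i : {poly int} :=
  \poly_(a < bd) (\dim (S i a))%:Z.

(** The entries of the graded Cartan matrix, which specialises to the ordinary one
    at [q = 1] and to the identity at [q = 0]. *)
Definition cartan_poly i j : {poly int} := \poly_(m < N) (d m i j)%:Z.

Lemma coef_gdim M S bd i a : lifted S bd (M := M) -> (gdim S bd i)`_a = (\dim (S i a))%:Z.
Proof.
move=> [_ _ _ Sl _]; rewrite coef_poly; case: ltnP => // le.
by rewrite Sl // dimv0.
Qed.

Lemma coef_cartan_poly i j m : (cartan_poly i j)`_m = (d m i j)%:Z.
Proof.
rewrite coef_poly; case: ltnP => // le.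
by rewrite -(pc_dim m 0) pc_large // dimv0.
Qed.

Lemma lifted_syzygy_gdim M S bd : lifted S bd (M := M) ->
  exists K (S' : forall i, nat -> {vspace 'Hom(P i, K)}) bd' Q
      (i : 'Hom(K, Q)) (p : 'Hom(Q, M)) (E : I -> {poly int}),
  [/\ lifted S' bd', projective Q /\ short_exact i p, i \in radv K Q &
      forall l, gdim S bd l + gdim S' bd' l = \sum_j cartan_poly l j * E j].
Proof.
move=> lM; have [K [S' [bd' [T [ix [lv [Q [i [p [lK pQ ri dimS]]]]]]]]]] := lifted_syzygy lM.
exists K, S', bd', Q, i, p, (fun j => \sum_(t | ix t == j) 'X^(lv t)); split=> // l.
transitivity (\sum_t cartan_poly l (ix t) * 'X^(lv t)); last first.
  rewrite (partition_big ix predT) //=; apply: eq_bigr => j _.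
  by rewrite big_distrr; apply: eq_bigr => t /eqP->.
apply/polyP=> a; rewrite coefD (coef_gdim _ _ lM) (coef_gdim _ _ lK) coef_sum.
rewrite -PoszD dimS -natz natr_sum; apply: eq_bigr => t _.
by rewrite coefMXn ltnNge natz; case: ifP => //= _; rewrite coef_cartan_poly.
Qed.

(** Along minimal lifted resolutions, graded dimensions of lifted modules are
    integral combinations of those of the lifted projectives; minimality makes
    the resolution stop as soon as a syzygy is projective. *)
Lemma lifted_gdim n M S bd :
    lifted S bd (M := M) -> pdim_at_most n M ->
  exists D : I -> {poly int}, forall i, gdim S bd i = \sum_j cartan_poly i j * D j.
Proof.
elim: n M S bd => [|n IHn] M S bd lM pM;
  have [K [S' [bd' [Q [i [p [E [lK [pQ sip] ri gE]]]]]]]] := lifted_syzygy_gdim lM.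
- exists E => l; rewrite -gE.
  suff zK : zero_mod K.
    rewrite [gdim S' _ _](_ : _ = 0) ?addr0 //; apply/polyP=> a.
    rewrite (coef_gdim _ _ lK) coef0 (_ : S' l a = 0%VS) ?dimv0 //.
    by apply: zero_eq => f _; apply: hom_zeror.
  have [mi ep ip] := sip; have [s hs ps] := projective_lift pM ep (hom_id M).
  have hp : p \in homv Q M by case: ep.
  have [||r hr er] := factor_kernel (u := \1%VF - s \c p) mi ip.
  + by rewrite rpredB ?hom_id ?hom_comp.
  + by rewrite comp_lfunBr comp_lfun1r comp_lfunA ps comp_lfun1l subrr.
  apply: rad_id; have -> : \1%VF = r \c i; last exact: rad_compl.
  apply: (mono_cancel mi); rewrite comp_lfunA -er comp_lfunBl comp_lfun1l comp_lfun1r.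
  by rewrite -comp_lfunA (kernel_comp0 ip) comp_lfun0r subr0.
have [|D DP] := IHn K S' bd' lK; first by apply: pM; exists Q, i, p.
exists (fun j => E j - D j) => l; rewrite -[LHS](addrK (gdim S' bd' l)) gE DP -sumrB.
by apply: eq_bigr => j _; rewrite mulrBr.
Qed.

(** The radical of [P j], as the sum of the images of all radical maps into it. *)
Lemma radical_submodule j : exists (K : rmodule A) (i : 'Hom(K, P j)), mono i /\
  forall l f, f \in homv (P l) (P j) -> (limg f <= limg i)%VS <-> f \in radv (P l) (P j).
Proof.
pose T : finType := {l : I & 'I_(\dim (radv (P l) (P j)))}.
pose b (t : T) : 'Hom(P (tag t), P j) := (vbasis (radv (P (tag t)) (P j)))`_(tagged t).
have rb t : b t \in radv (P (tag t)) (P j) by apply: mem_vbasis_nth.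
have [D [inj [prj [h_inj h_prj prj_inj sum1]]]] := biproduct_exists (fun t : T => P (tag t)).
pose e := \sum_t b t \c prj t.
have re : e \in radv D (P j) by apply: rpred_sum => t _; apply: rad_compr (rb t) (h_prj t).
have he := rad_hom re.
have e_inj t : e \c inj t = b t by apply: biproduct_inj.
have [K [i [mi ie]]] := submodule_mono (limg_submodule he); have [hi i0] := mi.
exists K, i; split=> // l f hf; rewrite ie; split=> [le|rf].
  have [|q hq eq] := factor_mono mi he; first by rewrite ie.
  have [|g hg eg] := factor_mono mi hf; first by rewrite ie.
  have epq : epi q.
    split=> //; apply: full_eq => x; have /memv_imgP[y _ ey] : i x \in limg e.
      by rewrite -ie memv_img ?memvf.
    have /eqP i0' := i0; have -> : x = q y by apply: (lker0P i0'); rewrite ey eq comp_lfunE.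
    by rewrite memv_img ?memvf.
  have [h hh qh] := projective_lift (@P_proj l) epq hg.
  by rewrite eg -qh comp_lfunA -eq; apply: rad_compr.
apply/subvP=> _ /memv_imgP[x _ ->].
rewrite (coord_vbasis rf) sum_lfunE; apply: rpred_sum => s _.
rewrite scale_lfunE; apply: rpredZ.
have -> : (vbasis (radv (P l) (P j)))`_s = b (existT (fun l => 'I_(\dim (radv (P l) (P j)))) l s) by [].
by rewrite -e_inj comp_lfunE memv_img ?memvf.
Qed.

Lemma dim_pc0 i j : d 0 i j = (i == j).
Proof.
rewrite -(pc_dim 0 0) pc0; have [<-|nij] := eqVneq i j.
  rewrite delta_eq dim_vline; case: eqP => // id0.
  have := @P_local i 1; rewrite id0 scaler0 mem0v => /(_ isT)/eqP.
  by rewrite oner_eq0.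
by rewrite delta_neq // vline0 dimv0.
Qed.

(** The radical of [P j] is a lifted module whose graded dimension is the [j]-th
    column of the graded Cartan matrix minus a unit vector; expressing it by
    the columns of that matrix provides the [j]-th column of an inverse. *)
Lemma cartan_poly_inverse n : (forall M, pdim_at_most n M) ->
  exists D : I -> I -> {poly int},
    forall i j, \sum_l cartan_poly i l * D l j = (i == j)%:R.
Proof.
move=> gld.
suff /fin_all_exists[D DP] : forall j, exists D : I -> {poly int},
    forall i, cartan_poly i j - (i == j)%:R = \sum_l cartan_poly i l * D l.
  exists (fun l j => (l == j)%:R - D j l) => i j.
  under eq_bigr => l _ do rewrite mulrBr.
  rewrite sumrB -DP (bigD1 j) //= eqxx mulr1 big1 ?addr0 => [|l /negPf->]; last by rewrite mulr0.
  by rewrite opprB addrC subrK.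
move=> j; have [K [i [mi radP]]] := radical_submodule j.
pose prj (t : unit) : 'Hom(P j, P j) := \1%VF.
have prj_inj (s t : unit) : prj t \c prj s = delta (fun _ : unit => P j) s t.
  by case: s t => -[]; rewrite comp_lfun1l delta_eq.
have sum1 : \sum_(t : unit) prj t \c prj t = \1%VF.
  by rewrite (bigD1 tt) //= comp_lfun1l big1 ?addr0 // => -[].
have hprj t : prj t \in homv (P j) (P j) by apply: hom_id.
have lP := @lifted_free unit (fun _ => j) (fun _ => 0%N) 1 (fun _ => isT) (P j)
  prj prj hprj hprj prj_inj sum1.
set S := free_piece _ _ in lP.
have SP l a (u : 'Hom(P l, P j)) : u \in S l a <-> u \in pc a 0 l j.
  split; first by move/(free_pieceP _ prj_inj sum1)/(_ tt); rewrite comp_lfun1l /pcs leq0n subn0.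
  by move=> Hu; apply/(free_pieceP _ prj_inj sum1) => t; rewrite comp_lfun1l /pcs leq0n subn0.
have lK : lifted (fun l a => postc (P l) i @^-1: S l a)%VS (1 + N).
  apply: lifted_submodule lP mi _ => l q F FS.
  have hF a : F a \in homv (P l) (P j) by apply: (subvP (pc_hom _ _ _ _)); apply/SP.
  have pos a : F a.+1 \in radv (P l) (P j).
    by apply: (subvP (pc_rad _ _ _ _)); apply/SP.
  move/radP => rad_sum a lt_a; apply/radP => //; case: a lt_a => // q0.
  have {rad_sum} := rad_sum; rewrite rpred_sum // => /(_ isT).
  case: q q0 => // q _; rewrite big_ord_recl => r.
  rewrite -[F 0%N](addrK (\sum_(a < q) F (lift ord0 a))); apply: rpredB => //.
  by apply: rpred_sum => a _; apply: pos.
have [D DP] := lifted_gdim lK (gld K); exists D => l; rewrite -DP.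
apply/polyP=> a; rewrite coefB (coef_gdim _ _ lK) coef_cartan_poly.
have hi : i \in homv K (P j) by case: mi.
have i0 : lker i = 0%VS by case: mi.
have imK : (postc (P l) i @: (postc (P l) i @^-1: S l a))%VS = (pc a 0 l j :&: radv (P l) (P j))%VS.
  apply/vspaceP=> u; rewrite memv_cap; apply/memv_imgP/andP=> [[v]|[Hu ru]].
    rewrite -memv_preim => Sv ->; split; first exact/SP.
    rewrite postcE in Sv *; apply/radP.
      by apply: (subvP (pc_hom _ _ _ _)); apply/SP; exact: Sv.
    by rewrite limg_comp limgS ?subvf.
  have hu := rad_hom ru.
  have [|h hh e] := factor_mono mi hu; first by apply/radP.
  by exists h; rewrite ?postcE // -memv_preim postcE -e; apply/SP.
rewrite -(limg_dim_eq (f := postc (P l) i)) ?postc_lker0 ?capv0 // imK.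
rewrite -(pc_dim a 0); case: a {imK} => [|a]; last first.
  by rewrite (capv_idPl (pc_rad _ _ _ _)) coefMn coef1 mul0rn subr0.
rewrite pc_dim dim_pc0 pc0 (_ : (_ :&: _)%VS = 0%VS) ?dimv0.
  by case: eqP; rewrite ?coef1 ?coef0 ?subrr.
have [<-|nlj] := eqVneq l j; last by rewrite delta_neq // vline0 cap0v.
rewrite delta_eq; apply: zero_eq => f; rewrite memv_cap.
by move=> /andP[/vlineP[c ->]] /P_local ->; rewrite scale0r.
Qed.

Lemma cartan_poly1 i j : (cartan_poly i j).[1] = (\dim (homv (P i) (P j)))%:Z.
Proof.
have -> : homv (P i) (P j) = (\sum_(l < N) pc l 0 i j)%VS.
  apply/eqP; rewrite eqEsubv pc_span; apply/subv_sumP=> l _; exact: pc_hom.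
have dir : directv (\sum_(l < N) pc l 0 i j)%VS.
  apply/directv_sum_independent => F mF F0 l _.
  pose G q := if insub q is Some o then F o else 0.
  have GE (o : 'I_N) : G o = F o by rewrite /G valK.
  rewrite -GE; apply: (@pc_indep 0 i j N G _ _ l (ltn_ord l)) => [q|].
    by rewrite /G; case: insubP => [o _ <-|_]; rewrite ?mem0v // mF.
  by rewrite -[RHS]F0; apply: eq_bigr => o _; rewrite GE.
rewrite (directvP dir) /= horner_poly -natz natr_sum; apply: eq_bigr => l _.
by rewrite expr1n mulr1 pc_dim natz.
Qed.

Lemma cartan_poly0 i j : (cartan_poly i j).[0] = (i == j)%:R.
Proof.
by rewrite horner_coef0 coef_cartan_poly dim_pc0; case: eqP.
Qed.

End Lifted.

(** * The Cartan determinant *)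

Lemma dim_le_inj (k : fieldType) (V W : vectType k) (U : {vspace V}) (U' : {vspace W})
    (phi : V -> W) :
    (forall c u v, u \in U -> v \in U -> phi (c *: u + v) = c *: phi u + phi v) ->
    (forall u v, u \in U -> v \in U -> phi u = phi v -> u = v) ->
    (forall u, u \in U -> phi u \in U') ->
  (\dim U <= \dim U')%N.
Proof.
move=> lin inj sub.
have phi0 : phi 0 = 0.
  have := lin 1 0 0 (mem0v U) (mem0v U); rewrite scale1r addr0 scale1r.
  by move/(congr1 (fun x => x - phi 0)); rewrite subrr addrK.
have phi_sum n (c : 'I_n -> k) (v : 'I_n -> V) : (forall i, v i \in U) ->
    phi (\sum_i c i *: v i) = \sum_i c i *: phi (v i).
  move=> vU; elim: n c v vU => [|n IHn] c v vU; first by rewrite !big_ord0.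
  rewrite !big_ord_recl lin // ?IHn //.
  by apply: rpred_sum => i _; rewrite rpredZ.
pose b (i : 'I_(\dim U)) := phi (vbasis U)`_i.
have bE (i : 'I_(\dim U)) : (mktuple b)`_i = b i by rewrite -tnth_nth tnth_mktuple.
have free_b : free (mktuple b).
  apply/freeP => c; under eq_bigr => i _ do rewrite bE.
  rewrite -(phi_sum _ c (fun i => (vbasis U)`_i)) => [|i]; last exact: mem_vbasis_nth.
  rewrite -phi0 => /inj e; have /freeP := basis_free (vbasisP U); apply.
  by apply: e; rewrite ?mem0v // rpred_sum // => i _; rewrite rpredZ ?mem_vbasis_nth.
have := free_b; rewrite /free size_tuple => /eqP<-; apply/dimvS/span_subvP => w.
by case/mapP=> i _ ->; apply/sub/mem_vbasis_nth.
Qed.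

Lemma dim_homv_isomorphic (k : fieldType) (A : falgType k) (M M' N N' : rmodule A) :
  isomorphic M M' -> isomorphic N N' -> \dim (homv M N) = \dim (homv M' N').
Proof.
have le (L L' R R' : rmodule A) : isomorphic L L' -> isomorphic R R' ->
    (\dim (homv L R) <= \dim (homv L' R'))%N.
  move=> /isomorphicP[f /isom_inv[f' [hf' _] [f'f _]]] /isomorphicP[g [hg [g' hg' [g'g _]]]].
  apply: (dim_le_inj (phi := fun u => g \c u \c f')) => [c u v _ _|u v _ _|u hu].
  - by rewrite comp_lfunDr comp_lfunDl comp_scale scale_comp.
  - move=> /(congr1 (fun w => g' \c w \c f)).
    by rewrite !comp_lfunA g'g !comp_lfun1l -!comp_lfunA f'f !comp_lfun1r.
  by rewrite !hom_comp.
move=> MM' NN'; apply/eqP; rewrite eqn_leq !le //; exact: isomorphic_sym.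
Qed.

Lemma isomorphic_projective (k : fieldType) (A : falgType k) (M M' : rmodule A) :
  isomorphic M M' -> projective M -> projective M'.
Proof.
move=> /isomorphicP[f [hf [g hg [gf fg]]]] pM; apply: stable_retract_projective pM.
have [Z zZ] := zero_mod_exists A.
exists g, f, Z, 0, 0; split; [by rewrite !rpred0 | exact: zero_projective |].
by rewrite fg comp_lfun0r addr0.
Qed.

Lemma indecomposable_representatives (k : fieldType) (A : falgType k) :
    representation_finite A ->
  exists (V : finType) (X : V -> rmodule A),
  [/\ forall v, indecomposable (X v),
      forall v w, isomorphic (X v) (X w) -> v = w &
      forall M : rmodule A, indecomposable M -> exists v, isomorphic M (X v)].
Proof.
move=> [r [X XP]].
pose sel i := indecomposable (X i) /\ forall j : 'I_r, (j < i)%N -> ~ isomorphic (X j) (X i).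
pose b i : bool := if excluded_middle_informative (sel i) then true else false.
have bP i : b i <-> sel i by rewrite /b; case: excluded_middle_informative.
exists {i : 'I_r | b i}, (fun v => X (val v)); split=> [[i /bP[]] //|[i bi] [j bj] /= iso|M indM].
  apply: val_inj => /=; have [_ ni] := (bP i).1 bi; have [_ nj] := (bP j).1 bj.
  case: (ltngtP i j) => [lt|gt|/val_inj //]; first by case: (nj i lt).
  by case: (ni j gt); apply: isomorphic_sym.
have [i iso] := XP M indM.
have [n] := ubnP (i : nat); elim: n i iso => // n IHn i iso; rewrite ltnS => le_in.
have [bi|nbi] := boolP (b i); first by exists (exist _ i bi).
have [j [lt ji]] : exists j : 'I_r, (j < i)%N /\ isomorphic (X j) (X i).
  apply: NNPP => no; case/negP: nbi; apply/bP; split.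
    exact: indecomposable_iso iso indM.
  by move=> j lt ji; apply: no; exists j.
apply: (IHn j); last exact: leq_trans lt le_in.
exact: isomorphic_trans iso (isomorphic_sym ji).
Qed.

(** The determinant is a unit of the ring of integral polynomials, hence constant,
    so that evaluating at 0 or at 1 makes no difference. *)
Lemma det_poly_unit (r : nat) (C : 'M[{poly int}]_r) (D : 'M[{poly int}]_r) :
    C *m D = 1%:M -> map_mx (horner_eval 0) C = 1%:M ->
  \det (map_mx (horner_eval 1) C) = 1.
Proof.
move=> CD C0; have detCD : \det C * \det D = 1 by rewrite -det_mulmx CD det1.
have det_at x : \det (map_mx (horner_eval x) C) = (\det C).[x].
  by rewrite (det_map_mx (horner_eval x : {rmorphism {poly int} -> int})).
have : \det C \is a GRing.unit by apply/unitrP; exists (\det D); rewrite mulrC detCD.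
rewrite poly_unitE => /andP[/size_poly1P[c _ detC] _].
by have := det_at 0; rewrite C0 det1 det_at detC !hornerC.
Qed.

Theorem cartan_det (k : closedFieldType) (A : falgType k) (r : nat)
    (P : 'I_r -> rmodule A) :
    representation_finite A -> finite_global_dimension A ->
    (forall i, indecomposable (P i)) -> (forall i, projective (P i)) ->
    (forall i j, isomorphic (P i) (P j) -> i = j) ->
    (forall (M : rmodule A) (U : {vspace M}), is_submodule U ->
       (forall i f, f \in homv (P i) M -> (limg f <= U)%VS) -> U = fullv) ->
  \det (\matrix_(i, j) (\dim (homv (P i) (P j)))%:Z) = 1.
Proof.
move=> /indecomposable_representatives[V [X [X_ind X_noniso X_complete]]] [g gld].
move=> P_ind P_proj P_noniso P_gen.
have /fin_all_exists[p pP] : forall i, exists v, isomorphic (P i) (X v).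
  by move=> i; apply: X_complete.
have p_inj : injective p.
  move=> i j e; apply: P_noniso; apply: isomorphic_trans (pP i) _.
  by rewrite e; apply: isomorphic_sym (pP j).
have [Ls LsP] := levels_exist X_ind X_noniso X_complete.
have Ls_arrows n : arrow_spaces (Ls n) by case: (LsP n).
have Ls_mesh n : mesh_compatible (Ls n) (Ls n.+1) by case: (LsP n).
have [N nil] := rad_pow_nilpotent X.
pose Y i := X (p i).
pose pc m n i j : {vspace 'Hom(Y i, Y j)} := piece Ls m n (p i) (p j).
pose d m i j := (\dim (rad_pow X m (p i) (p j)) - \dim (rad_pow X m.+1 (p i) (p j)))%N.
have Y_proj i : projective (Y i) by apply: isomorphic_projective (pP i) (P_proj i).
have Y_gen (M : rmodule A) (U : {vspace M}) : is_submodule U ->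
    (forall i f, f \in homv (Y i) M -> (limg f <= U)%VS) -> U = fullv.
  move=> sU YU; apply: P_gen sU _ => i f hf.
  have /isomorphicP[a [ha [b hb [ba _]]]] := pP i.
  apply: subv_trans (YU i (f \c b) (hom_comp hf hb)).
  by rewrite -{1}[f]comp_lfun1r -ba comp_lfunA limg_comp limgS ?subvf.
have Y_local i (c : k) : c *: \1%VF \in radv (Y i) (Y i) -> c = 0.
  exact: (scale_id_rad X_ind).
have pc_hom m n i j : (pc m n i j <= homv (Y i) (Y j))%VS by apply: (piece_hom Ls_arrows).
have pc0 n i j : pc 0 n i j = <[delta Y i j]>%VS.
  rewrite /pc /=; have [<-|nij] := eqVneq i j; first by rewrite !delta_eq.
  by rewrite !delta_neq // (inj_eq p_inj).
have pc_rad m n i j : (pc m.+1 n i j <= radv (Y i) (Y j))%VS.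
  apply: subv_trans (piece_rad_pow Ls_arrows _ _ _ _) _.
  rewrite /Y -rad_pow1; elim: m => [|m IHm]; first exact: subvv.
  exact: subv_trans (rad_pow_decr _ _ _ _) IHm.
have pc_comp m m' n i j l f h : f \in pc m n j l -> h \in pc m' (n + m)%N i j ->
    f \c h \in pc (m + m')%N n i l.
  exact: (piece_comp (Ls := Ls)).
have pc_large m n i j : (N <= m)%N -> pc m n i j = 0%VS by apply: (piece_large Ls_arrows nil).
have pc_span n i j : (homv (Y i) (Y j) <= \sum_(l < N) pc l n i j)%VS.
  exact: (rad_pow_pieces X_ind X_noniso Ls_arrows nil 0).
have pc_indep n i j q (F : nat -> 'Hom(Y i, Y j)) : (forall l, F l \in pc l n i j) ->
    \sum_(l < q) F l = 0 -> forall l, (l < q)%N -> F l = 0.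
  move=> FH F0 l lt_l; pose G l := if (l < q)%N then F l else 0.
  have GH m : G m \in piece Ls m n (p i) (p j).
    by rewrite /G; case: ifP => _; [apply: FH | apply: mem0v].
  have -> : F l = G l by rewrite /G lt_l.
  apply: (pieces_independent X_ind X_noniso Ls_arrows Ls_mesh nil GH).
  rewrite -(sum_pieces_large Ls_arrows nil q GH) addnC big_split_ord /=.
  rewrite [X in _ + X]big1 => [|m _]; last by rewrite /G ltnNge leq_addr.
  by rewrite addr0 -[RHS]F0; apply: eq_bigr => m _; rewrite /G ltn_ord.
have pc_dim m n i j : \dim (pc m n i j) = d m i j.
  exact: (dim_piece X_ind X_noniso Ls_arrows Ls_mesh nil).
have [D DP] := cartan_poly_inverse Y_proj Y_gen Y_local pc_hom pc0 pc_rad pc_comp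
  pc_large pc_span pc_indep pc_dim (fun M => pdim_le_at_most (gld M) (stable_retract_refl M)).
have := @det_poly_unit r (\matrix_(i, j) cartan_poly N d i j) (\matrix_(i, j) D i j).
have -> : map_mx (horner_eval 1) (\matrix_(i, j) cartan_poly N d i j) =
    \matrix_(i, j) (\dim (homv (P i) (P j)))%:Z.
  apply/matrixP=> i j; rewrite !mxE /horner_eval.
  rewrite (cartan_poly1 pc_hom pc_span pc_indep pc_dim) /Y.
  by rewrite (dim_homv_isomorphic (pP i) (pP j)).
apply; apply/matrixP=> i j; rewrite !mxE.
  by rewrite -DP; apply: eq_bigr => l _; rewrite !mxE.
by rewrite /horner_eval (cartan_poly0 Y_local pc0 pc_large pc_dim).
Qed.

(** * Morita equivalence *)

Section Idempotents.
Variables (k : fieldType) (A : falgType k).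
Implicit Types M N : rmodule A.

Lemma indecomposable_idempotent M (f : 'End(M)) :
    indecomposable M -> f \in homv M M -> f \c f = f -> f = 0 \/ f = \1%VF.
Proof.
move=> [_ ind] hf ff.
have fE x : f (f x) = f x by rewrite -comp_lfunE ff.
have cap0 : (limg f :&: lker f)%VS = 0%VS.
  apply: zero_eq => x; rewrite memv_cap memv_ker => /andP[/memv_imgP[y _ ->]].
  by rewrite fE => /eqP.
have sumT : (limg f + lker f)%VS = fullv.
  apply: full_eq => x; rewrite -[x](subrK (f x)) addrC; apply: memv_add.
    by rewrite memv_img ?memvf.
  by rewrite memv_ker linearB /= fE subrr.
have [f0|k0] := ind _ _ (limg_submodule hf) (lker_submodule hf) sumT cap0.
  left; apply/lfunP=> x; rewrite zero_lfunE; apply/eqP; rewrite -memv0 -f0.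
  by rewrite memv_img ?memvf.
right; apply/lfunP=> x; rewrite id_lfunE; have /eqP k0' := k0.
exact: (lker0P k0').
Qed.

Lemma idempotent_indecomposable M :
    ~ zero_mod M ->
    (forall f : 'End(M), f \in homv M M -> f \c f = f -> f = 0 \/ f = \1%VF) ->
  indecomposable M.
Proof.
move=> nzM idem; split=> // U V sU sV UV UV0.
have [M1 [M2 [i1 [i2 [p1 [p2 [[hi1 hi2 hp1 hp2] [_ _ iU iV] [p1i2 p2i1] ip]]]]]]] :=
  direct_sum_projections sU sV UV UV0.
have zero_img (L : rmodule A) (i : 'Hom(L, M)) : i = 0 -> limg i = 0%VS.
  by move=> ->; apply: zero_eq => _ /memv_imgP[x _ ->]; rewrite zero_lfunE.
have [||e|e] := idem (i1 \c p1).
- exact: hom_comp.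
- rewrite -[RHS]comp_lfun1r -ip comp_lfunDr (comp_lfunA _ i2) -(comp_lfunA i1 p1 i2).
  by rewrite p1i2 comp_lfun0r comp_lfun0l addr0.
- left; rewrite -iU; apply: zero_img; rewrite -[i1]comp_lfun1l -ip e add0r.
  by rewrite -comp_lfunA p2i1 comp_lfun0r.
right; rewrite -iV; apply: zero_img; rewrite -[i2]comp_lfun1l -e.
by rewrite -comp_lfunA p1i2 comp_lfun0r.
Qed.

Lemma epi_of_cancel M N (g : 'Hom(M, N)) : g \in homv M N ->
    (forall (Q : rmodule A) (p : 'Hom(N, Q)), p \in homv N Q -> p \c g = 0 -> p = 0) ->
  epi g.
Proof.
move=> hg cancel; split=> //.
have [Q [p [[hp pT] pk]]] := quotient_epi (limg_submodule hg).
have p0 : p = 0 by apply: cancel => //; apply: kernel_comp0.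
by rewrite -pk p0; apply: full_eq => x; rewrite memv_ker zero_lfunE.
Qed.

End Idempotents.

Section FunctorLaws.
Variables (k : fieldType) (C D : falgType k) (T : mod_functor C D).
Implicit Types L M N : rmodule C.

Lemma functor_hom M N (f : 'Hom(M, N)) : f \in homv M N -> fmor T f \in homv (T M) (T N).
Proof. by move/homvP/(fmor_hom (m := T))/homvP. Qed.

Lemma functor_comp L M N (f : 'Hom(M, N)) (g : 'Hom(L, M)) :
    f \in homv M N -> g \in homv L M ->
  fmor T (f \c g) = fmor T f \c fmor T g.
Proof. by move=> /homvP hf /homvP hg; apply: fmor_comp. Qed.

Lemma functor_linear M N c (f g : 'Hom(M, N)) :
    f \in homv M N -> g \in homv M N ->
  fmor T (c *: f + g) = c *: fmor T f + fmor T g.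
Proof. by move=> /homvP hf /homvP hg; apply: fmor_linear. Qed.

Lemma functor0 M N : fmor T (0 : 'Hom(M, N)) = 0.
Proof.
have h0 : (0 : 'Hom(M, N)) \in homv M N by apply: rpred0.
have := functor_linear 1 h0 h0; rewrite scale1r addr0 scale1r.
by move/(congr1 (fun x => x - fmor T 0)); rewrite subrr addrK.
Qed.

End FunctorLaws.

Section Equivalence.
Variables (k : fieldType) (A B : falgType k).
Variables (F : mod_functor A B) (G : mod_functor B A).
Variables (eta : forall M : rmodule A, 'Hom(M, G (F M)))
  (eps : forall N : rmodule B, 'Hom(F (G N), N)).
Hypothesis eta_iso : forall M, module_iso (eta M).
Hypothesis eta_nat : forall (M M' : rmodule A) (f : 'Hom(M, M')), module_hom f ->
  eta M' \c f = fmor G (fmor F f) \c eta M.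
Hypothesis eps_iso : forall N, module_iso (eps N).
Hypothesis eps_nat : forall (N N' : rmodule B) (f : 'Hom(N, N')), module_hom f ->
  eps N' \c fmor F (fmor G f) = f \c eps N.

Let eta_isom M : isom (eta M). Proof. exact/isomP/eta_iso. Qed.
Let eps_isom N : isom (eps N). Proof. exact/isomP/eps_iso. Qed.

Lemma left_faithful (M N : rmodule A) (f g : 'Hom(M, N)) :
  f \in homv M N -> g \in homv M N -> fmor F f = fmor F g -> f = g.
Proof.
move=> hf hg Ffg; apply: (mono_cancel (isom_mono (eta_isom N))).
by rewrite !eta_nat ?Ffg //; apply/homvP.
Qed.

Lemma right_faithful (M N : rmodule B) (f g : 'Hom(M, N)) :
  f \in homv M N -> g \in homv M N -> fmor G f = fmor G g -> f = g.
Proof.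
move=> hf hg Gfg; apply: (epi_cancel (isom_epi (eps_isom M))).
by rewrite -!eps_nat ?Gfg //; apply/homvP.
Qed.

Lemma right_full (M N : rmodule B) (h : 'Hom(G M, G N)) : h \in homv (G M) (G N) ->
  exists2 f, f \in homv M N & fmor G f = h.
Proof.
move=> hh; have [e [he _] [eM Me]] := isom_inv (eps_isom M); have [hN _] := eps_isom N.
have hf : eps N \c fmor F h \c e \in homv M N.
  by rewrite !hom_comp // functor_hom.
exists (eps N \c fmor F h \c e) => //; apply: left_faithful => //.
  exact: functor_hom.
apply: (mono_cancel (isom_mono (eps_isom N))); rewrite eps_nat; last exact/homvP.
by rewrite -comp_lfunA eM comp_lfun1r.
Qed.

Lemma left_full (M N : rmodule A) (h : 'Hom(F M, F N)) : h \in homv (F M) (F N) ->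
  exists2 f, f \in homv M N & fmor F f = h.
Proof.
move=> hh; have [e [he _] [eN Ne]] := isom_inv (eta_isom N); have [hM _] := eta_isom M.
have hf : e \c fmor G h \c eta M \in homv M N.
  by rewrite !hom_comp // functor_hom.
exists (e \c fmor G h \c eta M) => //; apply: right_faithful => //.
  exact: functor_hom.
apply: (epi_cancel (isom_epi (eta_isom M))); rewrite -eta_nat; last exact/homvP.
by rewrite !comp_lfunA Ne comp_lfun1l.
Qed.

Lemma right_dim (M N : rmodule B) : \dim (homv (G M) (G N)) = \dim (homv M N).
Proof.
apply/eqP; rewrite eqn_leq; apply/andP; split.
  have [e ie [eM Me]] := isom_inv (eps_isom M); have [hN _] := eps_isom N; have [he _] := ie.
  apply: (dim_le_inj (phi := fun h => eps N \c fmor F h \c e)) => [c u v hu hv|u v hu hv|h hh].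
  - by rewrite functor_linear // comp_lfunDr comp_lfunDl comp_scale scale_comp.
  - move/(epi_cancel (isom_epi ie))/(mono_cancel (isom_mono (eps_isom N))).
    exact: left_faithful.
  by rewrite !hom_comp ?functor_hom.
apply: (dim_le_inj (phi := fun h => fmor G h)) => [c u v|u v|h].
- exact: functor_linear.
- exact: right_faithful.
exact: functor_hom.
Qed.

Lemma right_isomorphic (M N : rmodule B) : isomorphic (G M) (G N) -> isomorphic M N.
Proof.
move=> /isomorphicP[h [hh [h' hh' [h'h hh1]]]].
have [f hf ef] := right_full hh; have [f' hf' ef'] := right_full hh'.
apply/isomorphicP; exists f; split=> //; exists f' => //; split;
  apply: right_faithful; rewrite ?hom_comp ?hom_id // functor_comp // ef ef' fmor_id //.
Qed.

Lemma right_nonzero (M : rmodule B) : ~ zero_mod M -> ~ zero_mod (G M).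
Proof.
move=> nzM /zero_modE GM0; apply: nzM; apply/zero_modE.
by apply: right_faithful; rewrite ?hom_id ?rpred0 // fmor_id functor0.
Qed.

Lemma left_nonzero (M : rmodule A) : ~ zero_mod M -> ~ zero_mod (F M).
Proof.
move=> nzM /zero_modE FM0; apply: nzM; apply/zero_modE.
by apply: left_faithful; rewrite ?hom_id ?rpred0 // fmor_id functor0.
Qed.

Lemma right_indecomposable (M : rmodule B) : indecomposable M -> indecomposable (G M).
Proof.
move=> indM; apply: idempotent_indecomposable.
  exact/right_nonzero/indecomposable_nz.
move=> h hh; have [f hf <-] := right_full hh => ff.
have [|->|->] := indecomposable_idempotent indM hf.
- by apply: right_faithful; rewrite ?hom_comp // functor_comp.
- by left; rewrite functor0.
by right; rewrite fmor_id.
Qed.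

(** Surjections are the epimorphisms, a notion that an equivalence preserves. *)
Lemma left_epi (M N : rmodule A) (g : 'Hom(M, N)) : epi g -> epi (fmor F g).
Proof.
move=> eg; have [hg _] := eg; apply: epi_of_cancel; first exact: functor_hom.
move=> Q p hp pg0; have [hN _] := eta_isom N.
apply: right_faithful; rewrite ?rpred0 // functor0.
apply: (epi_cancel (isom_epi (eta_isom N))); rewrite comp_lfun0l.
apply: (epi_cancel eg); rewrite comp_lfun0l -comp_lfunA eta_nat; last exact/homvP.
by rewrite comp_lfunA -functor_comp ?functor_hom // pg0 functor0 comp_lfun0l.
Qed.

Lemma right_projective (E : rmodule B) : projective E -> projective (G E).
Proof.
move=> pE M N g f /homvP hg gT /homvP hf; have eg : epi g by split.
have [e [he _] [eE Ee]] := isom_inv (eps_isom E); have [hE _] := eps_isom E.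
have [|h hh gh] := projective_lift (f := fmor F f \c e) pE (left_epi eg).
  by rewrite hom_comp ?functor_hom.
have [h' hh' eh'] := left_full (hom_comp hh hE).
exists h'; first exact/homvP.
apply: left_faithful; rewrite ?hom_comp // functor_comp // eh' comp_lfunA gh.
by rewrite -comp_lfunA eE comp_lfun1r.
Qed.

Lemma right_generating (I : finType) (E : I -> rmodule B) :
    (forall i, projective (E i)) ->
    (forall N, ~ zero_mod N -> exists i f, f \in homv (E i) N /\ f <> 0) ->
  forall (M : rmodule A) (U : {vspace M}), is_submodule U ->
    (forall i f, f \in homv (G (E i)) M -> (limg f <= U)%VS) -> U = fullv.
Proof.
move=> E_proj E_gen M U sU GU; have [Q [p [ep pk]]] := quotient_epi sU.
suff zQ : zero_mod Q.
  by rewrite -pk (hom_zeror p zQ); apply: full_eq => x; rewrite memv_ker zero_lfunE.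
apply: NNPP => /left_nonzero/E_gen[i [f [hf nf0]]]; apply: nf0.
have [hE _] := eps_isom (E i).
have [f' hf' ef'] := left_full (hom_comp hf hE).
have [f'' hf'' ef''] := projective_lift (right_projective (@E_proj i)) ep hf'.
apply: (epi_cancel (isom_epi (eps_isom (E i)))); rewrite comp_lfun0l -ef' -ef''.
rewrite (_ : p \c f'' = 0) ?functor0 //; apply/lfunP=> x.
rewrite comp_lfunE zero_lfunE; apply/eqP; rewrite -memv_ker pk.
by apply: (subvP (GU i f'' hf'')); rewrite memv_img ?memvf.
Qed.

End Equivalence.

(** * Projective modules of primitive idempotents *)

Section Principal.
Variables (k : fieldType) (B : falgType k) (n : nat) (e : 'I_n -> B).
Hypothesis e_prim : complete_primitive_orthogonal e.

Let ee i : e i * e i = e i.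
Proof. by have [orth _ _] := e_prim; rewrite orth eqxx. Qed.

Definition principal i : {vspace regular_rmodule B} := (<[e i]> * {: B})%VS.

Lemma principalP i (x : B) : x \in principal i <-> e i * x = x.
Proof.
split=> [|<-]; last by rewrite memv_mul ?memv_line ?memvf.
suff /subvP H : (principal i <= lker (amull (e i) - \1%VF))%VS.
  by move/H; rewrite memv_ker add_lfunE opp_lfunE id_lfunE lfunE subr_eq0 => /eqP.
apply/prodvP=> u v /vlineP[c ->] _.
rewrite memv_ker add_lfunE opp_lfunE id_lfunE lfunE /=.
by rewrite -!scalerAl -scalerAr mulrA ee subrr.
Qed.

Lemma principal_submodule i : is_submodule (principal i).
Proof. by move=> m a /principalP em; apply/principalP; rewrite /= mulrA em. Qed.

Definition principal_mod i := submod (@principal_submodule i).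

Lemma principal_gen i : e i \in principal i.
Proof. by apply/principalP; apply: ee. Qed.

Definition generator i : principal_mod i := vsproj (principal i) (e i : B).

Lemma generatorE i : vsval (generator i) = e i.
Proof. by rewrite /generator vsprojK // principal_gen. Qed.

Lemma principal_generated i (x : principal_mod i) : x = ract (generator i) (vsval x).
Proof.
apply: subvs_inj; rewrite (submod_actE (@principal_submodule i)) generatorE /=.
exact/esym/principalP/subvsP.
Qed.

Lemma principal_hom i (M : rmodule B) (m : M) : ract m (e i) = m ->
  exists f : 'Hom(principal_mod i, M), f \in homv (principal_mod i) M /\
    f (generator i) = m.
Proof.
move=> me.
have lin : linear (fun x : principal_mod i => ract m (vsval x)).
  by move=> c x y; rewrite linearP ract_linearr.
pose phi : {linear principal_mod i -> M} :=
  HB.pack (fun x : principal_mod i => ract m (vsval x))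
    (GRing.isLinear.Build k (principal_mod i) M _ _ lin).
exists (linfun phi); split; last by rewrite lfunE /= generatorE.
apply/homvP=> x a; rewrite !lfunE /=.
by rewrite (submod_actE (@principal_submodule i)) /= ractM.
Qed.

Lemma hom_generator i (M : rmodule B) (f : 'Hom(principal_mod i, M)) :
  f \in homv (principal_mod i) M -> ract (f (generator i)) (e i) = f (generator i).
Proof.
move=> hf; rewrite -(ractE _ _ hf); congr (f _).
by rewrite {2}[generator i]principal_generated generatorE.
Qed.

Lemma hom_principal_eq i (M : rmodule B) (f g : 'Hom(principal_mod i, M)) :
    f \in homv (principal_mod i) M -> g \in homv (principal_mod i) M ->
  f (generator i) = g (generator i) -> f = g.
Proof.
move=> hf hg fg; apply/lfunP=> x; rewrite [x]principal_generated.
by rewrite (ractE _ _ hf) (ractE _ _ hg) fg.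
Qed.

Lemma principal_projective i : projective (principal_mod i).
Proof.
move=> M N g f /homvP hg gT /homvP hf.
have /memv_imgP[m _ em] : f (generator i) \in limg g by rewrite gT memvf.
have [|h [hh eh]] := @principal_hom i M (ract m (e i)).
  by rewrite -ractM ee.
exists h; first exact/homvP.
apply: hom_principal_eq => //; first exact: hom_comp.
by rewrite comp_lfunE eh (ractE _ _ hg) -em hom_generator.
Qed.

Lemma principal_detects (M : rmodule B) : ~ zero_mod M ->
  exists i f, f \in homv (principal_mod i) M /\ f <> 0.
Proof.
move=> nzM; apply: NNPP => no; apply: nzM; apply: zero_eq => m _.
have [_ _ e1] := e_prim.
have ract_sum (I : finType) (F : I -> B) : ract m (\sum_i F i) = \sum_i ract m (F i).
  apply: (big_morph (ract m)) => [a b|].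
    by have := ract_linearr m 1 a b; rewrite !scale1r.
  by have := ractZr m 0 0; rewrite !scale0r.
rewrite -(ract1 m) -e1 ract_sum; apply: big1 => i _; apply: NNPP => nz; apply: no.
have [|f [hf fe]] := @principal_hom i M (ract m (e i)); first by rewrite -ractM ee.
by exists i, f; split=> // f0; apply: nz; rewrite -fe f0 zero_lfunE.
Qed.

Lemma principal_nonzero i : principal i <> 0%VS.
Proof.
move=> p0; have [_ prim _] := e_prim; have [_ + _] := prim i; apply.
by apply/eqP; rewrite -memv0 -p0 principal_gen.
Qed.

(** If [e = u + v] along a decomposition [U (+) V] of [e B] then [u] and [v] are
    orthogonal idempotents. *)
Lemma principal_indecomposable i : indecomposable (principal_mod i).
Proof.
split=> [z|U V sU sV UV UV0].
  apply: (@principal_nonzero i); apply/eqP; rewrite -dimv_eq0.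
  have := congr1 (fun W => \dim W) z; rewrite dimv0 dimvf /dim /= => ->; exact: eqxx.
have cap x : x \in U -> x \in V -> x = 0.
  by move=> Ux Vx; apply/eqP; rewrite -memv0 -UV0 memv_cap Ux.
have /memv_addP[u Uu [v Vv euv]] : generator i \in (U + V)%VS by rewrite UV memvf.
have eB : e i = vsval u + vsval v.
  by rewrite -generatorE euv linearD.
have actE (x : principal_mod i) a : vsval (ract x a) = vsval x * a.
  exact: (submod_actE (@principal_submodule i)).
have full W : is_submodule W -> generator i \in W -> W = fullv.
  by move=> sW Wg; apply: full_eq => x; rewrite [x]principal_generated; apply: sW.
have key (x y : principal_mod i) (X Y : {vspace principal_mod i}) :
    is_submodule X -> is_submodule Y -> x \in X -> y \in Y ->
    (forall z, z \in X -> z \in Y -> z = 0) -> e i = vsval x + vsval y ->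
    vsval x * vsval x = vsval x /\ vsval y * vsval x = 0.
  move=> sX sY Xx Yy XY0 exy.
  have ex : x - ract x (vsval x) = ract y (vsval x).
    apply: subvs_inj; rewrite linearB /= !actE.
    have /principalP {1}<- := subvsP x; rewrite exy mulrDl.
    by rewrite addrC addKr.
  have z0 : ract y (vsval x) = 0.
    by apply: XY0; [rewrite -ex rpredB // sX | apply: sY].
  split; last by rewrite -actE z0 linear0.
  by apply/esym/eqP; rewrite -subr_eq0 -actE -linearB ex z0 linear0.
have [uu vu] := key u v U V sU sV Uu Vv cap eB.
have [vv uv] : vsval v * vsval v = vsval v /\ vsval u * vsval v = 0.
  apply: (key v u V U) => //; first by move=> z Vz Uz; apply: cap.
  by rewrite addrC.
have [_ prim _] := e_prim; have [_ _ prim_i] := prim i.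
have [u0|v0] := prim_i _ _ uu vv uv vu eB.
  left; have VT : V = fullv.
    apply: full => //; rewrite euv (_ : u = 0) ?add0r //.
    by apply: subvs_inj; rewrite u0 linear0.
  by rewrite -UV0 VT capvf.
right; have UT : U = fullv.
  apply: full => //; rewrite euv (_ : v = 0) ?addr0 //.
  by apply: subvs_inj; rewrite v0 linear0.
by rewrite -UV0 UT capfv.
Qed.

Lemma principal_sum : directv (\sum_(i < n) principal i) /\
  (\sum_(i < n) principal i)%VS = fullv.
Proof.
have [orth _ e1] := e_prim; split.
  apply/directv_sum_independent => F mF F0 i _.
  have /principalP <- := mF i isT.
  have : e i * (\sum_(j < n) F j) = 0 by rewrite F0 mulr0.
  rewrite mulr_sumr (bigD1 i) //= big1 ?addr0 // => j nji.
  have /principalP <- := mF j isT.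
  by rewrite mulrA orth eq_sym (negPf nji) mul0r.
apply: full_eq => x; rewrite -[x]mul1r -e1 mulr_suml.
by apply: memv_sumr => i _; apply/principalP; rewrite mulrA ee.
Qed.

Lemma dim_hom_principal i j :
  \dim (homv (principal_mod j) (principal_mod i)) = \dim (<[e i]> * {: B} * <[e j]>)%VS.
Proof.
have memP (x : B) : x \in (<[e i]> * {: B} * <[e j]>)%VS <-> e i * x = x /\ x * e j = x.
  split=> [Hx|[ex xe]]; last first.
    by rewrite -xe -ex memv_mul ?memv_line // memv_mul ?memv_line ?memvf.
  split.
    have /subvP H : (<[e i]> * {: B} * <[e j]> <= principal i)%VS.
      by rewrite /principal -prodvA prodvSr ?subvf.
    exact/principalP/H.
  have /subvP H : (<[e i]> * {: B} * <[e j]> <= lker (amulr (e j) - \1%VF))%VS.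
    apply/prodvP=> u v _ /vlineP[c ->].
    rewrite memv_ker add_lfunE opp_lfunE id_lfunE lfunE /=.
    by rewrite -!scalerAr -!scalerAl -mulrA ee subrr.
  by move/H: Hx; rewrite memv_ker add_lfunE opp_lfunE id_lfunE lfunE subr_eq0 => /eqP.
apply/eqP; rewrite eqn_leq; apply/andP; split.
  apply: (dim_le_inj (phi := fun f : 'Hom(principal_mod j, principal_mod i) => vsval (f (generator j)))) => [c f g _ _|f g hf hg fg|f hf].
  - by rewrite add_lfunE scale_lfunE linearP.
  - exact: (hom_principal_eq hf hg (subvs_inj fg)).
  apply/memP; split; first exact/principalP/subvsP.
  have := hom_generator hf => /(congr1 (fun x => vsval x)).
  by rewrite (submod_actE (@principal_submodule i)).
have homP (x : B) : exists f : 'Hom(principal_mod j, principal_mod i),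
    x \in (<[e i]> * {: B} * <[e j]>)%VS ->
    f \in homv (principal_mod j) (principal_mod i) /\ vsval (f (generator j)) = x.
  have [/memP[ex xe]|nx] := boolP (x \in (<[e i]> * {: B} * <[e j]>)%VS); last first.
    by exists 0.
  have px : x \in principal i by apply/principalP.
  have [|f [hf fe]] := @principal_hom j (principal_mod i) (vsproj (principal i) x).
    by apply: subvs_inj; rewrite (submod_actE (@principal_submodule i)) vsprojK.
  by exists f => _; rewrite fe vsprojK.
pose phi x := proj1_sig (constructive_indefinite_description _ (homP x)).
have phiP x : x \in (<[e i]> * {: B} * <[e j]>)%VS ->
    phi x \in homv (principal_mod j) (principal_mod i) /\ vsval (phi x (generator j)) = x.
  by rewrite /phi; case: constructive_indefinite_description.
apply: (dim_le_inj (phi := phi)) => [c u v hu hv|u v hu hv uv|u hu].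
- have hw : c *: u + v \in (<[e i]> * {: B} * <[e j]>)%VS by rewrite rpredD ?rpredZ.
  have [[h1 e1] [[h2 e2] [h3 e3]]] := (phiP _ hw, (phiP _ hu, phiP _ hv)).
  apply: hom_principal_eq => //; first by rewrite rpredD ?rpredZ.
  by apply: subvs_inj; rewrite e1 add_lfunE scale_lfunE linearP /= e2 e3.
- by rewrite -(phiP _ hu).2 -(phiP _ hv).2 uv.
by case: (phiP _ hu).
Qed.

End Principal.

Theorem theoremA (k : closedFieldType) (A : falgType k)
    (repA : representation_finite A) (gldimA : finite_global_dimension A)
    (B : falgType k) (basicB : basic B) (moritaAB : morita_equivalent A B)
    (n : nat) (e : 'I_n -> B) (primB : complete_primitive_orthogonal e) :
  \det (cartan_matrix e) = 1.
Proof.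
have [F [G [eta [eps [eta_iso eta_nat eps_iso eps_nat]]]]] := moritaAB.
have [dir sum] := principal_sum primB.
have noniso := @basicB n (principal e) (@principal_submodule k B n e primB) dir sum
  (principal_indecomposable primB).
rewrite -[RHS](@cartan_det k A n (fun i => G (principal_mod primB i)) repA gldimA).
- rewrite -det_tr; congr (\det _); apply/matrixP=> i j; rewrite !mxE.
  by rewrite (right_dim eta_iso eta_nat eps_iso eps_nat) dim_hom_principal.
- move=> i; apply: (right_indecomposable eta_iso eta_nat eps_iso eps_nat).
  exact: principal_indecomposable.
- move=> i; apply: (right_projective eta_iso eta_nat eps_iso eps_nat).
  exact: principal_projective.
- move=> i j /(right_isomorphic eta_iso eta_nat eps_iso eps_nat) iso.
  by apply/eqP/negPn/negP => /noniso; apply.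
apply: (right_generating eta_iso eta_nat eps_iso eps_nat).
  exact: principal_projective.
exact: principal_detects.
Qed.
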